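(* Let $d\ge2$, let $I\subset\mathbb{R}$ be an open interval and $u\in BV(I;\mathbb{RP}^{d-1})$. Then there exists a lifting $n\in BV(I;\mathbb{S}^{d-1})$ of $u$ (i.e. $u=[n]$ a.e. in $I$) such that $$|D^an|(I)=|D^au|(I),\qquad|D^cn|(I)=|D^cu|(I),\qquad J_n=J_u,$$ and at every jump point $x\in J_u(=J_n)$, the traces $n^\pm(x)$ belong to $R^{-1}\cdot\overline U$ for some rotation $R\in SO(d)$ depending on $x$.
   Context: For $n\in\mathbb{S}^{d-1}$ (the unit sphere of $\mathbb{R}^d$), $[n]=\{\pm n\}$ denotes the corresponding element of $\mathbb{RP}^{d-1}=\mathbb{S}^{d-1}/\mathbb{Z}_2$, which carries the Riemannian metric induced from $\mathbb{S}^{d-1}$. Let $e_d=(0,\dots,0,1)\in\mathbb{R}^d$ and $$U=\{\omega\in\mathbb{S}^{d-1}:\ \mathrm{dist}_{\mathbb{S}^{d-1}}(\omega,e_d)<\pi/4\},$$ where $\mathrm{dist}_{\mathbb{S}^{d-1}}(\omega,e_d)=\arccos(\omega\cdot e_d)$ is the geodesic distance, and let $\overline U$ be its closure. For $\mathcal N$ a compact Riemannian manifold isometrically embedded in some $\mathbb{R}^D$, $BV(I;\mathcal N)$ is the set of maps $u\in L^1_{loc}(I;\mathbb{R}^D)$ such that $u(x)\in\mathcal N$ a.e. and $Du$ is a finite Radon measure. This set is independent of the embedding. One has $Du=D^au+D^cu+D^ju$ (absolutely continuous, Cantor and jump parts), $J_u$ is the jump set and $u^\pm$ are the one-sided traces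 at jump points. For $\mathbb{S}^{d-1}$ the standard embedding in $\mathbb{R}^d$ is used, and for $\mathbb{RP}^{d-1}$ any fixed isometric embedding into some $\mathbb{R}^D$ (its choice plays no role). Total variations are with respect to Euclidean norms. *)

(* Defs.v *)
From HB Require Import structures.
From mathcomp Require Import all_boot all_order all_algebra.
From mathcomp Require Import all_classical all_reals all_analysis.

Set Implicit Arguments.
Unset Strict Implicit.
Unset Printing Implicit Defensive.
Import Order.TTheory GRing.Theory Num.Theory.
Import numFieldNormedType.Exports.

Local Open Scope classical_set_scope.
Local Open Scope ring_scope.

Section euclidean.
Context {R : realType}.

(* The library's norm on row vectors is the sup norm; it induces the same
   topology as [enorm], but lengths and total variations need [enorm]. *)
Definition dot m (v w : 'rV[R]_m) : R := \sum_(i < m) v 0 i * w 0 i.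
Definition enorm m (v : 'rV[R]_m) : R := Num.sqrt (dot v v).

Definition sphere d : set 'rV[R]_d := [set v | enorm v = 1].

Definition last_vec d : 'rV[R]_d := \row_(j < d) ((j : nat) == d.-1)%:R.

Definition cap d : set 'rV[R]_d :=
  [set w | sphere w /\ acos (dot w (last_vec d)) < pi / 4].

Definition SO d : set 'M[R]_d :=
  [set Q | Q *m Q^T = 1%:M /\ \det Q = 1].

(* Vectors are rows, so the action of the matrix Q on v is v Q^T. *)
Definition rotate d (Q : 'M[R]_d) (v : 'rV[R]_d) : 'rV[R]_d := v *m Q^T.

End euclidean.

Section projective.
Context {R : realType}.

Definition proj_class d (n : 'rV[R]_d) : set 'rV[R]_d := [set n; - n].

Definition RP d : set (set 'rV[R]_d) := (@proj_class d) @` (sphere (d := d)).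

(* C^k on an open set O, through iterated directional derivatives. *)
Fixpoint Ck_on (V W : normedModType R) (k : nat) (O : set V) (f : V -> W) :=
  if k is k'.+1 then
    (forall x, O x -> differentiable f x) /\
    (forall v, Ck_on k' O (fun x => 'D_v f x))
  else forall x, O x -> {for x, continuous f}.

Definition smooth_on (V W : normedModType R) (O : set V) (f : V -> W) :=
  forall k, Ck_on k O f.

(* The 0-homogeneous extension to R^d \ {0} of the lift of iota to the sphere.
   Since S^{d-1} -> RP^{d-1} is a local diffeomorphism and x |-> x / |x| is a
   smooth retraction of R^d \ {0} onto S^{d-1}, iota is smooth on RP^{d-1} iff
   this map is smooth on R^d \ {0}, and at n in S^{d-1} its derivative in a
   direction v tangent to the sphere is the differential of iota at [n] applied
   to the tangent vector represented by v. *)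
Definition sphere_lift d D (iota : set 'rV[R]_d -> 'rV[R]_D) (x : 'rV[R]_d)
  : 'rV[R]_D := iota (proj_class ((enorm x)^-1 *: x)).

(* Isometric embedding of RP^{d-1} into R^D; only the values of iota on [RP d]
   matter.  As RP^{d-1} is compact, an injective immersion is an embedding. *)
Record isometric_embedding d D (iota : set 'rV[R]_d -> 'rV[R]_D) : Prop := {
  emb_inj : forall L M, RP L -> RP M -> iota L = iota M -> L = M ;
  emb_smooth : smooth_on [set x | x != 0] (sphere_lift iota) ;
  emb_isometry : forall n v w, sphere n -> dot n v = 0 -> dot n w = 0 ->
    dot ('D_v (sphere_lift iota) n) ('D_w (sphere_lift iota) n) = dot v w }.

End projective.

Section vector_measures.
Context {R : realType}.

(* R^m-valued measures on R, given by their components.  Charges are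
   finite-valued, and every finite Borel measure on R is Radon. *)
Definition vcharge m := 'I_m -> {charge set (measurableTypeR R) -> \bar R}.

Definition vcharge_val m (nu : vcharge m) (A : set R) : 'rV[R]_m :=
  \row_i fine (nu i A).

Definition tot_var m (nu : vcharge m) (A : set R) : \bar R :=
  ereal_sup [set (\sum_(0 <= k <oo) (enorm (vcharge_val nu (F k)))%:E)%E
    | F in [set F : (set (measurableTypeR R))^nat |
        [/\ forall k, measurable (F k), trivIset setT F & \bigcup_k F k = A]]].

Definition hahn_pos (nu : {charge set (measurableTypeR R) -> \bar R}) :=
  projT1 (cid (Hahn_decomposition nu)).
Definition hahn_neg (nu : {charge set (measurableTypeR R) -> \bar R}) :=
  projT1 (cid (projT2 (cid (Hahn_decomposition nu)))).
Lemma hahn_posneg (nu : {charge set (measurableTypeR R) -> \bar R}) :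
  hahn_decomposition nu (hahn_pos nu) (hahn_neg nu).
Proof. exact: projT2 (cid (projT2 (cid (Hahn_decomposition nu)))). Qed.

Definition charge_integral (nu : {charge set (measurableTypeR R) -> \bar R})
    (A : set R) (f : R -> R) : \bar R :=
  (\int[jordan_pos (hahn_posneg nu)]_(x in A) (f x)%:E
   - \int[jordan_neg (hahn_posneg nu)]_(x in A) (f x)%:E)%E.

Definition lebesgue_decomposition m (nu nua nus : vcharge m) : Prop :=
  [/\ forall i A, measurable A -> nu i A = (nua i A + nus i A)%E,
      forall i, nua i `<< @lebesgue_measure R &
      exists Z : set (measurableTypeR R),
        [/\ measurable Z, lebesgue_measure Z = 0%E &
            forall i A, measurable A -> nus i (A `\` Z) = 0%E]].

End vector_measures.

Section BV.
Context {R : realType}.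
Local Notation leb := (@lebesgue_measure R).

Definition test_function (I : set R) (phi : R -> R) : Prop :=
  (forall k x, derivable (derive1n k phi) x 1) /\
  exists K, [/\ compact K, K `<=` I & forall x, ~ K x -> phi x = 0].

(* A measure on I is encoded as a measure on R that vanishes off I. *)
Definition distributional_derivative m (I : set R) (u : R -> 'rV[R]_m)
    (Du : vcharge m) : Prop :=
  (forall i A, measurable A -> A `&` I = set0 -> Du i A = 0%E) /\
  (forall i phi, test_function I phi ->
     (\int[leb]_(x in I) (u x 0 i * derive1 phi x)%:E
      = - charge_integral (Du i) I phi)%E).

Definition BV m (I : set R) (N : set 'rV[R]_m) (u : R -> 'rV[R]_m) : Prop :=
  [/\ forall i, locally_integrable I (fun x => u x 0 i),
      {ae leb, forall x, I x -> N (u x)} &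
      exists Du : vcharge m, distributional_derivative I u Du].

(* Traces are approximate one-sided limits, hence independent of the choice of
   representative of u; in dimension one the orientation is the standard one. *)
Definition right_trace m (u : R -> 'rV[R]_m) (x : R) (a : 'rV[R]_m) : Prop :=
  ((r^-1)%:E * \int[leb]_(y in `]x, (x + r)%R[) (enorm (u y - a))%:E)%E
    @[r --> 0^'+] --> 0%E.
Definition left_trace m (u : R -> 'rV[R]_m) (x : R) (b : 'rV[R]_m) : Prop :=
  ((r^-1)%:E * \int[leb]_(y in `](x - r)%R, x[) (enorm (u y - b))%:E)%E
    @[r --> 0^'+] --> 0%E.

Definition jump_traces m (I : set R) (u : R -> 'rV[R]_m) (x : R)
    (up um : 'rV[R]_m) : Prop :=
  [/\ I x, up <> um, right_trace u x up & left_trace u x um].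

Definition jump_set m (I : set R) (u : R -> 'rV[R]_m) : set R :=
  [set x | exists up um, jump_traces I u x up um].

(* Du = Da + Dc + Dj: Da is the absolutely continuous part of Du, and Dj, Dc
   are the restrictions of its singular part to J_u and to the complement
   of J_u. *)
Definition BV_parts m (I : set R) (u : R -> 'rV[R]_m) (Da Dc Dj : vcharge m)
    : Prop :=
  exists Du Ds : vcharge m,
    [/\ distributional_derivative I u Du,
        lebesgue_decomposition Du Da Ds,
        forall i A, measurable A -> Dj i A = Ds i (A `&` jump_set I u) &
        forall i A, measurable A -> Dc i A = Ds i (A `\` jump_set I u)].

End BV.

(* Main.v *)
Require Import Defs.
From HB Require Import structures.
From mathcomp Require Import all_boot all_order all_algebra.
From mathcomp Require Import all_classical all_reals all_analysis.
From mathcomp Require Import measurable_realfun.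
From mathcomp Require Import ring lra.
Set Implicit Arguments.
Unset Strict Implicit.
Unset Printing Implicit Defensive.
Import Order.TTheory GRing.Theory Num.Theory.
Import numFieldNormedType.Exports.
Local Open Scope classical_set_scope.
Local Open Scope ring_scope.

(** [Du] is given only through test functions. The du Bois-Reymond lemma ties the values of [u] to
    the function x |-> Du(]-oo, x]) and so turns the problem into one about increments. Chords of
    the sphere and of its image have comparable but different lengths, so the sizes of the jumps of
    n and v are not compared; at a jump only the alternative q = p or q = - p matters. A non-obtuse
    angle between n(x-) and n(x) excludes n(x-) = - n(x), a jump that v would not see. Two unit
    vectors at such an angle lie within pi / 4 of their bisector, which is where the aperture of the
    cap comes from. The bound 1 / (2 C) keeps all lifts on one piece within 1/2 of a reference
    vector, hence within 1 of each other, and p . q = 1 - |p - q|^2 / 2. Because of the Cantor part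
    the variations cannot be compared through pointwise derivatives. They are compared on half-open
    intervals, with covers that are nearly optimal for the common dominating measure P. *)

(** Let f p = iota [p].  Up to a null set u is a right-continuous map v with
    values in f(S^{d-1}) whose increments are those of Du, hence are dominated
    by a finite measure P.  The map f is an immersion with f p = f q only for
    q = p or q = - p, so by compactness |p - q| <= C |f p - f q| as soon as
    p . q >= 0.  On a set where P(]-oo, x]) varies by less than 1 / (2 C) the
    values of v are so close that signs can be chosen to make all lifts
    pairwise non-obtuse; there are finitely many such pieces, and at the
    passage from one to the next the sign is chosen so that the left limit
    n(x-) and n(x) make a non-obtuse angle.  The resulting lift n has
    increments at most C times those of P(]-oo, x]), so it is BV, it jumps
    exactly where v does, and n(x-), n(x) lie in a common rotated cap.

    Off the jumps n is continuous, and as f is isometric to first order,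
    |f q - f q'| = (1 + o(1)) |q - q'| for q, q' near n(x).  Covering by short
    intervals gives |Dn|(A) = |Du|(A) for every Borel set A without jump
    points.  One Lebesgue-null set carries the singular part of P, so it
    splits both Du and Dn into their absolutely continuous and singular
    parts. *)

(** * The Euclidean norm and the sphere *)

Section euclidean_norm.
Context {R : realType} {m : nat}.
Implicit Types (u v w : 'rV[R]_m) (k : R).

Lemma dotC v w : dot v w = dot w v.
Proof. by apply: eq_bigr => i _; rewrite mulrC. Qed.

Lemma dotDl u v w : dot (u + v) w = dot u w + dot v w.
Proof. by rewrite -big_split/=; apply: eq_bigr => i _; rewrite mxE mulrDl. Qed.

Lemma dotZl k v w : dot (k *: v) w = k * dot v w.
Proof. by rewrite mulr_sumr; apply: eq_bigr => i _; rewrite mxE mulrA. Qed.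

Lemma dotNl v w : dot (- v) w = - dot v w.
Proof. by rewrite -scaleN1r dotZl mulN1r. Qed.

Lemma dotBl u v w : dot (u - v) w = dot u w - dot v w.
Proof. by rewrite dotDl dotNl. Qed.

Lemma dotDr u v w : dot w (u + v) = dot w u + dot w v.
Proof. by rewrite dotC dotDl !(dotC w). Qed.

Lemma dotZr k v w : dot w (k *: v) = k * dot w v.
Proof. by rewrite dotC dotZl (dotC w). Qed.

Lemma dotNr v w : dot w (- v) = - dot w v.
Proof. by rewrite dotC dotNl (dotC w). Qed.

Lemma dotBr u v w : dot w (u - v) = dot w u - dot w v.
Proof. by rewrite dotDr dotNr. Qed.

Lemma dot0l v : dot 0 v = 0.
Proof. by rewrite -(scale0r v) dotZl mul0r. Qed.

Definition dotE := (dotDl, dotDr, dotZl, dotZr, dotNl, dotNr).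

Lemma dot_ge0 v : 0 <= dot v v.
Proof. by apply: sumr_ge0 => i _; rewrite -expr2 sqr_ge0. Qed.

Lemma dot_eq0 v : dot v v = 0 -> v = 0.
Proof.
move/eqP; rewrite psumr_eq0 => [/allP h|i _]; last by rewrite -expr2 sqr_ge0.
apply/rowP => i; rewrite !mxE; apply/eqP.
by have := h i (mem_index_enum _); rewrite /= mulf_eq0 orbb.
Qed.

Lemma sqr_enorm v : enorm v ^+ 2 = dot v v.
Proof. by rewrite sqr_sqrtr ?dot_ge0. Qed.

Lemma enorm_ge0 v : 0 <= enorm v.
Proof. exact: sqrtr_ge0. Qed.

Lemma enorm0 : enorm (0 : 'rV[R]_m) = 0.
Proof. by rewrite /enorm dot0l sqrtr0. Qed.

Lemma enorm_eq0 v : enorm v = 0 -> v = 0.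
Proof. by move=> v0; apply: dot_eq0; rewrite -sqr_enorm v0 expr0n. Qed.

Lemma enorm_gt0 v : v != 0 -> 0 < enorm v.
Proof.
by move=> v0; rewrite lt0r enorm_ge0 andbT; apply: contra_neq v0 => /enorm_eq0.
Qed.

Lemma enormN v : enorm (- v) = enorm v.
Proof. by rewrite /enorm dotNl dotNr opprK. Qed.

Lemma enormBC v w : enorm (v - w) = enorm (w - v).
Proof. by rewrite -enormN opprB. Qed.

Lemma enormZ k v : enorm (k *: v) = `|k| * enorm v.
Proof.
by rewrite /enorm dotZl dotZr mulrA -expr2 sqrtrM ?sqr_ge0// sqrtr_sqr.
Qed.

Lemma normr_dot_le v w : `|dot v w| <= enorm v * enorm w.
Proof.
rewrite -(@ler_pXn2r _ 2)// ?nnegrE ?mulr_ge0 ?enorm_ge0//.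
rewrite exprMn !sqr_enorm real_normK ?num_real//.
have [w0|w0] := eqVneq (dot w w) 0.
  by rewrite (dot_eq0 w0) dotC dot0l expr0n mulr_ge0 ?dot_ge0.
have wpos : 0 < dot w w by rewrite lt0r w0 dot_ge0.
(* The square of this vector is [dot w w] times the gap in the inequality. *)
have := dot_ge0 (dot w w *: v - dot v w *: w).
rewrite !dotE (dotC w v) -subr_ge0 -(pmulr_rge0 _ wpos).
by congr (0 <= _); ring.
Qed.

Lemma dot_le_enorm v w : dot v w <= enorm v * enorm w.
Proof. exact: le_trans (ler_norm _) (normr_dot_le _ _). Qed.

Lemma enormD v w : enorm (v + w) <= enorm v + enorm w.
Proof.
rewrite -(@ler_pXn2r _ 2)// ?nnegrE ?addr_ge0 ?enorm_ge0//.
rewrite sqrrD !sqr_enorm !dotE (dotC w v).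
have := dot_le_enorm v w; lra.
Qed.

Lemma enormB v w : enorm (v - w) <= enorm v + enorm w.
Proof. by rewrite (le_trans (enormD _ _))// enormN. Qed.

Lemma enorm_distD u v w : enorm (v - w) <= enorm (v - u) + enorm (u - w).
Proof. by have := enormD (v - u) (u - w); rewrite addrA subrK. Qed.

Lemma ler_enorm_dist v w : `|enorm v - enorm w| <= enorm (v - w).
Proof.
have := enormD (v - w) w; have := enormD (w - v) v.
by rewrite !subrK (enormBC w v) ler_norml; lra.
Qed.

Lemma enorm_sum (J : Type) (s : seq J) (P : pred J) (F : J -> 'rV[R]_m) :
  enorm (\sum_(j <- s | P j) F j) <= \sum_(j <- s | P j) enorm (F j).
Proof.
elim/big_rec2 : _ => [|j y x Pj xy]; first by rewrite enorm0.
by rewrite (le_trans (enormD _ _))// lerD2l.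
Qed.

Lemma normr_coord_le v i : `|v 0 i| <= enorm v.
Proof.
rewrite -(@ler_pXn2r _ 2)// ?nnegrE ?enorm_ge0// sqr_enorm.
rewrite real_normK ?num_real// /dot (bigD1 i)//= -expr2 lerDl.
by apply: sumr_ge0 => j _; rewrite -expr2 sqr_ge0.
Qed.

Lemma enorm_le_sum v : enorm v <= \sum_i `|v 0 i|.
Proof.
rewrite -(@ler_pXn2r _ 2)// ?nnegrE ?enorm_ge0// ?sumr_ge0//.
rewrite sqr_enorm expr2 mulr_suml; apply: ler_sum => i _.
rewrite (le_trans (ler_norm _))// normrM ler_wpM2l//.
by rewrite (bigD1 i)//= lerDl sumr_ge0.
Qed.

Lemma mx_norm_le_enorm v : `|v| <= enorm v.
Proof.
rewrite -[leLHS]/(mx_norm v) mx_normrE; apply/bigmax_leP; split=> [|[i j] _].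
  exact: enorm_ge0.
by rewrite (ord1 i) normr_coord_le.
Qed.

Lemma cvg_dot (T : Type) (F : set_system T) {FF : Filter F}
    (f g : T -> 'rV[R]_m) v w : f @ F --> v -> g @ F --> w ->
  dot (f x) (g x) @[x --> F] --> dot v w.
Proof.
move=> fv gw; apply: cvg_big => [|i _]; first exact: add_continuous.
apply: cvgM.
  exact: (cvg_comp _ _ fv (@coord_continuous _ _ _ 0 i v)).
exact: (cvg_comp _ _ gw (@coord_continuous _ _ _ 0 i w)).
Qed.

Lemma cvg_enorm (T : Type) (F : set_system T) {FF : Filter F}
    (f : T -> 'rV[R]_m) v : f @ F --> v -> enorm (f x) @[x --> F] --> enorm v.
Proof.
move=> fv; apply: (cvg_comp (fun x => dot (f x) (f x)) Num.sqrt).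
  exact: (cvg_dot fv fv).
exact: sqrt_continuous.
Qed.

Lemma continuous_enorm : continuous (@enorm R m).
Proof. by move=> v; apply: (@cvg_enorm _ (nbhs v) _ id v); exact: cvg_id. Qed.

Lemma cvg_enorm_dist (T : Type) (F : set_system T) {FF : Filter F}
    (f : T -> 'rV[R]_m) v :
  f @ F --> v <-> enorm (f x - v) @[x --> F] --> 0.
Proof.
split=> [fv|fv].
  rewrite -enorm0; apply: cvg_enorm; rewrite -(subrr v).
  by apply: cvgB => //; exact: cvg_cst.
apply/cvgrPdist_lt => e e0; move/cvgrPdist_lt : fv => /(_ e e0).
apply: filterS => x; rewrite sub0r normrN ger0_norm ?enorm_ge0//.
by apply: le_lt_trans; rewrite distrC; exact: mx_norm_le_enorm.
Qed.

Lemma near_enorm (v : 'rV[R]_m) (e : R) : 0 < e ->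
  \forall w \near v, enorm (w - v) < e.
Proof.
move=> e0; have /cvg_enorm_dist/cvgrPdist_lt/(_ e e0) := @cvg_id _ (nbhs v).
by apply: filterS => w; rewrite sub0r normrN ger0_norm ?enorm_ge0.
Qed.

End euclidean_norm.

Section sphere_topology.
Context {R : realType} {d : nat}.
Implicit Types p q : 'rV[R]_d.

Lemma sphereP p : sphere p <-> dot p p = 1.
Proof.
rewrite /sphere/= -sqr_enorm; split=> [->|/eqP]; first by rewrite expr1n.
by rewrite sqrf_eq1 => /orP[/eqP//|/eqP p1]; have := enorm_ge0 p; rewrite p1; lra.
Qed.

Lemma sphereN p : sphere p -> sphere (- p).
Proof. by rewrite /sphere/= enormN. Qed.

Lemma sphere_neq0 p : sphere p -> p != 0.
Proof.
by rewrite /sphere/=; apply: contraPneq => ->; rewrite enorm0; lra.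
Qed.

Lemma sqr_sphere_dist p q : sphere p -> sphere q ->
  enorm (p - q) ^+ 2 = 2 - 2 * dot p q.
Proof.
by move=> /sphereP p1 /sphereP q1; rewrite sqr_enorm !dotE (dotC q p) p1 q1; ring.
Qed.

Lemma closed_sphere : closed (sphere (R := R) (d := d)).
Proof.
have -> : sphere (d := d) = (@enorm R d) @^-1` [set 1] by [].
apply: preimage_closed => [x _|]; last exact: closed_eq.
exact: continuous_enorm.
Qed.

Lemma compact_sphere : compact (sphere (R := R) (d := d)).
Proof.
apply: bounded_closed_compact; last exact: closed_sphere.
exists 1; split; first exact: num_real.
move=> x x1 p /= p1; rewrite (le_trans (mx_norm_le_enorm p))//.
by rewrite p1 ltW.
Qed.

End sphere_topology.

(** * The embedding of the projective space *)

Section strict_differentiability.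
Context {R : realType}.

Lemma nbhs_enormP m (v : 'rV[R]_m) (P : set 'rV[R]_m) :
  nbhs v P -> exists2 r : R, 0 < r & forall w, enorm (w - v) < r -> P w.
Proof.
move=> /nbhs_ballP[r /= r0 h]; exists r => // w wv; apply: h.
by rewrite -ball_normE/= distrC (le_lt_trans (mx_norm_le_enorm _)).
Qed.

Lemma is_derive_line (V : normedModType R) (G : V -> R) (a w : V) (t : R) :
  derivable G (a + t *: w) w ->
  is_derive t 1 (fun s : R => G (a + s *: w)) ('D_w G (a + t *: w)).
Proof.
have E : (fun h : R => h^-1 *: (((fun s : R => G (a + s *: w)) \o shift t)
             (h *: (1 : R)) - G (a + t *: w)))
    = (fun h => h^-1 *: ((G \o shift (a + t *: w)) (h *: w) - G (a + t *: w))).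
  apply/funext => h; congr (_ *: (G _ - _)).
  by rewrite /= [_ *: 1]mulr1 scalerDl addrCA.
move=> dG; split; first by rewrite /derivable E.
by rewrite /derive E.
Qed.

Lemma MVT01 (g dg : R -> R) :
  (forall t : R, 0 <= t <= 1 -> is_derive t 1 g (dg t)) ->
  exists2 c : R, 0 <= c <= 1 & g 1 - g 0 = dg c.
Proof.
move=> gd; have [||c] := @MVT_segment R g dg 0 1 ler01.
- by move=> x; rewrite in_itv/= => /andP[x0 x1]; apply: gd; rewrite !ltW.
- by apply: derivable_within_continuous => x; rewrite in_itv/= => /gd[].
by rewrite in_itv/= subr0 mulr1 => c01 gE; exists c.
Qed.

(** The mean value theorem is scalar, so it is applied to each component of [F] along the segment
    from [q'] to [q]. There the entries of the Jacobian are close to those at [p]. *)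
Lemma strict_differentiability m k (F : 'rV[R]_m -> 'rV[R]_k) (p : 'rV[R]_m)
    (e : R) :
  (\forall x \near p, differentiable F x) ->
  (forall v, {for p, continuous (fun x => 'D_v F x)}) -> 0 < e ->
  exists2 r : R, 0 < r & forall q q', enorm (q - p) < r -> enorm (q' - p) < r ->
    enorm (F q - F q' - 'D_(q - q') F p) <= e * enorm (q - q').
Proof.
(* The final error is a sum of [k * m] terms of size [e' * enorm w]; the successor covers the case
   [k * m = 0]. *)
move=> dF cF e0; pose e' := e / (k * m).+1%:R.
have e'0 : 0 < e' by rewrite divr_gt0.
have : \forall x \near p, differentiable F x /\
    forall (i : 'I_m) (j : 'I_k), `|jacobian F x i j - jacobian F p i j| < e'.
  have dFp := nbhs_singleton dF.
  have jE x i j : differentiable F x ->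
      jacobian F x i j = ('D_(delta_mx 0 i) F x) 0 j.
    by move=> dFx; rewrite (deriveEjacobian _ dFx) -rowE [RHS]mxE.
  have near_ij i j : \forall x \near p, `|jacobian F x i j - jacobian F p i j| < e'.
    have /cvgrPdistC_lt/(_ e' e'0) : (fun x => ('D_(delta_mx 0 i) F x) 0 j) @ p -->
        ('D_(delta_mx 0 i) F p) 0 j.
      exact: (cvg_comp _ _ (cF (delta_mx 0 i)) (@coord_continuous _ _ _ 0 j _)).
    apply: filterS2 dF => x dFx.
    by move: (jE x i j dFx) (jE p i j dFp) => /= <- <-; exact.
  have near_ijs : \forall x \near p, forall (i : 'I_m) (j : 'I_k),
      `|jacobian F x i j - jacobian F p i j| < e'.
    have := filter_forall _ (fun i => filter_forall _ (near_ij i)).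
    exact.
  exact: filterI dF near_ijs.
case/nbhs_enormP => r r0 hr; exists r => // q q' qr q'r.
set w := q - q'; rewrite (deriveEjacobian _ (hr p _).1) ?subrr ?enorm0//.
(* Balls are convex: the segment stays in the ball on which the Jacobian is controlled. *)
have hin (t : R) : 0 <= t <= 1 -> enorm (q' + t *: w - p) < r.
  move=> /andP[t0 t1].
  have -> : q' + t *: w - p = t *: (q - p) + (1 - t) *: (q' - p).
    by apply/rowP => i; rewrite !mxE; ring.
  rewrite (le_lt_trans (enormD _ _))// !enormZ !ger0_norm ?subr_ge0//.
  have [->|t0'] := eqVneq t 0; first by rewrite mul0r add0r subr0 mul1r.
  have tpos : 0 < t by rewrite lt0r t0'.
  have h1 : t * enorm (q - p) < t * r by rewrite ltr_pM2l.
  have h2 : (1 - t) * enorm (q' - p) <= (1 - t) * r.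
    by rewrite ler_wpM2l ?subr_ge0//; exact: ltW.
  lra.
rewrite (le_trans (enorm_le_sum _))//.
have hc (j : 'I_k) : `|(F q - F q' - w *m jacobian F p) 0 j| <= m%:R * e' * enorm w.
  have [|c c01 E] := @MVT01 (fun s : R => F (q' + s *: w) 0 j)
      (fun t => (w *m jacobian F (q' + t *: w)) 0 j).
    move=> t /hin/hr[dFt _].
    have dvF : derivable F (q' + t *: w) w by exact: diff_derivable.
    have := (derivable_mxP _ _ _).1 dvF 0 j.
    move/(@is_derive_line _ (fun x => F x 0 j)).
    by rewrite -(deriveEjacobian _ dFt) derive_mx// mxE.
  have qw : q' + 1 *: w = q by rewrite scale1r /w addrC subrK.
  rewrite qw scale0r addr0 in E.
  have -> : (F q - F q' - w *m jacobian F p) 0 j =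
      \sum_i w 0 i * (jacobian F (q' + c *: w) i j - jacobian F p i j).
    rewrite !mxE E !mxE -sumrB; apply: eq_bigr => i _.
    by rewrite mulrBr.
  rewrite (le_trans (ler_norm_sum _ _ _))//.
  apply: (@le_trans _ _ (\sum_(i < m) e' * enorm w)); last first.
    by rewrite sumr_const card_ord -[leRHS]mulrA mulr_natl.
  apply: ler_sum => i _.
  rewrite normrM mulrC ler_pM// ?normr_coord_le//.
  by apply/ltW; apply: (hr _ _).2; exact: hin.
apply: (@le_trans _ _ (\sum_(j < k) m%:R * e' * enorm w)); first exact: ler_sum.
rewrite sumr_const card_ord -[leLHS]mulr_natl !mulrA ler_wpM2r ?enorm_ge0//.
rewrite ler_pdivrMr// mulrC ler_wpM2l ?(ltW e0)//.
by rewrite -natrM ler_nat.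
Qed.

End strict_differentiability.

Section embedding.
Context {R : realType} {d D : nat} (iota : set 'rV[R]_d -> 'rV[R]_D).
Hypothesis emb : isometric_embedding iota.
Implicit Types p q : 'rV[R]_d.

Definition emb_line p := iota (proj_class p).
Local Notation f := emb_line.
Local Notation F := (sphere_lift iota).

Lemma proj_classN p : proj_class (- p) = proj_class p.
Proof. by rewrite /proj_class opprK setUC. Qed.

Lemma emb_lineN p : f (- p) = f p.
Proof. by rewrite /emb_line proj_classN. Qed.

Lemma sphere_lift_sphere p : sphere p -> F p = f p.
Proof. by rewrite /sphere/= /sphere_lift => ->; rewrite invr1 scale1r. Qed.

Lemma emb_line_inj p q : sphere p -> sphere q -> f p = f q -> q = p \/ q = - p.
Proof.
move=> p1 q1 /(emb_inj emb) pq.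
have : proj_class q q by left.
by rewrite -pq; [case; [left|right]|exists p|exists q].
Qed.

Lemma emb_line_inj_dot p q : sphere p -> sphere q -> 0 <= dot p q -> f p = f q ->
  p = q.
Proof.
move=> p1 q1 pq /(emb_line_inj p1 q1)[//|qp].
by exfalso; move: pq; rewrite qp dotNr ((sphereP _).1 p1); lra.
Qed.

Lemma near_neq0 p : p != 0 -> \forall x \near p, x != 0.
Proof.
move=> p0; apply: filterS (near_enorm p (enorm_gt0 p0)) => x.
by apply: contraTneq => ->; rewrite sub0r enormN ltxx.
Qed.

(* The linearization of F at p is isometric only on the tangent space; the
   component of q - q' along p is (q - q') . (p - (q + q') / 2), of higher
   order. *)
Lemma near_isometry p (e : R) : sphere p -> 0 < e ->
  exists2 r : R, 0 < r & forall q q', sphere q -> sphere q' ->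
    enorm (q - p) < r -> enorm (q' - p) < r ->
    `|enorm (f q - f q') - enorm (q - q')| <= e * enorm (q - q').
Proof.
move=> p1 e0; have p0 := sphere_neq0 p1.
have [dF cF] := emb_smooth emb 1.
have e20 : 0 < e / 2 by rewrite divr_gt0.
have nearF : \forall x \near p, differentiable F x.
  by have := near_neq0 p0; apply: filterS => x; exact: dF.
have [r r0 hr] := strict_differentiability nearF (fun v => cF v p p0) e20.
have dFp := dF p p0.
(* Dropping the component [s *: p] of [w] costs [|s| * (K - 1)] after differentiation and [|s|]
   before, together [|s| * K]. The radius [r'] makes this at most half of the allowed error; strict
   differentiability uses the other half. *)
pose K := enorm (p *m jacobian F p) + 1.
have K0 : 0 < K by rewrite ltr_wpDl ?enorm_ge0.
pose r' := Num.min r (e / 2 / K).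
have r'r : r' <= r by rewrite ge_min lexx.
have r'e : r' <= e / 2 / K by rewrite ge_min lexx orbT.
exists r'; first by rewrite lt_min r0 divr_gt0.
move=> q q' q1 q'1 qr q'r; set w := q - q'.
have := hr q q' (lt_le_trans qr r'r) (lt_le_trans q'r r'r).
rewrite (deriveEjacobian _ dFp) !sphere_lift_sphere// -/w => Hw.
pose s := dot w p; pose wT := w - s *: p.
have wT0 : dot p wT = 0.
  by rewrite /wT dotBr dotZr ((sphereP _).1 p1) mulr1 dotC subrr.
have iso : enorm (wT *m jacobian F p) = enorm wT.
  by rewrite /enorm -!(deriveEjacobian _ dFp) (emb_isometry emb).
have sE : s = dot w (p - 2^-1 *: (q + q')).
  rewrite /s /w !dotE ((sphereP _).1 q1) ((sphereP _).1 q'1) (dotC q' q).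
  by ring.
have hs : `|s| <= r' * enorm w.
  rewrite sE (le_trans (normr_dot_le _ _))// mulrC ler_wpM2r ?enorm_ge0//.
  have -> : p - 2^-1 *: (q + q') = - (2^-1 *: (q - p) + 2^-1 *: (q' - p)).
    by apply/rowP => i; rewrite !mxE; field.
  rewrite enormN (le_trans (enormD _ _))// !enormZ ger0_norm ?invr_ge0//.
  by lra.
have h1 : `|enorm (w *m jacobian F p) - enorm (wT *m jacobian F p)|
    <= `|s| * (K - 1).
  rewrite (le_trans (ler_enorm_dist _ _))// -mulmxBl.
  have -> : w - wT = s *: p by rewrite /wT opprB addrC subrK.
  by rewrite -scalemxAl enormZ /K addrK.
have h2 : `|enorm wT - enorm w| <= `|s|.
  rewrite (le_trans (ler_enorm_dist _ _))//.
  have -> : wT - w = - (s *: p) by rewrite /wT addrAC subrr add0r.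
  by rewrite enormN enormZ p1 mulr1.
have h3 := le_trans (ler_enorm_dist _ _) Hw.
have h4 : `|s| * K <= e / 2 * enorm w.
  rewrite (@le_trans _ _ (r' * enorm w * K)) ?ler_wpM2r ?(ltW K0)//.
  by rewrite mulrAC ler_wpM2r ?enorm_ge0// -ler_pdivlMr.
move: h1 h2 h3; rewrite iso !ler_norml => /andP[? ?] /andP[? ?] /andP[? ?].
by apply/andP; split; lra.
Qed.

Lemma continuous_sphere_lift p : p != 0 -> {for p, continuous F}.
Proof.
by move=> p0; apply: differentiable_continuous; exact: (emb_smooth emb 1).1.
Qed.

Lemma emb_RPE : iota @` RP (d := d) = f @` sphere (d := d).
Proof.
by rewrite /RP image_comp.
Qed.

Lemma compact_emb_line : compact (f @` sphere (d := d)).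
Proof.
have -> : f @` sphere (d := d) = F @` sphere (d := d).
  by apply: eq_imagel => p p1; rewrite sphere_lift_sphere.
apply: continuous_compact; last exact: compact_sphere.
apply: continuous_in_subspaceT => p; rewrite inE => /sphere_neq0.
exact: continuous_sphere_lift.
Qed.

Lemma closed_emb_line : closed (f @` sphere (d := d)).
Proof. by apply: compact_closed compact_emb_line. Qed.

(** The pairs at a non-obtuse angle form a compact set. Near a diagonal pair the estimate follows
    from [near_isometry]; near any other pair [f p] and [f q] stay apart, because [q = - p] is
    excluded, while [enorm (p - q)] is at most 2. *)
Lemma emb_line_inv_lipschitz : exists2 C : R, 0 < C &
  forall p q, sphere p -> sphere q -> 0 <= dot p q ->
    enorm (p - q) <= C * enorm (f p - f q).
Proof.
pose S := @sphere R d.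
pose K : set ('rV[R]_d * 'rV[R]_d) := (S `*` S) `&` [set x | 0 <= dot x.1 x.2].
have cK : compact K.
  apply: compact_closedI; first by apply: compact_setX; exact: compact_sphere.
  apply: (@preimage_closed _ _ (fun x => dot x.1 x.2) [set t | 0 <= t]).
    by move=> x _; apply: cvg_dot; [exact: cvg_fst|exact: cvg_snd].
  exact: closed_ge.
(* It is enough to prove the bound near each pair of [K] for all large [N]; compactness then yields
   a common [N]. *)
have := (compact_near_coveringP K).1 cK nat \oo
  (fun N x => S x.1 -> S x.2 -> 0 <= dot x.1 x.2 ->
    enorm (x.1 - x.2) <= N%:R * enorm (f x.1 - f x.2)) _.
case=> [[p q] [[/= p1 q1] pq]|N _ /(_ N (leqnn N)) hN]; last first.
  exists N.+1%:R => // p q p1 q1 pq.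
  rewrite (le_trans (hN (p, q) (conj (conj p1 q1) pq) p1 q1 pq))//.
  by rewrite ler_wpM2r ?enorm_ge0// ler_nat.
suff [r [c [r0 hrc]]] : exists r c : R, 0 < r /\
    forall p' q', S p' -> S q' -> enorm (p' - p) < r -> enorm (q' - q) < r ->
      enorm (p' - q') <= c * enorm (f p' - f q').
  exists ([set x | enorm (x.1 - p) < r /\ enorm (x.2 - q) < r],
          [set n | c <= n%:R]) => /=.
    split; last exact: nbhs_infty_ger.
    exists ([set x | enorm (x - p) < r], [set x | enorm (x - q) < r]).
      by split; exact: near_enorm.
    by case=> [? ?] [].
  case=> [[p' q'] n] /= [[p'r q'r] cn] p'1 q'1 _.
  by rewrite (le_trans (hrc _ _ p'1 q'1 p'r q'r))// ler_wpM2r ?enorm_ge0.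
have [pqE|pq0] := eqVneq p q.
  have half0 : 0 < 2^-1 :> R by rewrite invr_gt0.
  have [r r0 hr] := near_isometry p1 half0.
  exists r, 2; split=> // p' q' p'1 q'1 p'r; rewrite -pqE => q'r.
  by have := hr _ _ p'1 q'1 p'r q'r; rewrite ler_norml => /andP[]; lra.
have fpq : f p - f q != 0.
  by rewrite subr_eq0; apply: contra_neq pq0; exact: emb_line_inj_dot.
set c0 := enorm (f p - f q); have c00 : 0 < c0 := enorm_gt0 fpq.
have [r1 r10 hr1] := near_isometry p1 ltr01.
have [r2 r20 hr2] := near_isometry q1 ltr01.
(* Near [p] and near [q] the map [f] is 2-Lipschitz, so each image moves by at most [c0 / 4]. This
   leaves [enorm (f p' - f q') >= c0 / 2], and [4 / c0] times that is at least 2. *)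
exists (Num.min (Num.min r1 r2) (c0 / 8)), (4 / c0).
split; first by rewrite !lt_min r10 r20 divr_gt0.
move=> p' q' p'1 q'1; rewrite !lt_min => /andP[/andP[p'r1 _] p'c].
move=> /andP[/andP[_ q'r2] q'c].
have := hr1 p' p p'1 p1 p'r1; rewrite subrr enorm0 => /(_ r10).
rewrite ler_norml => /andP[_ fp'].
have := hr2 q' q q'1 q1 q'r2; rewrite subrr enorm0 => /(_ r20).
rewrite ler_norml => /andP[_ fq'].
have h1 : c0 <= enorm (f p' - f p) + enorm (f q' - f q) + enorm (f p' - f q').
  rewrite /c0; have -> : f p - f q = - (f p' - f p) + (f q' - f q) + (f p' - f q').
    by apply/rowP => i; rewrite !mxE; ring.
  rewrite (le_trans (enormD _ _))// lerD2r (le_trans (enormD _ _))//.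
  by rewrite enormN.
have h2 : enorm (p' - q') <= 2.
  by rewrite (le_trans (enormB _ _))// p'1 q'1.
rewrite (le_trans h2)// mulrAC ler_pdivlMr//; lra.
Qed.

End embedding.

(** * Rotations and the cap *)

Section rotations.
Context {R : realType} {d : nat}.
Implicit Types p q b w : 'rV[R]_d.

Lemma dot_mulmx p q : dot p q = (p *m q^T) 0 0.
Proof. by rewrite mxE; apply: eq_bigr => i _; rewrite mxE. Qed.

Lemma orthogonal_dot (Q : 'M[R]_d) p q : Q^T *m Q = 1%:M ->
  dot (p *m Q^T) (q *m Q^T) = dot p q.
Proof.
move=> QQ; rewrite !dot_mulmx trmx_mul trmxK mulmxA -(mulmxA p) QQ mulmx1.
by [].
Qed.

Lemma sphere_last_vec : (0 < d)%N -> sphere (last_vec d : 'rV[R]_d).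
Proof.
move=> d0; apply/sphereP; have ld : (d.-1 < d)%N by rewrite prednK.
rewrite /dot (bigD1 (Ordinal ld))//= !mxE eqxx mulr1 big1 ?addr0// => i id.
rewrite !mxE; suff /negPf-> : (i : nat) != d.-1 by rewrite mul0r.
by move: id; rewrite -val_eqE.
Qed.

(* Q is a Householder reflection, or 1. *)
Lemma orthogonal_transitive p q : sphere p -> sphere q ->
  exists Q : 'M[R]_d, Q *m Q^T = 1%:M /\ p *m Q^T = q.
Proof.
move=> p1 q1; have [->|pq] := eqVneq p q.
  by exists 1%:M; rewrite trmx1 !mulmx1.
pose w := p - q; have w0 : dot w w != 0.
  by apply: contra_neq pq => /dot_eq0/subr0_eq.
pose k := 2 / dot w w.
pose H := 1%:M - k *: (w^T *m w).
have HT : H^T = H.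
  by rewrite /H raddfB/= trmx1 linearZ/= trmx_mul trmxK.
have act v : v *m H = v - (k * dot v w) *: w.
  rewrite /H mulmxBr mulmx1 -scalemxAr mulmxA [v *m w^T]mx11_scalar.
  by rewrite -dot_mulmx mul_scalar_mx scalerA.
exists H; rewrite HT; split.
  apply/row_matrixP => i; rewrite rowE mulmxA !act rowE mulmx1.
  rewrite dotBl dotZl -addrA -opprD -scalerDl.
  set x := dot _ _; have -> : k * x + k * (x - k * x * dot w w) = 0.
    by rewrite /k; field.
  by rewrite scale0r subr0.
rewrite act; have -> : k * dot p w = 1; last by rewrite scale1r /w opprB addrC subrK.
rewrite /k; apply: (mulIf w0); rewrite mul1r mulrAC divfK//.
rewrite /w !dotE ((sphereP _).1 p1) ((sphereP _).1 q1) (dotC q p).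
by ring.
Qed.

(** If the orthogonal map found has determinant -1, it is followed by a sign change of the first
    coordinate, which fixes [last_vec d] because [d >= 2]. *)
Lemma rotation_last_vec p : (2 <= d)%N -> sphere p ->
  exists2 Q : 'M[R]_d, SO Q & p *m Q^T = last_vec d.
Proof.
move=> d2 p1; have d0 : (0 < d)%N by exact: ltnW.
have [Q [QQ pQ]] := orthogonal_transitive p1 (sphere_last_vec d0).
have : \det Q ^+ 2 = 1 by rewrite expr2 -{2}det_tr -det_mulmx QQ det1.
move/eqP; rewrite sqrf_eq1 => /orP[/eqP Q1|/eqP QN1]; first by exists Q.
pose s : 'rV[R]_d := \row_j (if j == Ordinal d0 then -1 else 1).
have ss : diag_mx s *m diag_mx s = 1%:M.
  rewrite mulmx_diag -diag_const_mx; congr diag_mx; apply/rowP => j.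
  by rewrite !mxE; case: ifP => _; rewrite ?mulrNN mulr1.
have dets : \det (diag_mx s) = -1.
  rewrite det_diag (bigD1 (Ordinal d0))//= mxE eqxx big1 ?mulr1// => j j0.
  by rewrite mxE (negbTE j0).
exists (diag_mx s *m Q).
  split; last by rewrite det_mulmx dets QN1 mulrNN mulr1.
  by rewrite trmx_mul tr_diag_mx mulmxA -(mulmxA _ Q) QQ mulmx1 ss.
rewrite trmx_mul mulmxA pQ tr_diag_mx mul_mx_diag; apply/rowP => j.
rewrite !mxE; have [->/=|_] := eqVneq j (Ordinal d0); last by rewrite mulr1.
rewrite (_ : (0%N == d.-1) = false) ?mul0r//; apply/negbTE.
by rewrite eq_sym -lt0n -ltnS prednK.
Qed.

Lemma sqr_cos_piquarter : 2 * cos (pi / 4) ^+ 2 = 1 :> R.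
Proof.
have : cos ((pi / 4) *+ 2) = 0 :> R.
  by rewrite -cos_pihalf; congr cos; rewrite -mulr_natr; field.
by rewrite cos_mulr2n -mulr_natl; lra.
Qed.

Lemma cos_piquarter_gt0 : 0 < cos (pi / 4) :> R.
Proof. by apply: cos_gt0_pihalf; have := @pi_gt0 R; lra. Qed.

Lemma acos_lt_piquarter (x : R) : x <= 1 -> cos (pi / 4) < x -> acos x < pi / 4.
Proof.
move=> x1 cx; have x1' : -1 <= x <= 1.
  by rewrite x1 andbT; have := cos_piquarter_gt0; lra.
rewrite -ltr_cos ?in_itv/= ?acos_ge0 ?acos_lepi ?acosK ?in_itv//=.
by have := @pi_gt0 R; lra.
Qed.

(** Adding [t *: e] with small [t > 0] and normalizing moves [w] strictly towards the pole, hence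
    into the open cap, and tends to [w] with [t]. *)
Lemma closure_cap w : (0 < d)%N -> sphere w ->
  cos (pi / 4) <= dot w (last_vec d) -> closure (cap (d := d)) w.
Proof.
move=> d0 w1; set e := last_vec d => cw.
have e1 : sphere e by exact: sphere_last_vec.
have [ee ww] := ((sphereP _).1 e1, (sphereP _).1 w1).
have cpos := cos_piquarter_gt0.
set s := dot w e in cw *.
have s1 : s <= 1 by rewrite (le_trans (dot_le_enorm _ _))// w1 e1 mulr1.
pose v (t : R) := w + t *: e.
pose g (t : R) := (enorm (v t))^-1 *: v t.
have cv : v t @[t --> 0^'+] --> w.
  rewrite -[w in _ --> w]addr0 -(scale0r e); apply: cvgD; first exact: cvg_cst.
  by apply: cvgZr_tmp; apply: cvg_at_right_filter; exact: cvg_id.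
have cg : g t @[t --> 0^'+] --> w.
  rewrite -[w in _ --> w]scale1r -invr1; apply: cvgZ => //; apply: cvgV => //.
  by rewrite -w1; exact: cvg_enorm.
move=> B /cg Bg.
have [t [t0 Bt]] : exists t, 0 < t /\ B (g t).
  near (0 : R)^'+ => t; exists t; split=> //.
  by near: t; exact: Bg.
exists (g t); split=> //.
have vt : enorm (v t) ^+ 2 = 1 + 2 * t * s + t ^+ 2.
  by rewrite sqr_enorm /v !dotE ee ww (dotC e w) -/s; ring.
have vpos : 0 < enorm (v t).
  by rewrite lt0r enorm_ge0 andbT -sqrf_eq0 vt; nra.
have g1 : sphere (g t).
  by rewrite /sphere/= /g enormZ ger0_norm ?invr_ge0 ?enorm_ge0// mulVf ?gt_eqF.
split=> //; apply: acos_lt_piquarter.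
  by rewrite (le_trans (dot_le_enorm _ _))// g1 e1 mulr1.
rewrite /g dotZl ltr_pdivlMl// /v dotDl dotZl ee -/s mulr1.
rewrite -(@ltr_pXn2r _ 2)// ?nnegrE; [|nra|nra].
rewrite exprMn vt; set c := cos _ in cw cpos *.
have c2 : 2 * c ^+ 2 = 1 by exact: sqr_cos_piquarter.
nra.
Unshelve. all: by end_near. Qed.

(** The rotation carries the normalized bisector [b] to the pole. With [m = enorm (p + q)], both
    [dot p b] and [dot q b] equal [m / 2], and [m ^+ 2 = 2 + 2 * dot p q >= 2] makes this at least
    cos (pi / 4). *)
Lemma rotate_closure_cap p q : (2 <= d)%N -> sphere p -> sphere q ->
  0 <= dot p q -> exists2 Q : 'M[R]_d, SO Q &
    (rotate (invmx Q) @` closure (cap (d := d))) p /\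
    (rotate (invmx Q) @` closure (cap (d := d))) q.
Proof.
move=> d2 p1 q1 pq; have [pp qq] := ((sphereP _).1 p1, (sphereP _).1 q1).
have d0 : (0 < d)%N by exact: ltnW.
pose m := enorm (p + q).
have m2 : m ^+ 2 = 2 + 2 * dot p q.
  by rewrite sqr_enorm !dotE pp qq (dotC q p); ring.
have m0 : 0 < m by rewrite lt0r enorm_ge0 andbT -sqrf_eq0 m2; lra.
pose b := m^-1 *: (p + q).
have b1 : sphere b.
  by rewrite /sphere/= /b enormZ ger0_norm ?invr_ge0 ?ltW// mulVf ?gt_eqF.
have [Q SOQ bQ] := rotation_last_vec d2 b1.
exists Q => //; have [QQ _] := SOQ.
have QQ' := mulmx1C QQ.
have Qu : Q \in unitmx by case: (mulmx1_unit QQ).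
have QE : invmx Q = Q^T by rewrite -[LHS]mulmx1 -QQ mulmxA mulVmx ?mul1mx.
have key v : sphere v -> dot v (p + q) = m ^+ 2 / 2 ->
    (rotate (invmx Q) @` closure (cap (d := d))) v.
  move=> v1 vb; exists (v *m Q^T); last first.
    by rewrite /rotate QE trmxK -mulmxA QQ' mulmx1.
  apply: closure_cap => //.
    by apply/sphereP; rewrite orthogonal_dot//; exact/sphereP.
  rewrite -bQ orthogonal_dot// /b dotZr vb expr2 -!mulrA mulrCA mulVKf ?gt_eqF//.
  have c2 := sqr_cos_piquarter; have c0 := cos_piquarter_gt0.
  rewrite -(@ler_pXn2r _ 2)// ?nnegrE; [|exact: ltW|lra].
  by rewrite expr_div_n m2; lra.
split; apply: key => //; rewrite dotDr m2 ?pp ?qq ?(dotC q p); lra.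
Qed.

End rotations.

(** * The du Bois-Reymond lemma *)

Section smooth_functions.
Context {R : realType}.
Implicit Types f g : R -> R.

(** The derivatives are given by existence, not as iterates of [derive1], so closure under products
    and composition is an induction on [k] that never writes down a higher derivative. *)
Fixpoint times_derivable (k : nat) f : Prop :=
  if k is k'.+1 then
    exists2 df : R -> R, (forall x : R, is_derive x 1 f (df x)) &
      times_derivable k' df
  else True.

Definition smooth f := forall k, times_derivable k f.

Lemma is_derive_derive1 f (df : R -> R) :
  (forall x : R, is_derive x 1 f (df x)) -> f^`()%classic = df.
Proof. by move=> fdf; apply/funext => x; rewrite derive1E derive_val. Qed.

Lemma smooth_derivable f : smooth f ->
  forall k x, derivable (derive1n k f) x 1.
Proof.
move=> sf k; have {sf} : times_derivable k.+1 f by exact: sf.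
elim: k f => [f [df fdf _] x|k IHk f [df fdf dk] x]; first exact: ex_derive.
rewrite /derive1n iterSr (is_derive_derive1 fdf).
exact: IHk.
Qed.

Lemma times_derivableW k f : times_derivable k.+1 f -> times_derivable k f.
Proof.
elim: k f => // k IHk f [df fdf dk]; exists df => //; exact: IHk.
Qed.

Lemma times_derivable_cst k (c : R) : times_derivable k (cst c).
Proof.
elim: k c => // k IHk c; exists (cst 0) => // x; exact: is_derive_cst.
Qed.

Lemma times_derivableD k f g : times_derivable k f -> times_derivable k g ->
  times_derivable k (f \+ g).
Proof.
elim: k f g => // k IHk f g [df fdf dk] [dg gdg dgk].
by exists (df \+ dg) => [x|]; [exact: is_deriveD|exact: IHk].
Qed.

Lemma times_derivableM k f g : times_derivable k f -> times_derivable k g ->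
  times_derivable k (f \* g).
Proof.
elim: k f g => // k IHk f g df0 dg0.
have [[df fdf dk] [dg gdg dgk]] := (df0, dg0).
exists ((f \* dg) \+ (g \* df)) => [x|]; first exact: is_deriveM.
by apply: times_derivableD; apply: IHk => //; exact: times_derivableW.
Qed.

Lemma times_derivable_comp k f g : times_derivable k f -> times_derivable k g ->
  times_derivable k (f \o g).
Proof.
elim: k f g => // k IHk f g [df fdf dk] dg0; have [dg gdg dgk] := dg0.
exists ((df \o g) \* dg) => [x|]; first exact: is_derive1_comp.
by apply: times_derivableM => //; apply: IHk => //; exact: times_derivableW.
Qed.

Lemma smooth_affine (a b : R) : smooth (fun x => a * x + b).
Proof.
case=> // k; exists (cst a); last exact: times_derivable_cst.
by move=> x; apply: is_derive_eq; rewrite addr0 [_ *: 1]mulr1.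
Qed.

End smooth_functions.

(** * A smooth step function *)

Section smooth_step.
Context {R : realType}.
Implicit Types p : {poly R}.

(* The functions p(1/x) exp(-1/x) are closed under differentiation, which gives
   smoothness at 0 by induction. *)
Definition flat p (x : R) : R := if 0 < x then p.[x^-1] * expR (- x^-1) else 0.

Lemma expR_geXn (y : R) n : 0 <= y -> y ^+ n <= n`!%:R * expR y.
Proof.
move=> y0; case: n => [|n].
  rewrite expr0 mul1r; have := expR_ge1Dx y; lra.
have := expR_ge1Dxn n y0; rewrite -ler_pdivrMl ?ltr0n ?fact_gt0// mulrC.
lra.
Qed.

Lemma horner_le_expR p : exists2 C : R, 0 <= C &
  forall y, 0 <= y -> `|p.[y]| <= C * expR y.
Proof.
exists (\sum_(i < size p) `|p`_i| * i`!%:R) => [|y y0].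
  by apply: sumr_ge0 => i _; rewrite mulr_ge0.
rewrite horner_coef mulr_suml (le_trans (ler_norm_sum _ _ _))//.
apply: ler_sum => i _; rewrite normrM -mulrA ler_wpM2l//.
by rewrite ger0_norm ?exprn_ge0// expR_geXn.
Qed.

(** Bounding [p * 'X^2] instead of [p] by the exponential gains the factor [x ^+ 2]; this is what
    makes [flat p] differentiable at 0 with derivative 0. *)
Lemma flat_le_sqr p : exists2 C : R, 0 <= C &
  forall x : R, `|flat p x| <= C * `|x| ^+ 2.
Proof.
have [C C0 hC] := horner_le_expR (p * 'X^2); exists C => // x.
rewrite /flat; case: ifPn => [x0|_]; last by rewrite normr0 mulr_ge0.
have := hC x^-1; rewrite invr_ge0 (ltW x0) => /(_ isT).
rewrite hornerM hornerXn normrM (ger0_norm (exprn_ge0 _ _)) ?invr_ge0 ?(ltW x0)//.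
rewrite normrM (ger0_norm (expR_ge0 _)) expRN (gtr0_norm x0) => h.
rewrite ler_pdivrMr ?expR_gt0//.
have : `|p.[x^-1]| * x^-1 ^+ 2 * x ^+ 2 <= C * expR x^-1 * x ^+ 2.
  by rewrite ler_wpM2r// sqr_ge0.
by rewrite -mulrA -exprMn mulVf ?gt_eqF// expr1n mulr1 mulrAC.
Qed.

(** For [x > 0] this is the product rule, where differentiating 1/x produces the factor ['X^2]. At 0
    the difference quotient is at most [C * |h|]. *)
Lemma is_derive_flat p (x : R) :
  is_derive x 1 (flat p) (flat ('X^2 * (p - p^`())) x).
Proof.
have [x0|x0|->] := ltgtP x 0.
- rewrite [X in is_derive _ _ _ X](_ : _ = 0); last by rewrite /flat ltNge ltW.
  apply: (near_eq_is_derive _ (is_derive_cst (0 : R) x 1)).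
  near=> y; rewrite /flat ltNge ltW//=; near: y; exact: lt_nbhsl.
- rewrite [X in is_derive _ _ _ X](_ : _ =
      p.[x^-1] * (expR (- x^-1) * x ^- 2) + expR (- x^-1) * (p^`().[x^-1] * - x ^- 2)).
    have dV : is_derive x 1 (fun x : R => x^-1) (- x ^- 2).
      apply: is_derive_eq; first by apply: is_deriveV; rewrite gt_eqF.
      by rewrite [_ *: 1]mulr1.
    have dNV : is_derive x 1 (fun x : R => - x^-1) (x ^- 2).
      by rewrite -[x ^- 2]opprK; exact: is_deriveN.
    have h := is_deriveM
      (@is_derive1_comp _ (horner p) (fun x => x^-1) x _ _ (is_derive_poly p x^-1) dV)
      (@is_derive1_comp _ expR (fun x => - x^-1) x _ _ (is_derive_expR _) dNV).
    have fg : \forall y \near x, ((horner p \o (fun x : R => x^-1)) *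
        (expR \o (fun x : R => - x^-1))) y = flat p y.
      by near=> y; rewrite /flat ifT//; near: y; exact: lt_nbhsr.
    exact: (near_eq_is_derive fg h).
  rewrite /flat x0 !(hornerM, hornerX, hornerD, hornerN).
  by field; rewrite gt_eqF.
rewrite {2}/flat ltxx.
have [C C0 hC] := flat_le_sqr p.
have lim0 : (fun h : R => h^-1 *: ((flat p \o shift 0) (h *: (1 : R)) - flat p 0))
    @ 0^' --> (0 : R).
  apply/cvgrPdist_le => e e0; near=> h.
  rewrite sub0r normrN /= addr0 [_ *: 1]mulr1 [flat p 0]/flat ltxx subr0.
  have h0 : h != 0 by near: h; exact: nbhs_dnbhs_neq.
  rewrite normrM normfV ler_pdivrMl ?normr_gt0//.
  rewrite (le_trans (hC _))// expr2 mulrA mulrC ler_wpM2l//.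
  have : `|h| <= e / (C + 1).
    by near: h; apply: dnbhs0_le; rewrite divr_gt0// ltr_wpDl.
  rewrite ler_pdivlMr ?ltr_wpDl// => he; have := normr_ge0 h; nra.
split; first by apply/cvg_ex; exists 0.
exact/cvg_lim.
Unshelve. all: by end_near. Qed.

Lemma smooth_flat p : smooth (flat p).
Proof.
move=> k; elim: k p => // k IHk p.
by exists (flat ('X^2 * (p - p^`()))) => // x; exact: is_derive_flat.
Qed.

Lemma smooth_stepP : exists Phi rho : R -> R, [/\ smooth Phi,
  forall x : R, is_derive x 1 Phi (rho x),
  forall x, x <= 0 -> Phi x = 0, forall x, 1 <= x -> Phi x = 1 &
  continuous rho].
Proof.
pose e : R -> R := flat 1; pose c := e 1.
have ele0 x : x <= 0 -> e x = 0 by move=> x0; rewrite /e /flat ltNge x0.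
have egt0 x : 0 < x -> e x = expR (- x^-1).
  by move=> x0; rewrite /e /flat x0 hornerE mul1r.
have c0 : 0 < c by rewrite /c egt0// expR_gt0.
have c1 x : 1 <= x -> c - e x <= 0.
  move=> x1; rewrite subr_le0 /c !egt0 ?(lt_le_trans _ x1)// ler_expR lerN2.
  by rewrite lef_pV2 ?posrE ?(lt_le_trans _ x1).
pose k := e c; have k0 : 0 < k by rewrite /k egt0// expR_gt0.
(* Phi x = 1 - e (c - e x) / e c is a composition of smooth functions, so no
   quotient has to be differentiated. *)
pose Phi : R -> R := (fun x => - k^-1 * x + 1) \o e \o (fun x => -1 * x + c) \o e.
have sPhi : smooth Phi.
  move=> n; have se : times_derivable n e by exact: smooth_flat.
  have sa (a b : R) : times_derivable n (fun x => a * x + b) by exact: smooth_affine.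
  exact: (times_derivable_comp (times_derivable_comp
    (times_derivable_comp (sa _ _) se) (sa _ _)) se).
have [rho Phirho [drho rhod _]] := sPhi 2.
exists Phi, rho; split=> //.
- move=> x x0; rewrite /Phi /= (ele0 x)// mulr0 add0r -/k mulNr mulVf ?gt_eqF//.
  by rewrite addNr.
- move=> x x1; rewrite /Phi /= [e (-1 * _ + _)]ele0 ?mulr0 ?add0r//.
  by rewrite mulN1r addrC c1.
- move=> x; apply: differentiable_continuous.
  by apply/derivable1_diffP; case: (rhod x).
Qed.

End smooth_step.

(** * Mollifiers supported to the right of a point *)

Section mollifiers.
Context {R : realType}.
Local Notation leb := (@lebesgue_measure R).

Lemma integral_support d (T : measurableType d) (mu : {measure set T -> \bar R})
    (A B : set T) (f : T -> \bar R) : A `<=` B ->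
  (forall x, B x -> ~ A x -> f x = 0%E) ->
  (\int[mu]_(x in B) f x = \int[mu]_(x in A) f x)%E.
Proof.
move=> AB f0; rewrite integral_mkcond [RHS]integral_mkcond; congr integral.
apply/funext => x; rewrite /patch; case: ifPn => [|xB].
  rewrite inE => Bx; case: ifPn => // /negP; rewrite inE; exact: f0.
by rewrite ifF//; apply: contraNF xB; rewrite !inE; exact: AB.
Qed.

Section mollification.
Context {Phi rho : R -> R} {L : R}.
Hypothesis Phirho : forall x : R, is_derive x 1 Phi (rho x).
Hypothesis Phi0 : forall x, x <= 0 -> Phi x = 0.
Hypothesis Phi1 : forall x, 1 <= x -> Phi x = 1.
Hypothesis crho : continuous rho.

Lemma rho_eq0 x : x < 0 \/ 1 < x -> rho x = 0.
Proof.
move=> x01; have [_ <-] := Phirho x.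
suff [] : is_derive x 1 Phi 0 by [].
case: x01 => [x0|x1].
  apply: (near_eq_is_derive _ (is_derive_cst (0 : R) x 1)).
  by near=> y; rewrite Phi0// ltW//; near: y; exact: lt_nbhsl.
apply: (near_eq_is_derive _ (is_derive_cst (1 : R) x 1)).
by near=> y; rewrite Phi1// ltW//; near: y; exact: lt_nbhsr.
Unshelve. all: by end_near. Qed.

Lemma rho_bounded : exists2 L, 0 < L & forall x, `|rho x| <= L.
Proof.
have c01 : {within `[0, 1], continuous (fun x => `|rho x|)}.
  apply: continuous_subspaceT => x; apply: cvg_norm; exact: crho.
have [c _ hc] := EVT_max ler01 c01.
exists (`|rho c| + 1) => [|x]; first by rewrite ltr_wpDl.
have [x01|] := boolP (x \in `[0, 1]); first by rewrite (le_trans (hc x x01))// lerDl.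
rewrite in_itv/= negb_and -!ltNge => /orP x01.
by rewrite rho_eq0// normr0 addr_ge0.
Qed.

(** The argument is (x - a) / r, written in the form that [smooth_affine] covers. *)
Definition moll (a r x : R) : R := r^-1 * rho (r^-1 * x + - (r^-1 * a)).
Definition moll_step (a r x : R) : R := Phi (r^-1 * x + - (r^-1 * a)).

Lemma is_derive_moll_step a r (x : R) :
  is_derive x 1 (moll_step a r) (moll a r x).
Proof.
have h : is_derive x 1 (fun x : R => r^-1 * x + - (r^-1 * a)) r^-1.
  by apply: is_derive_eq; rewrite subr0 [_ *: 1]mulr1.
by rewrite /moll mulrC; exact: (@is_derive1_comp _ Phi _ x _ _ (Phirho _) h).
Qed.

Lemma continuous_moll a r : continuous (moll a r).
Proof.
move=> x; apply: cvgM; first exact: cvg_cst.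
apply: (@continuous_comp _ _ _ (fun x => r^-1 * x + - (r^-1 * a)) rho x).
  by apply: cvgD; [apply: cvgM; [exact: cvg_cst|exact: cvg_id]|exact: cvg_cst].
exact: crho.
Qed.

Lemma moll_eq0 a r x : 0 < r -> x < a \/ a + r < x -> moll a r x = 0.
Proof.
move=> r0 xar; rewrite /moll rho_eq0 ?mulr0// -mulrBr.
by case: xar => xar; [left|right]; rewrite ?pmulr_rlt0 ?ltr_pdivlMl ?invr_gt0; lra.
Qed.

Lemma moll_step_eq0 a r x : 0 < r -> x <= a -> moll_step a r x = 0.
Proof.
move=> r0 xa; rewrite /moll_step Phi0// -mulrBr.
by rewrite pmulr_rle0 ?invr_gt0; lra.
Qed.

Lemma moll_step_eq1 a r x : 0 < r -> a + r <= x -> moll_step a r x = 1.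
Proof.
move=> r0 xa; rewrite /moll_step Phi1// -mulrBr.
by rewrite ler_pdivlMl//; lra.
Qed.

Lemma integral_moll a r : 0 < r ->
  (\int[leb]_(x in `[a, (a + r)%R]) (moll a r x)%:E = 1)%E.
Proof.
move=> r0; have ar : a < a + r by rewrite ltrDl.
rewrite (@continuous_FTC2 _ _ (moll_step a r))//.
- by rewrite (@moll_step_eq0 a r a)// (@moll_step_eq1 a r (a + r))// oppe0 adde0.
- apply: continuous_subspaceT; exact: continuous_moll.
- have c x : {for x, continuous (moll_step a r)}.
    apply: differentiable_continuous; apply/derivable1_diffP.
    by case: (is_derive_moll_step a r x).
  split=> [x _||]; first by case: (is_derive_moll_step a r x).
    by apply: cvg_at_right_filter; exact: c.
  by apply: cvg_at_left_filter; exact: c.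
- by move=> x _; rewrite derive1E; case: (is_derive_moll_step a r x).
Qed.

Hypothesis L0 : 0 < L.
Hypothesis rhoL : forall x, `|rho x| <= L.

Lemma moll_bound a r x : 0 < r -> `|moll a r x| <= L / r.
Proof.
move=> r0; rewrite normrM (gtr0_norm (_ : 0 < r^-1)) ?invr_gt0// mulrC.
by rewrite ler_wpM2r ?invr_ge0 ?(ltW r0).
Qed.

(** As the mollifier has integral 1, the difference is the integral of [(g x - c) * moll a r x], and
    the mollifier is at most [L / r]. *)
Lemma mollification_dist (g : R -> R) (a r c : R) : 0 < r ->
  leb.-integrable `[a, a + r] (EFin \o g) ->
  (`|\int[leb]_(x in `[a, (a + r)%R]) (g x * moll a r x)%:E - c%:E| <=
   (L / r)%:E * \int[leb]_(x in `[a, (a + r)%R]) `|g x - c|%:E)%E.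
Proof.
move=> r0 ig; set J := `[a, _]%classic.
have mJ : measurable J by exact: measurable_itv.
have finJ : (leb J < +oo)%E.
  by rewrite lebesgue_measure_itv/=; case: ifP => _; rewrite ltey.
have ic k : leb.-integrable J (EFin \o (fun=> k : R)).
  by apply: measurable_bounded_integrable => //; exists `|k|; split => // M kM x _ /=; exact: ltW.
have igc : leb.-integrable J (EFin \o (fun x => g x - c)).
  rewrite (_ : EFin \o _ = (fun x => (g x)%:E - c%:E)%E)//.
  by apply: integrableB => //; exact: (ic c).
have mm : measurable_fun J (moll a r).
  by apply: measurable_funTS; apply: continuous_measurable_fun; exact: continuous_moll.
have bm : [bounded moll a r x | x in J].
  exists (L / r); split; first exact: num_real.
  by move=> M LM x _ /=; rewrite (le_trans (moll_bound _ _ _))// ltW.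
have iM h : leb.-integrable J (EFin \o h) ->
    leb.-integrable J (EFin \o (fun x => h x * moll a r x)).
  move=> ih; rewrite (_ : _ \o _ = ((EFin \o h) \* (EFin \o moll a r))%E).
    by apply: integrableMl.
  by apply/funext => x /=; rewrite EFinM.
have -> : (\int[leb]_(x in J) (g x * moll a r x)%:E - c%:E =
    \int[leb]_(x in J) ((g x - c) * moll a r x)%:E)%E.
  under [RHS]eq_integral do rewrite mulrBl EFinB.
  rewrite [RHS]integralB_EFin//; [|exact: iM|exact: (iM (fun=> c))].
  under [X in (_ = _ - X)%E]eq_integral do rewrite EFinM.
  rewrite integralZl//; first by rewrite integral_moll// mule1.
  apply: eq_integrable (iM _ (ic 1)) => // x _ /=.
  by rewrite mul1r.
have iMc := iM _ igc.
rewrite (le_trans (le_abse_integral _ _ _))//; first exact: measurable_int iMc.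
rewrite -ge0_integralZl//; last 2 first.
- by apply/measurable_EFinP; apply: measurableT_comp => //; apply/measurable_EFinP; exact: measurable_int igc.
- by rewrite lee_fin divr_ge0 ?ltW.
apply: ge0_le_integral => //.
- apply: measurableT_comp => //; exact: measurable_int iMc.
- apply: measurable_funeM; apply/measurable_EFinP; apply: measurableT_comp => //; apply/measurable_EFinP; exact: measurable_int igc.
- move=> x _ /=; rewrite -EFinM lee_fin normrM mulrC ler_wpM2r//.
  exact: moll_bound.
Qed.

End mollification.
End mollifiers.

(** * A function with vanishing distributional derivative is constant *)

Section du_Bois_Reymond.
Context {R : realType}.
Local Notation leb := (@lebesgue_measure R).

Lemma interval_subset (I : set R) a b : is_interval I -> I a -> I b ->
  `[a, b]%classic `<=` I.
Proof.
move=> iI Ia Ib x /=; rewrite in_itv/= => axb; exact: (iI a b).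
Qed.

Lemma locally_integrable_itv (I : set R) (g : R -> R) a b :
  locally_integrable I g -> `[a, b]%classic `<=` I ->
  leb.-integrable `[a, b] (EFin \o g).
Proof.
move=> [mg oI gI] abI; apply/integrableP; split.
  apply/measurable_EFinP; apply: measurable_funS mg => //.
  exact: open_measurable.
exact: (gI _ abI (@segment_compact _ _ _)).
Qed.

Section lebesgue_points.
Variables (I : set R) (g : R -> R).
Hypothesis iI : is_interval I.
Hypothesis lg : locally_integrable I g.
Hypothesis test0 : forall phi, test_function I phi ->
  (\int[leb]_(x in I) (g x * derive1 phi x)%:E = 0)%E.

Section steps.
Context {Phi rho : R -> R} {L : R}.
Hypothesis sPhi : smooth Phi.
Hypothesis Phirho : forall x : R, is_derive x 1 Phi (rho x).
Hypothesis Phi0 : forall x, x <= 0 -> Phi x = 0.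
Hypothesis Phi1 : forall x, 1 <= x -> Phi x = 1.
Hypothesis crho : continuous rho.
Hypothesis L0 : 0 < L.
Hypothesis rhoL : forall x, `|rho x| <= L.
Local Notation moll := (@moll R rho).
Local Notation moll_step := (@moll_step R Phi).

(* The difference of two shifted steps is a test function whose derivative is a
   difference of mollifiers. *)
Lemma mollified_eq a b r : 0 < r -> a < b -> I a -> I (b + r) ->
  (\int[leb]_(x in `[a, (a + r)%R]) (g x * moll a r x)%:E =
   \int[leb]_(x in `[b, (b + r)%R]) (g x * moll b r x)%:E)%E.
Proof.
move=> r0 ab Ia Ibr; set K := `[a, b + r]%classic.
have KI : K `<=` I by exact: interval_subset.
have mK : measurable K by exact: measurable_itv.
have iK : leb.-integrable K (EFin \o g) by exact: locally_integrable_itv lg KI.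
have im c : leb.-integrable K (EFin \o (fun x => g x * moll c r x)).
  rewrite (_ : _ \o _ = ((EFin \o g) \* (EFin \o moll c r))%E); last first.
    by apply/funext => x /=; rewrite EFinM.
  apply: integrableMl => //.
    by apply: measurable_funTS; apply: continuous_measurable_fun; exact: continuous_moll.
  exists (L / r); split; first exact: num_real.
  by move=> M LM x _ /=; rewrite (le_trans (moll_bound rhoL _ _ _))// ltW.
pose phi := moll_step a r \+ (fun x => -1 * moll_step b r x + 0).
have sstep c : smooth (moll_step c r).
  move=> k; apply: (@times_derivable_comp _ _ Phi (fun x => r^-1 * x + - (r^-1 * c))).
    exact: sPhi.
  exact: smooth_affine.
have sphi : smooth phi.
  move=> k; apply: times_derivableD; first exact: sstep.
  apply: (@times_derivable_comp _ _ (fun x => -1 * x + 0)); first exact: smooth_affine.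
  exact: sstep.
have phi' x : phi^`()%classic x = moll a r x - moll b r x.
  rewrite derive1E; apply: derive_val; apply: is_deriveD.
    exact: is_derive_moll_step.
  have h := is_derive_moll_step Phirho b r x.
  rewrite (_ : (fun x => _) = (fun x => -1 *: moll_step b r x)); last first.
    by apply/funext => y; rewrite addr0.
  by rewrite -[- moll b r x]mulN1r; exact: is_deriveZ.
have phi0 x : ~ K x -> phi x = 0.
  rewrite /K/= in_itv/= => /negP; rewrite negb_and -!ltNge => /orP[xa|bx].
    rewrite /phi /= !(@moll_step_eq0 _ Phi Phi0)// ?mulr0 ?addr0//; apply: ltW => //.
    exact: lt_trans ab.
  rewrite /phi /= !(@moll_step_eq1 _ Phi Phi1)//; first by rewrite mulr1 addr0 subrr.
  - exact: ltW.
  - by rewrite ltW// (lt_trans _ bx)// ltrD2r.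
have tphi : test_function I phi.
  split; first exact: smooth_derivable.
  by exists K; split => //; exact: segment_compact.
have : (\int[leb]_(x in K) (g x * moll a r x - g x * moll b r x)%:E = 0)%E.
  rewrite -[RHS](test0 tphi); transitivity
    (\int[leb]_(x in I) (g x * moll a r x - g x * moll b r x)%:E)%E; last first.
    by apply: eq_integral => x _; rewrite phi' mulrBr.
  apply/esym; apply: integral_support => //.
  move=> x _; rewrite /K/= in_itv/= => /negP; rewrite negb_and -!ltNge => /orP xK.
  rewrite !(@moll_eq0 _ _ _ Phirho Phi0 Phi1)// ?mulr0 ?subr0//.
    by case: xK => xK; [left; exact: lt_trans ab|right].
  by case: xK => xK; [left|right; rewrite (lt_trans _ xK)// ltrD2r].
under eq_integral do rewrite EFinB.
rewrite integralB_EFin//.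
have E c : a <= c -> c <= b -> (\int[leb]_(x in K) (g x * moll c r x)%:E =
    \int[leb]_(x in `[c, (c + r)%R]) (g x * moll c r x)%:E)%E.
  move=> ac cb; apply: integral_support.
    by apply: subset_itv; rewrite ?bnd_simp ?lerD2r.
  move=> x _; rewrite /= in_itv/= => /negP; rewrite negb_and -!ltNge => /orP xc.
  by rewrite (@moll_eq0 _ _ _ Phirho Phi0 Phi1)// mulr0.
rewrite !E ?lexx ?(ltW ab)//.
move=> /eqP; rewrite sube_eq ?add0e; first by move=> /eqP.
  by rewrite -E ?lexx ?(ltW ab)//; exact: integrable_fin_num (im _).
exact: fin_num_adde_defr.
Qed.

End steps.

(** The mollified values at [a] and [b] agree for every radius, and at a Lebesgue point they tend to
    the value of [g]. Restricting [g] to [[p, q]] gives a function that is integrable on the whole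
    line. *)
Lemma lebesgue_pt_eq p q a b : p < a -> a < b -> b < q ->
  `[p, q]%classic `<=` I ->
  lebesgue_pt (g \_ `[p, q]) a -> lebesgue_pt (g \_ `[p, q]) b -> g a = g b.
Proof.
move=> pa ab bq pqI La Lb.
have [Phi [rho [sPhi Phirho Phi0 Phi1 crho]]] := @smooth_stepP R.
have [L L0 rhoL] := rho_bounded Phirho Phi0 Phi1 crho.
set G := g \_ `[p, q] in La Lb.
have GE x : p <= x <= q -> G x = g x.
  by move=> xpq; rewrite /G patchT// inE/= in_itv.
have mG : measurable_fun setT G.
  apply/(measurable_restrictT _ (measurable_itv _)).
  have /integrableP[/measurable_EFinP] := locally_integrable_itv lg pqI.
  by [].
(* The mollifier on [[c, c + s / 2]] is at most [L / (s / 2)] and the ball of radius [s] has length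
   [2 * s]; the product of the two is [4 * L]. *)
have bound c s : p <= c -> c + s <= q -> 0 < s ->
  (`|\int[leb]_(x in `[c, (c + s / 2)%R]) (g x * @moll R rho c (s / 2) x)%:E - (g c)%:E|
   <= (4 * L)%:E * davg G c s)%E.
  move=> pc csq s0; have s20 : 0 < s / 2 by rewrite divr_gt0.
  have cq : c <= q by lra.
  have JI : `[c, c + s / 2]%classic `<=` I.
    apply: subset_trans pqI; apply: subset_itv; rewrite bnd_simp//; lra.
  rewrite (le_trans (mollification_dist Phirho Phi0 Phi1 crho L0 rhoL _ _
    (locally_integrable_itv lg JI)))//.
  have -> : (4 * L)%:E = (L / (s / 2) * (s *+ 2))%:E :> \bar R.
    by congr EFin; rewrite -mulr_natr; field; rewrite gt_eqF.
  rewrite [in leRHS]EFinM -muleA; apply: lee_wpmul2l; first by rewrite lee_fin divr_ge0 ?ltW.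
  rewrite /davg /iavg lebesgue_measure_ball ?(ltW s0)// inver.
  rewrite mulrn_eq0/= gt_eqF// muleA -EFinM divff ?mulrn_eq0 ?gt_eqF// mul1e.
  rewrite (@le_trans _ _ (\int[leb]_(x in `[c, (c + s / 2)%R]) `|(G x - G c)%:E|)%E)//.
    apply: le_trans (le_refl _); rewrite le_eqVlt; apply/orP; left; apply/eqP.
    apply: eq_integral => x; rewrite inE/= in_itv/= => /andP[cx xc].
    by rewrite !GE//; lra.
  apply: ge0_subset_integral => //.
  - exact: measurable_ball.
  - apply: measurableT_comp => //; apply/measurable_EFinP.
    by apply: measurable_funTS; apply: measurable_funB => //; exact: measurable_cst.
  - move=> x /=; rewrite in_itv/= ball_itv/= in_itv/= => /andP[cx xc]; lra.
apply/eqP; rewrite -subr_eq0 -normr_le0; apply/ler_addgt0Pl => e e0; rewrite addr0.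
pose e' := e / (8 * L); have e'0 : 0 < e' by rewrite divr_gt0// mulr_gt0.
have small c : lebesgue_pt G c -> \forall s \near 0^'+, (davg G c s <= e'%:E)%E.
  move=> /fine_cvgP[finG] /cvgrPdist_le/(_ e' e'0) h.
  near=> s; rewrite -[davg G c s]fineK; last by near: s.
  rewrite lee_fin (le_trans (ler_norm _))// -normrN -[- _]add0r.
  by near: s.
near (0 : R)^'+ => s.
have s0 : 0 < s by [].
have sq : s < q - b by near: s; apply: nbhs_right_lt; rewrite subr_gt0.
have da : (davg G a s <= e'%:E)%E by near: s; exact: small.
have db : (davg G b s <= e'%:E)%E by near: s; exact: small.
have bound' s' : (s' <= e'%:E)%E -> ((4 * L)%:E * s' <= (e / 2)%:E)%E.
  move=> se; have -> : e / 2 = 4 * L * e' by rewrite /e'; field; rewrite gt_eqF.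
  rewrite [leRHS]EFinM; apply: lee_wpmul2l => //.
  by rewrite lee_fin mulr_ge0// ltW.
have ba := le_trans (bound a s (ltW pa) ltac:(lra) s0) (bound' _ da).
have bb := le_trans (bound b s ltac:(lra) ltac:(lra) s0) (bound' _ db).
have s20 : 0 < s / 2 by rewrite divr_gt0.
have moll_ab := mollified_eq sPhi Phirho Phi0 Phi1 crho rhoL s20 ab
  (pqI a ltac:(rewrite /= in_itv/=; lra)) (pqI (b + s / 2) ltac:(rewrite /= in_itv/=; lra)).
rewrite moll_ab in ba.
move: ba bb; case: (\int[_]_(x in _) _)%E => //= x.
rewrite !lee_fin !ler_norml => /andP[? ?] /andP[? ?].
by apply/andP; split; lra.
Unshelve. all: by end_near. Qed.

(** Lebesgue points depend on the interval to which [g] is restricted. Using rational intervals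
    only, the exceptional points form a countable union of null sets, and any two points of [I] lie
    inside one such interval. *)
Lemma du_Bois_Reymond : exists c : R, {ae leb, forall x, I x -> g x = c}.
Proof.
have [mg oI gI] := lg.
pose N (z : rat * rat) : set R := [set x | `[ratr z.1, ratr z.2]%classic `<=` I /\
  ~ lebesgue_pt (g \_ `[ratr z.1, ratr z.2]) x].
have Nneg z : leb.-negligible (N z).
  have [zI|zI] := pselect (`[ratr z.1, ratr z.2]%classic `<=` I); last first.
    apply: (negligibleS _ (negligible_set0 _)) => x [].
    by move/zI.
  have ig := locally_integrable_itv lg zI.
  have : locally_integrable setT (g \_ `[ratr z.1, ratr z.2]).
    apply: open_integrable_locally => //; first exact: openT.
    rewrite (_ : _ \o _ = (EFin \o g) \_ `[ratr z.1, ratr z.2]).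
      by apply/integrable_restrict => //; rewrite setTI.
    by apply/funext => x; rewrite /= /patch; case: ifP.
  move/lebesgue_differentiation; apply: negligibleS => x [_ xN].
  exact.
pose NN := \bigcup_k (if unpickle k is Some z then N z else set0).
have NNneg : leb.-negligible NN.
  apply: negligible_bigcup => k; case: unpickle => [z|]; first exact: Nneg.
  exact: negligible_set0.
have notNN z x : ~ NN x -> `[ratr z.1, ratr z.2]%classic `<=` I ->
    lebesgue_pt (g \_ `[ratr z.1, ratr z.2]) x.
  move=> xNN zI; apply: contrapT => xz; apply: xNN.
  exists (pickle z); first by [].
  rewrite pickleK; split; [exact: zI|exact: xz].
have key x y : I x -> I y -> ~ NN x -> ~ NN y -> x < y -> g x = g y.
  move=> Ix Iy xN yN xy.
  have /nbhs_ballP[r /= r0 rI] : nbhs x I by exact: open_nbhs_nbhs.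
  have /nbhs_ballP[s /= s0 sI] : nbhs y I by exact: open_nbhs_nbhs.
  have [p pP] : exists p : rat, x - r < ratr p < x.
    have /rat_in_itvoo[p] : x - r < x by rewrite ltrBlDr ltrDl.
    by rewrite in_itv/= => ?; exists p.
  have [q qP] : exists q : rat, y < ratr q < y + s.
    have /rat_in_itvoo[q] : y < y + s by rewrite ltrDl.
    by rewrite in_itv/= => ?; exists q.
  have pqI : `[ratr p, ratr q]%classic `<=` I.
    apply: interval_subset => //.
      by apply: rI; rewrite ball_itv/= in_itv/=; lra.
    by apply: sI; rewrite ball_itv/= in_itv/=; lra.
  by apply: (@lebesgue_pt_eq (ratr p) (ratr q)) => //; [lra|lra| |];
    apply: (notNN (p, q)).
(* If all of [I] lies in the null set [NN], for instance if [I] is empty, any constant will do. *)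
have [[x0 [Ix0 x0N]]|nox] := pselect (exists x, I x /\ ~ NN x).
  exists (g x0); apply: (negligibleS _ NNneg) => x /= /not_implyP[Ix gx].
  apply: contrapT => xN; apply: gx.
  have [|xx0|xx0] := ltgtP x x0; last by rewrite xx0.
    exact: key.
  by rewrite (key x0 x).
exists 0; apply: (negligibleS _ NNneg) => x /= /not_implyP[Ix _].
by apply: contrapT => xN; apply: nox; exists x.
Qed.

End lebesgue_points.
End du_Bois_Reymond.

(** * Integration by parts against a charge *)

Section integration_by_parts.
Context {R : realType}.
Local Notation leb := (@lebesgue_measure R).

Lemma compact_sub_itv (K : set R) : compact K ->
  exists a b : R, a < b /\ K `<=` `[a, b]%classic.
Proof.
move=> /compact_bounded[M [_ hM]].
exists (- (`|M| + 1)), (`|M| + 1); split.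
  by have := normr_ge0 M; lra.
move=> x /(hM (`|M| + 1)) /=; rewrite in_itv/= -ler_norml; apply.
by rewrite (le_lt_trans (ler_norm _))// ltrDl.
Qed.

Section test.
Variables (I : set R) (phi : R -> R).
Hypothesis tphi : test_function I phi.

Lemma test_function_continuous_derive : continuous phi^`()%classic.
Proof.
move=> x; apply: differentiable_continuous; apply/derivable1_diffP.
exact: (tphi.1 1).
Qed.

Lemma test_function_continuous : continuous phi.
Proof.
move=> x; apply: differentiable_continuous; apply/derivable1_diffP.
exact: (tphi.1 0).
Qed.

Lemma test_function_derive_support : exists K, [/\ compact K, K `<=` I,
  forall x, ~ K x -> phi x = 0 & forall x, ~ K x -> phi^`()%classic x = 0].
Proof.
have [K [cK KI phi0]] := tphi.2; exists K; split=> // x xK.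
have : \forall y \near x, ~ K y.
  apply: open_nbhs_nbhs; split=> //; apply: closed_openC.
  exact: compact_closed.
move=> xnK; rewrite derive1E; apply: derive_val.
apply: (near_eq_is_derive _ (is_derive_cst (0 : R) x 1)).
by apply: filterS xnK => y /phi0.
Qed.

Lemma test_function_support : exists a b : R, [/\ a < b,
  forall x, ~ `[a, b]%classic x \/ ~ I x -> phi x = 0 &
  forall x, ~ `[a, b]%classic x \/ ~ I x -> phi^`()%classic x = 0].
Proof.
have [K [cK KI phi0 phi'0]] := test_function_derive_support.
have [a [b [ab Kab]]] := compact_sub_itv cK.
have nK x : ~ `[a, b]%classic x \/ ~ I x -> ~ K x.
  by move=> [xab /Kab|xI /KI].
by exists a, b; split=> // x /nK; [exact: phi0|exact: phi'0].
Qed.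

Lemma integrable_test_derive : leb.-integrable setT (EFin \o phi^`()%classic).
Proof.
have [a [b [ab _ phi'0]]] := test_function_support.
rewrite (_ : _ \o _ = (EFin \o phi^`()%classic) \_ `[a, b]%classic).
  apply/integrable_restrict => //; rewrite setTI.
  apply: continuous_compact_integrable; first exact: segment_compact.
  apply: continuous_subspaceT; exact: test_function_continuous_derive.
apply/funext => x; rewrite /patch; case: ifPn => // /negP; rewrite inE => xab.
by rewrite /= phi'0//; left.
Qed.

(** The fundamental theorem of calculus, with the lower limit [y] moved into the integrand so that
    Fubini's theorem applies. *)
Lemma test_function_integral (y : R) :
  ((phi y)%:E = \int[leb]_x (if y <= x then - phi^`()%classic x else 0)%:E)%E.
Proof.
have [a [b [ab phi0 phi'0]]] := test_function_support.
(* [phi] vanishes from [B] on, and [y < B] also when [y] lies to the right of the support. *)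
pose B := Num.max (b + 1) (y + 1).
have yB : y < B by rewrite lt_max ltrDl ltr01 orbT.
have bB : b < B by rewrite lt_max ltrDl ltr01.
have D (x : R) : is_derive x 1 (fun x => - phi x) (- phi^`()%classic x).
  by apply: is_deriveN; rewrite derive1E; apply: DeriveDef => //; exact: (tphi.1 0).
have C : continuous (fun x => - phi x).
  by move=> x; apply: cvgN; exact: test_function_continuous.
transitivity (\int[leb]_(x in `[y, B])
    (if y <= x then - phi^`()%classic x else 0)%:E)%E; last first.
  apply/esym; apply: integral_support => // x _; rewrite /= in_itv/= => /negP; rewrite negb_and -!ltNge => /orP.
  case: leP => // yx [//|Bx]; rewrite phi'0 ?oppr0//; left.
  by rewrite /= in_itv/= => /andP[_]; rewrite leNgt (lt_trans bB).
transitivity (\int[leb]_(x in `[y, B]) (- phi^`()%classic x)%:E)%E; last first.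
  by apply: eq_integral => x; rewrite inE/= in_itv/= => /andP[->].
rewrite (@continuous_FTC2 _ _ (fun x => - phi x))//.
- rewrite (phi0 B); last by left; rewrite /= in_itv/= => /andP[_]; rewrite leNgt bB.
  by rewrite oppr0 add0e -EFinN opprK.
- apply: continuous_subspaceT => x; apply: cvgN.
  exact: test_function_continuous_derive.
- split=> [x _||]; first by case: (D x).
    by apply: cvg_at_right_filter; exact: C.
  by apply: cvg_at_left_filter; exact: C.
- by move=> x _; rewrite derive1E; case: (D x).
Qed.

Variable P : {finite_measure set (measurableTypeR R) -> \bar R}.

Let f (z : measurableTypeR R * measurableTypeR R) : \bar R :=
  (if z.2 <= z.1 then - phi^`()%classic z.1 else 0)%:E.

Let mf : measurable_fun setT f.
Proof.
apply/measurable_EFinP; apply: measurable_fun_ifT => //.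
- exact: measurable_fun_ler.
- apply: measurableT_comp => //; apply: measurableT_comp => //.
  by apply: continuous_measurable_fun; exact: test_function_continuous_derive.
Qed.

Let intf : (leb \x P)%E.-integrable setT f.
Proof.
apply/integrable21ltyP => //.
have /integrableP[mphi' intphi'] := integrable_test_derive.
apply: (@le_lt_trans _ _ (\int[P]_y (\int[leb]_x `|(phi^`()%classic x)%:E|))%E).
  apply: ge0_le_integral => //.
  - move=> y _; exact: integral_ge0.
  - apply: (@measurable_fun_fubini_tonelli_G _ _ _ _ _ leb (abse \o f)) => //=.
    exact: measurableT_comp.
  move=> y _; apply: ge0_le_integral => //.
  - apply: measurableT_comp => //.
    exact: (measurableT_comp mf (measurable_pair2 y)).
  - exact: measurableT_comp.
  move=> x _; rewrite /f /=; case: ifP => _; first by rewrite normrN.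
  by rewrite normr0 lee_fin.
rewrite integral_cst//=; rewrite lte_mul_pinfty// ?integral_ge0//.
  by rewrite ge0_fin_numE// integral_ge0.
exact: fin_num_fun_lty.
Qed.

(** Fubini for [f], which is - phi'(x) on y <= x: integrating in y first gives - P(]-oo, x])
    phi'(x), integrating in x first gives phi(y). *)
Lemma finite_measure_by_parts : measurable I ->
  leb.-integrable I (fun x => (fine (P `]-oo, x]%classic) * phi^`()%classic x)%:E)
  /\ (\int[leb]_(x in I) (fine (P `]-oo, x]%classic) * phi^`()%classic x)%:E =
      - \int[P]_(x in I) (phi x)%:E)%E.
Proof.
move=> mI.
have GE x : (\int[P]_y f (x, y) =
    (- (fine (P `]-oo, x]%classic) * phi^`()%classic x))%:E)%E.
  transitivity (\int[P]_(y in `]-oo, x]) f (x, y))%E.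
    apply: integral_support => // y _ /=; rewrite in_itv/= /f/=.
    by move=> /negP/negPf ->.
  rewrite (eq_integral (cst (- phi^`()%classic x)%:E)); last first.
    by move=> y; rewrite inE/= in_itv/= /f/= => ->.
  rewrite integral_cst//= -[in LHS](@fineK _ (P _)) ?fin_num_measure//.
  by rewrite -EFinM mulNr [in LHS]mulrC.
have iG := integrable_fubini_F intf.
have iT : leb.-integrable setT
    (fun x => (fine (P `]-oo, x]%classic) * phi^`()%classic x)%:E).
  apply: (eq_integrable _ (fun x => (- 1)%:E * (\int[P]_y f (x, y)))%E) => //.
    by move=> x _; rewrite GE -EFinM mulN1r opprK.
  exact: integrableZl.
have iI : leb.-integrable I
    (fun x => (fine (P `]-oo, x]%classic) * phi^`()%classic x)%:E).
  by apply: integrableS iT.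
split=> //.
have [a [b [ab phi0 phi'0]]] := test_function_support.
transitivity (- \int[P]_x (phi x)%:E)%E; last first.
  by congr (- _)%E; apply: integral_support => // x _ Ix; rewrite phi0//; right.
transitivity (- \int[P]_y \int[leb]_x f (x, y))%E; last first.
  by congr (- _)%E; apply: eq_integral => y _; rewrite test_function_integral.
rewrite -(Fubini intf).
transitivity (- \int[leb]_x ((- 1)%:E * (fine (P `]-oo, x]%classic) * phi^`()%classic x)%:E))%E.
  rewrite integralZl// EFinN mulN1e oppeK.
  by apply/esym; apply: integral_support => // x _ Ix; rewrite phi'0 ?mulr0//; right.
by congr (- _)%E; apply: eq_integral => x _; rewrite GE -EFinM mulN1r.
Qed.

End test.

Lemma charge_integral_by_parts (nu : {charge set (measurableTypeR R) -> \bar R})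
    (I : set R) (phi : R -> R) : measurable I -> test_function I phi ->
  (\int[leb]_(x in I) (fine (nu `]-oo, x]%classic) * phi^`()%classic x)%:E =
   - charge_integral nu I phi)%E.
Proof.
move=> mI tphi; rewrite /charge_integral.
set Pp := jordan_pos _; set Pn := jordan_neg _.
have [ip Ep] := finite_measure_by_parts tphi Pp mI.
have [i_n En] := finite_measure_by_parts tphi Pn mI.
have nuE A : measurable A -> fine (nu A) = fine (Pp A) - fine (Pn A).
  move=> mA; rewrite (jordan_decomp (hahn_posneg nu) mA).
  have : Pp A \is a fin_num by rewrite fin_num_measure.
  have : Pn A \is a fin_num by rewrite fin_num_measure.
  rewrite /cadd/= /cscale/= -/Pp -/Pn.
  by case: (Pp A) => // p; case: (Pn A) => //= n _ _; rewrite mulN1r.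
under eq_integral do rewrite nuE// mulrBl EFinB.
rewrite integralB_EFin// Ep En.
have : (- \int[Pp]_(x in I) (phi x)%:E)%E \is a fin_num.
  by rewrite -Ep; exact: integrable_fin_num.
move: (\int[Pp]_(x in I) _)%E (\int[Pn]_(x in I) _)%E => [a||] [b||] //= _.
by congr EFin; ring.
Qed.

End integration_by_parts.

(** * Total variation *)

Section total_variation.
Context {R : realType} {m : nat} (nu : vcharge (R := R) m).
Local Notation T := (measurableTypeR R).
Implicit Types (A B : set T) (F : (set T)^nat).
Local Notation val := (vcharge_val nu).

Lemma vcharge_val0 : val set0 = 0.
Proof. by apply/rowP => i; rewrite !mxE charge0. Qed.

Lemma vcharge_valU A B : measurable A -> measurable B -> A `&` B = set0 ->
  val (A `|` B) = val A + val B.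
Proof.
move=> mA mB AB; apply/rowP => i; rewrite !mxE chargeU// fineD//;
  exact: fin_num_measure.
Qed.

Lemma vcharge_val_setD A B : measurable A -> measurable B -> A `<=` B ->
  val B = val A + val (B `\` A).
Proof.
move=> mA mB AB; rewrite -vcharge_valU ?setDUK//; first exact: measurableD.
by rewrite setDIK.
Qed.

Lemma cvg_vcharge_val F : (forall k, measurable (F k)) -> trivIset setT F ->
  \sum_(0 <= k < n) val (F k) @[n --> \oo] --> val (\bigcup_k F k).
Proof.
move=> mF tF.
have mU : measurable (\bigcup_k F k) by exact: bigcup_measurable.
apply/cvg_enorm_dist/cvgrPdist_le => e e0.
have h (i : 'I_m) : \forall n \near \oo,
    `|(\sum_(0 <= k < n) val (F k)) 0 i - val (\bigcup_k F k) 0 i| <= e / m.+1%:R.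
  have em : 0 < e / m.+1%:R by rewrite divr_gt0.
  have := @charge_semi_sigma_additive _ _ _ (nu i) F mF tF mU.
  rewrite -[X in _ --> X]fineK ?fin_num_measure// => /fine_cvgP[_].
  move/cvgrPdist_le/(_ _ em); apply: filterS => n /=.
  rewrite distrC mxE; congr (`|_ - _| <= _).
  rewrite summxE (eq_bigr (fun k => (val (F k) 0 i)%:E)) ?sumEFin// => k _.
  by rewrite mxE fineK// fin_num_measure.
have hall : \forall n \near \oo, forall i : 'I_m,
    `|(\sum_(0 <= k < n) val (F k)) 0 i - val (\bigcup_k F k) 0 i| <= e / m.+1%:R.
  exact: filter_forall.
apply: filterS hall => n hn.
rewrite sub0r normrN ger0_norm ?enorm_ge0// (le_trans (enorm_le_sum _))//.
apply: (@le_trans _ _ (\sum_(i < m) e / m.+1%:R)).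
  by apply: ler_sum => i _; rewrite !mxE; have := hn i; rewrite !mxE.
rewrite sumr_const card_ord -[leLHS]mulr_natr mulrAC ler_pdivrMr//.
by rewrite ler_wpM2l ?(ltW e0)// ler_nat.
Qed.

Lemma enorm_val_le_series F : (forall k, measurable (F k)) -> trivIset setT F ->
  ((enorm (val (\bigcup_k F k)))%:E <= \sum_(0 <= k <oo) (enorm (val (F k)))%:E)%E.
Proof.
move=> mF tF; have /cvg_enorm h := cvg_vcharge_val mF tF.
have {}h : (enorm (\sum_(0 <= k < n) val (F k)))%:E @[n --> \oo] -->
    (enorm (val (\bigcup_k F k)))%:E.
  by apply: cvg_EFin => //; exact: nearW.
rewrite -(cvg_lim _ h)//; apply: lime_le; first exact: cvgP h.
apply: nearW => n /=; apply: le_trans (nneseries_lim_ge n _); last first.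
  by move=> k _ _; rewrite lee_fin enorm_ge0.
by rewrite sumEFin lee_fin enorm_sum.
Qed.

Lemma tot_var_ge F A : (forall k, measurable (F k)) -> trivIset setT F ->
  \bigcup_k F k = A ->
  (\sum_(0 <= k <oo) (enorm (val (F k)))%:E <= tot_var nu A)%E.
Proof. by move=> mF tF FA; apply: ereal_sup_ubound; exists F. Qed.

(** [tot_var] ranges over exact partitions of [A], so the first [n] sets are completed by their
    remainder in [A], put at index [n], and by empty sets. *)
Lemma tot_var_ge_sum F A n : measurable A -> (forall k, measurable (F k)) ->
  trivIset setT F -> (forall k, F k `<=` A) ->
  (\sum_(0 <= k < n) (enorm (val (F k)))%:E <= tot_var nu A)%E.
Proof.
move=> mA mF tF FA.
pose H k := if (k < n)%N then F k else
  if k == n then A `\` \big[setU/set0]_(i < n) F i else set0.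
have mH k : measurable (H k).
  rewrite /H; case: ifP => // _; case: ifP => // _; apply: measurableD => //.
  exact: bigsetU_measurable.
have FH k : (k < n)%N -> H k = F k by rewrite /H => ->.
apply: (@le_trans _ _ (\sum_(0 <= k <oo) (enorm (val (H k)))%:E)%E).
  apply: le_trans (nneseries_lim_ge n _); last by move=> k _ _; rewrite lee_fin enorm_ge0.
  rewrite !big_nat; apply: lee_sum => k /andP[_ kn].
  by rewrite FH.
have sub i x : (i < n)%N -> F i x -> (\big[setU/set0]_(i < n) F i) x.
  by move=> i_n Fx; rewrite -bigcup_mkord; exists i.
apply: tot_var_ge => //.
  apply/trivIsetP => i j _ _ ij; rewrite /H.
  have [i_n|i_n] := ltnP i n; have [j_n|j_n] := ltnP j n.
  - exact: (trivIsetP.1 tF).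
  - case: ifPn => _; last by rewrite setI0.
    by apply/seteqP; split=> // x [Fx [_]]; apply; exact: sub Fx.
  - case: ifPn => _; last by rewrite set0I.
    by apply/seteqP; split=> // x [[_ nx] Fx]; apply: nx; exact: sub Fx.
  - have [iE|_] := eqVneq i n; last by rewrite set0I.
    by rewrite -iE eq_sym (negbTE ij) setI0.
apply/seteqP; split=> [x [k _]|x Ax].
  rewrite /H; case: ifP => _; first exact: FA.
  by case: ifP => // _ [].
have [|nx] := pselect ((\big[setU/set0]_(i < n) F i) x).
  rewrite -bigcup_mkord => -[k /= kn Fx].
  by exists k => //; rewrite FH.
by exists n => //; rewrite /H ltnn eqxx.
Qed.

Lemma tot_var_le A (y : \bar R) :
  (forall F, (forall k, measurable (F k)) -> trivIset setT F ->
    \bigcup_k F k = A ->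
    forall n, (\sum_(0 <= k < n) (enorm (val (F k)))%:E <= y)%E) ->
  (tot_var nu A <= y)%E.
Proof.
move=> h; apply: ge_ereal_sup => _ [F [mF tF FA] <-].
apply: lime_le; last by apply: nearW => n; exact: h.
by apply: is_cvg_nneseries => k _ _; rewrite lee_fin enorm_ge0.
Qed.

Lemma tot_var_ge0 A : measurable A -> (0 <= tot_var nu A)%E.
Proof.
move=> mA; have := @tot_var_ge_sum (fun=> set0) A 0 mA; rewrite big_geq//.
move=> h; apply: h => [_|| _] //.
by apply/trivIsetP => i j _ _ _; rewrite setI0.
Qed.

Lemma tot_var_mono A B : measurable A -> measurable B -> A `<=` B ->
  (tot_var nu A <= tot_var nu B)%E.
Proof.
move=> mA mB AB; apply: tot_var_le => F mF tF FA n.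
by apply: tot_var_ge_sum => // k; apply: subset_trans AB; rewrite -FA; exact: bigcup_sup.
Qed.

(** Finite parts of a partition of [A] and of one of [B], put one after the other, form a disjoint
    family in the union. *)
Lemma tot_var_superadd2 A B : measurable A -> measurable B -> A `&` B = set0 ->
  (tot_var nu A + tot_var nu B <= tot_var nu (A `|` B))%E.
Proof.
move=> mA mB AB; set t := tot_var nu (A `|` B).
have mAB : measurable (A `|` B) by exact: measurableU.
have tA : (tot_var nu A <= t)%E by apply: tot_var_mono => //; exact: subsetUl.
have tB : (tot_var nu B <= t)%E by apply: tot_var_mono => //; exact: subsetUr.
(* If [t] is infinite there is nothing to prove; otherwise both variations are finite and can be
   moved across the inequality. *)
have [tfin|] := boolP (t \is a fin_num); last first.
  have : (0 <= t)%E by exact: tot_var_ge0.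
  by case: t tA tB => // _ _ _ _; rewrite leey.
have Bfin : tot_var nu B \is a fin_num.
  rewrite ge0_fin_numE ?tot_var_ge0// (le_lt_trans tB)//.
  by rewrite -ge0_fin_numE// tot_var_ge0.
rewrite -leeBrDr//; apply: tot_var_le => F mF tF FA n.
rewrite leeBrDr// addeC -leeBrDr ?sumEFin//.
apply: tot_var_le => G mG tG GB n'; rewrite leeBrDr// -sumEFin.
pose H k := if (k < n)%N then F k else if (k < n + n')%N then G (k - n)%N else set0.
have FA' k : F k `<=` A by rewrite -FA; exact: bigcup_sup.
have GB' k : G k `<=` B by rewrite -GB; exact: bigcup_sup.
have FG i j : F i `&` G j = set0.
  by apply/seteqP; split=> // x [/FA' Ax /GB' Bx]; rewrite -AB.
have mH k : measurable (H k).
  by rewrite /H; case: ifP => // _; case: ifP.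
have tH : trivIset setT H.
  apply/trivIsetP => i j _ _ ij; rewrite /H.
  have tFi := trivIsetP.1 tF; have tGi := trivIsetP.1 tG.
  have [i_n|i_n] := ltnP i n; have [j_n|j_n] := ltnP j n; rewrite ?tFi//.
  + by case: ifP => _; rewrite ?setI0.
  + by case: ifP => _; rewrite ?set0I// setIC.
  + case: ifP => _; case: ifP => _; rewrite ?setI0 ?set0I//.
    apply: tGi => //; apply: contra_neq ij => e.
    by rewrite -(subnK i_n) e subnK.
have HAB k : H k `<=` A `|` B.
  rewrite /H; case: ifP => _; first by move=> x /FA'; left.
  by case: ifP => [_ x /GB' Bx|_ x []]; right.
apply: le_trans (tot_var_ge_sum (n + n') mAB mH tH HAB).
suff -> : (\sum_(0 <= k < n + n') (enorm (val (H k)))%:E =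
    \sum_(0 <= k < n') (enorm (val (G k)))%:E +
    \sum_(0 <= k < n) (enorm (val (F k)))%:E)%E by [].
rewrite (@big_cat_nat _ _ _ n)//= ?leq_addr//.
have := big_addn 0 (n + n')%N n xpredT (fun k => (enorm (val (H k)))%:E).
rewrite add0n addKn => ->; rewrite [RHS]addeC; apply: f_equal2.
  by rewrite !big_nat; apply: eq_bigr => k /andP[_ kn]; rewrite /H kn.
rewrite !big_nat; apply: eq_bigr => k /andP[_ kn].
by rewrite /H addnK ltnNge leq_addl/= addnC ltn_add2l kn.
Qed.

Lemma tot_var_superadd F A : measurable A -> (forall k, measurable (F k)) ->
  trivIset setT F -> (forall k, F k `<=` A) ->
  (\sum_(0 <= k <oo) tot_var nu (F k) <= tot_var nu A)%E.
Proof.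
move=> mA mF tF FA; apply: lime_le.
  by apply: is_cvg_nneseries => k _ _; exact: tot_var_ge0.
apply: nearW => n.
apply: (@le_trans _ _ (tot_var nu (\big[setU/set0]_(k < n) F k))); last first.
  apply: tot_var_mono => //; first exact: bigsetU_measurable.
  by rewrite -bigcup_mkord; exact: bigcup_sub.
elim: n => [|n IHn].
  by rewrite big_geq// big_ord0 tot_var_ge0.
rewrite big_nat_recr//= big_ord_recr/=.
apply: le_trans (tot_var_superadd2 _ _ _) => //; first exact: leeD.
  exact: bigsetU_measurable.
apply/seteqP; split=> // x [+ Fx]; rewrite -bigcup_mkord => -[k /= kn Fkx].
have kn0 : F k `&` F n = set0 by apply: (trivIsetP.1 tF); rewrite ?ltn_eqF.
by have : (F k `&` F n) x by []; rewrite kn0.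
Qed.

End total_variation.

(** * Comparing two vector measures through their values on short intervals *)

Section comparison.
Context {R : realType} {a b : nat} (al : vcharge (R := R) a) (be : vcharge (R := R) b).
Local Notation T := (measurableTypeR R).
Variables (mu : {finite_measure set T -> \bar R}) (K c : R).
Implicit Types (A B F : set T).
Local Notation nal A := (enorm (vcharge_val al A)).
Local Notation nbe A := (enorm (vcharge_val be A)).
Hypothesis K0 : 0 <= K.
Hypothesis c0 : 0 <= c.
Hypothesis alK : forall A, measurable A -> ((nal A)%:E <= K%:E * mu A)%E.
Hypothesis beK : forall A, measurable A -> ((nbe A)%:E <= K%:E * mu A)%E.
Hypothesis cover : forall A (e : R), measurable A -> 0 < e ->
  exists s t : nat -> R, A `<=` \bigcup_k `]s k, t k]%classic /\
    (\sum_(0 <= k <oo) mu `]s k, t k]%classic <= mu A + e%:E)%E.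

(* Both sides are compared on a cover of F by intervals E k whose total measure
   exceeds mu F only by e; passing from E k to a partition F k of F costs
   mu (E k `\` F k), and these sum to at most e. *)
Lemma enorm_le_tot_var_itv p q F : measurable F -> F `<=` `]p, q]%classic ->
  (forall s t, p <= s -> s <= t -> t <= q ->
    nal `]s, t]%classic <= c * nbe `]s, t]%classic) ->
  ((nal F)%:E <= c%:E * tot_var be F)%E.
Proof.
move=> mF Fpq loc; apply/lee_addgt0Pr => e e0.
(* The excess of the cover is paid for with the factor [(1 + c) * K]; adding 1 keeps the divisor
   positive. *)
pose K1 := (1 + c) * K + 1.
have K10 : 0 < K1 by rewrite ltr_wpDl// mulr_ge0// addr_ge0.
have [s [t [Fst hst]]] := cover mF (divr_gt0 e0 K10).
(* The intervals of the cover are clipped to the range where [loc] applies. *)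
pose E k : set T := `]Num.max (s k) p, Num.min (t k) q]%classic.
have mE k : measurable (E k) by exact: measurable_itv.
have EE k : E k = `]s k, t k]%classic `&` `]p, q]%classic.
  rewrite /E; apply/seteqP; split=> x /=; rewrite !in_itv/= gt_max le_min.
    by move=> /andP[/andP[-> ->] /andP[-> ->]].
  by move=> [/andP[-> ->] /andP[-> ->]].
pose F' k := seqDU (fun k => F `&` E k) k.
have mF' k : measurable (F' k).
  by apply: seqDU_measurable => j; exact: measurableI.
have tF' : trivIset setT F' by exact: trivIset_seqDU.
have UF' : \bigcup_k F' k = F.
  rewrite -seqDU_bigcup_eq; apply/seteqP; split=> [x [k _ []]//|x Fx].
  by have [k _ xk] := Fst x Fx; exists k => //; split=> //; rewrite EE; split=> //; exact: Fpq.
have F'E k : F' k `<=` E k by move=> x h; case: (subset_seqDU h).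
have hE : (\sum_(0 <= k <oo) mu (E k `\` F' k) <= (e / K1)%:E)%E.
  have muF : mu F = (\sum_(0 <= k <oo) mu (F' k))%E.
    by rewrite -measure_semi_bigcup ?UF'//.
  have hs : (\sum_(0 <= k <oo) mu (F' k) + \sum_(0 <= k <oo) mu (E k `\` F' k)
      <= mu F + (e / K1)%:E)%E.
    rewrite -nneseriesD// (le_trans _ hst)//; apply: lee_nneseries => [k _ _|k _].
      by rewrite adde_ge0.
    rewrite -measureU//; [|exact: measurableD|by rewrite setDIK].
    rewrite setDUK//; apply: le_measure; rewrite ?inE//.
    by rewrite EE; exact: subIsetl.
  by move: hs; rewrite -muF leeD2lE// fin_num_measure.
have step k : ((nal (F' k))%:E <=
    c%:E * (nbe (F' k))%:E + ((1 + c) * K)%:E * mu (E k `\` F' k))%E.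
  have mD : measurable (E k `\` F' k) by exact: measurableD.
  have := alK mD; have := beK mD.
  rewrite -[mu _]fineK ?fin_num_measure// -!EFinM -!EFinD !lee_fin => hbe hal.
  have vb := vcharge_val_setD be (mF' k) (mE k) (F'E k).
  have va := vcharge_val_setD al (mF' k) (mE k) (F'E k).
  have ha : nal (F' k) <= nal (E k) + nal (E k `\` F' k).
    rewrite va -[X in enorm X <= _](addrK (vcharge_val al (E k `\` F' k))).
    exact: enormB.
  have hb : nbe (E k) <= nbe (F' k) + nbe (E k `\` F' k).
    by rewrite vb enormD.
  have hc : nal (E k) <= c * nbe (E k).
    have [st|ts] := leP (Num.max (s k) p) (Num.min (t k) q).
      by apply: loc => //; [rewrite le_max lexx orbT|rewrite ge_min lexx orbT].
    by rewrite /E set_itv_ge ?bnd_simp -?leNgt ?(ltW ts)// vcharge_val0 enorm0 mulr_ge0 ?enorm_ge0.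
  have : c * nbe (E k) <= c * (nbe (F' k) + nbe (E k `\` F' k)) by rewrite ler_wpM2l.
  have : c * nbe (E k `\` F' k) <= c * (K * fine (mu (E k `\` F' k))) by rewrite ler_wpM2l.
  nra.
rewrite -[in leLHS]UF' (le_trans (enorm_val_le_series _ mF' tF'))//.
apply: (@le_trans _ _ (\sum_(0 <= k <oo)
    (c%:E * (nbe (F' k))%:E + ((1 + c) * K)%:E * mu (E k `\` F' k)))%E).
  by apply: lee_nneseries => [k _ _|k _]; [rewrite lee_fin enorm_ge0|exact: step].
rewrite nneseriesD; last 2 first.
- by move=> k _ _; rewrite mule_ge0 ?lee_fin ?enorm_ge0.
- by move=> k _ _; rewrite mule_ge0 ?lee_fin ?mulr_ge0 ?addr_ge0.
rewrite nneseriesZl; last by move=> k _; rewrite lee_fin enorm_ge0.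
rewrite nneseriesZl//; apply: leeD.
  by rewrite lee_wpmul2l ?lee_fin// tot_var_ge.
rewrite (@le_trans _ _ (((1 + c) * K)%:E * (e / K1)%:E)%E)//.
  by rewrite lee_wpmul2l ?lee_fin ?mulr_ge0 ?addr_ge0.
rewrite -EFinM lee_fin mulrA ler_pdivrMr// mulrC ler_wpM2l ?(ltW e0)//.
by rewrite lerDl.
Qed.

(** Countably many intervals with rational ends on which the comparison holds cover [A]. Cutting [A]
    into disjoint pieces, each inside one of them, reduces to the previous lemma; superadditivity of
    [tot_var be] puts the pieces together again. *)
Lemma tot_var_le_local A : measurable A ->
  (forall x, A x -> exists2 e : R, 0 < e &
    forall s t, x - e < s -> s <= t -> t < x + e ->
      nal `]s, t]%classic <= c * nbe `]s, t]%classic) ->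
  (tot_var al A <= c%:E * tot_var be A)%E.
Proof.
move=> mA loc.
pose good (z : rat * rat) := forall s t, ratr z.1 <= s -> s <= t -> t <= ratr z.2 ->
  nal `]s, t]%classic <= c * nbe `]s, t]%classic.
pose O k : set T := if unpickle k is Some z then
  (if `[< good z >] then `]ratr z.1, ratr z.2]%classic else set0) else set0.
have mO k : measurable (O k).
  by rewrite /O; case: unpickle => // z; case: ifP => // _; exact: measurable_itv.
have AO x : A x -> exists k, O k x.
  move=> /loc[e e0 xe].
  have [p pP] : exists p : rat, x - e < ratr p < x.
    have /rat_in_itvoo[p] : x - e < x by rewrite ltrBlDr ltrDl.
    by rewrite in_itv/= => ?; exists p.
  have [q qP] : exists q : rat, x < ratr q < x + e.
    have /rat_in_itvoo[q] : x < x + e by rewrite ltrDl.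
    by rewrite in_itv/= => ?; exists q.
  exists (pickle (p, q)); rewrite /O pickleK ifT /=.
    by rewrite in_itv/=; lra.
  by apply/asboolP => s t /= ps st tq; apply: xe => //; lra.
pose A' k := seqDU (fun k => A `&` O k) k.
have mA' k : measurable (A' k).
  by apply: seqDU_measurable => j; exact: measurableI.
have tA' : trivIset setT A' by exact: trivIset_seqDU.
have UA' : \bigcup_k A' k = A.
  rewrite -seqDU_bigcup_eq; apply/seteqP; split=> [x [k _ []]//|x Ax].
  by have [k xk] := AO x Ax; exists k.
have onF F : measurable F -> F `<=` A -> ((nal F)%:E <= c%:E * tot_var be F)%E.
  move=> mF FA.
  have FE : F = \bigcup_k (F `&` A' k) by rewrite -setI_bigcupr UA' setIidl.
  have mFA k : measurable (F `&` A' k) by exact: measurableI.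
  have tFA : trivIset setT (fun k => F `&` A' k) by exact: trivIset_setIl.
  rewrite [in leLHS]FE (le_trans (enorm_val_le_series _ mFA tFA))//.
  apply: (@le_trans _ _ (\sum_(0 <= k <oo) c%:E * tot_var be (F `&` A' k))%E).
    apply: lee_nneseries => [k _ _|k _]; first by rewrite lee_fin enorm_ge0.
    have FAO : F `&` A' k `<=` O k by move=> x [_ h]; case: (subset_seqDU h).
    have : O k = set0 \/ exists2 z, O k = `]ratr z.1, ratr z.2]%classic & good z.
      rewrite /O; case: unpickle => [z|]; last by left.
      by case: asboolP => gz; [right; exists z|left].
    case=> [Zero|[[p q] Opq gpq]].
      have -> : F `&` A' k = set0 by apply/seteqP; split=> //; rewrite -Zero.
      by rewrite vcharge_val0 enorm0 mule_ge0 ?lee_fin// tot_var_ge0.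
    apply: (enorm_le_tot_var_itv (p := ratr p) (q := ratr q)) => //.
    by rewrite -Opq.
  rewrite nneseriesZl; last by move=> k _; rewrite tot_var_ge0.
  by rewrite lee_wpmul2l ?lee_fin// tot_var_superadd// => k; exact: subIsetl.
apply: tot_var_le => F mF tF FA n.
apply: (@le_trans _ _ (\sum_(0 <= k <oo) c%:E * tot_var be (F k))%E).
  apply: le_trans (nneseries_lim_ge n _); last first.
    by move=> k _ _; rewrite mule_ge0 ?lee_fin// tot_var_ge0.
  apply: lee_sum => k _; apply: onF => //.
  by rewrite -FA; exact: bigcup_sup.
rewrite nneseriesZl; last by move=> k _; rewrite tot_var_ge0.
rewrite lee_wpmul2l ?lee_fin// tot_var_superadd// => k.
by rewrite -FA; exact: bigcup_sup.
Qed.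

End comparison.

(** * Finite measures and functions of bounded variation *)

Section finite_measures.
Context {R : realType}.
Local Notation T := (measurableTypeR R).
Implicit Types (P Q : {finite_measure set T -> \bar R}) (A : set T).

Definition mass P (x : R) : R := fine (P `]-oo, x]%classic).

Lemma mass_itv P a b : a <= b -> P `]a, b]%classic = (mass P b - mass P a)%:E.
Proof.
move=> ab; have : `]a, b]%classic = `]-oo, b] `\` `]-oo, a] :> set R.
  by rewrite -[RHS]setCK setCD setCitvl setUC -[LHS]setCK setCitv.
move=> ->; rewrite measureD//=; last by rewrite -ge0_fin_numE// fin_num_measure.
rewrite setIidr; last by apply: subset_itvl; rewrite bnd_simp.
by rewrite EFinB !fineK ?fin_num_measure.
Qed.

Lemma mass_ge0 P x : 0 <= mass P x.
Proof. exact: fine_ge0. Qed.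

Lemma mass_le P x : mass P x <= fine (P setT).
Proof. by rewrite fine_le ?fin_num_measure// le_measure ?inE. Qed.

Lemma mass_nd P : {homo mass P : x y / x <= y}.
Proof.
move=> x y xy; rewrite -subr_ge0 -lee_fin -mass_itv//.
Qed.

Lemma finite_measure_small P (F : (set T)^nat) (e : R) :
  (forall n, measurable (F n)) -> (forall n, F n.+1 `<=` F n) ->
  \bigcap_n F n = set0 -> 0 < e -> exists n, (P (F n) < e%:E)%E.
Proof.
move=> mF ndF F0 e0.
have := @nonincreasing_cvg_mu _ _ _ P F _ mF _ _.
rewrite F0 measure0 => /(_ _ _ _)h.
have {}h : (P \o F) n @[n --> \oo] --> 0%E.
  apply: h => //; first by rewrite -ge0_fin_numE// fin_num_measure.
  by apply/nonincreasing_seqP => n; apply/subsetPset; exact: ndF.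
have /fine_cvgP[_ /cvgrPdist_lt/(_ e e0)[n _ hn]] := h.
exists n; rewrite -[P _]fineK ?fin_num_measure// lte_fin.
by have := hn n (leqnn n); rewrite sub0r normrN /= ger0_norm ?fine_ge0.
Qed.

Lemma itv_right_small P x (e : R) : 0 < e ->
  exists2 h : R, 0 < h & (P `]x, (x + h)%R]%classic < e%:E)%E.
Proof.
move=> e0; have [n|n||n hn] := @finite_measure_small P
    (fun n => `]x, (x + n.+1%:R^-1)%R]%classic) e _ _ _ e0.
- exact: measurable_itv.
- by apply: subset_itvl; rewrite bnd_simp lerD2l lef_pV2 ?posrE// ler_nat.
- apply/seteqP; split=> // y hy; have := hy (Num.bound (y - x)^-1) Logic.I.
  have := hy 0%N Logic.I; rewrite /= !in_itv/= => /andP[xy _] /andP[_].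
  rewrite -lerBlDl leNgt => /negP; apply.
  rewrite -[ltRHS]invrK ltf_pV2 ?posrE ?invr_gt0 ?subr_gt0//.
  rewrite (lt_le_trans (archi_boundP _))// ?ler_nat// invr_ge0 subr_ge0 ltW//.
- by exists n.+1%:R^-1.
Qed.

Lemma itv_left_small P x (e : R) : 0 < e ->
  exists2 h : R, 0 < h & (P `](x - h)%R, x[%classic < e%:E)%E.
Proof.
move=> e0; have [n|n||n hn] := @finite_measure_small P
    (fun n => `](x - n.+1%:R^-1)%R, x[%classic) e _ _ _ e0.
- exact: measurable_itv.
- by apply: subset_itvr; rewrite bnd_simp lerD2l lerN2 lef_pV2 ?posrE// ler_nat.
- apply/seteqP; split=> // y hy; have := hy (Num.bound (x - y)^-1) Logic.I.
  have := hy 0%N Logic.I; rewrite /= !in_itv/= => /andP[_ yx] /andP[+ _].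
  rewrite ltrBlDr -ltrBlDl => /ltW; rewrite leNgt => /negP; apply.
  rewrite -[ltRHS]invrK ltf_pV2 ?posrE ?invr_gt0 ?subr_gt0//.
  rewrite (lt_le_trans (archi_boundP _))// ?ler_nat// invr_ge0 subr_ge0 ltW//.
- by exists n.+1%:R^-1.
Qed.

Lemma mass_rc P x (e : R) : 0 < e -> exists2 h, 0 < h &
  forall y, x <= y -> y < x + h -> mass P y < mass P x + e.
Proof.
move=> /(itv_right_small P x)[h h0 hP]; exists h => // y xy yh.
have := hP; rewrite mass_itv ?lerDl ?(ltW h0)// lte_fin.
have : mass P y <= mass P (x + h) by apply: mass_nd; exact: ltW.
lra.
Qed.

Lemma right_continuousP (f : R -> R) : {homo f : x y / x <= y} ->
  (forall x e, 0 < e -> exists2 h, 0 < h &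
    forall y, x <= y -> y < x + h -> f y < f x + e) ->
  right_continuous f.
Proof.
move=> ndf rcf x; apply/cvgrPdist_lt => e /(rcf x)[h h0 hf].
near=> y; have xy : x <= y by apply: ltW.
rewrite ler0_norm ?subr_le0 ?ndf// opprB ltrBlDl; apply: hf => //.
by near: y; apply: nbhs_right_lt; rewrite ltrDl.
Unshelve. all: by end_near. Qed.

Definition cumulative_of (f : R -> R) (nd : {homo f : x y / x <= y})
  (rc : right_continuous f) : cumulative R R :=
  HB.pack f (isCumulative.Build R _ R f nd rc).

Lemma lebesgue_stieltjes_itv (f : cumulative R R) a b : a <= b ->
  lebesgue_stieltjes_measure f `]a, b]%classic = (f b - f a)%:E.
Proof.
move=> ab; rewrite /lebesgue_stieltjes_measure /measure_extension/=.
by rewrite measurable_mu_extE/= ?wlength_itv_bnd//; exact: is_ocitv.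
Qed.

(** The total mass is the limit of the masses of ]-n, n], which are increments of [f]. *)
Lemma finite_lebesgue_stieltjes (f : R -> R) (B : R) : {homo f : x y / x <= y} ->
  (forall x e, 0 < e -> exists2 h, 0 < h &
    forall y, x <= y -> y < x + h -> f y < f x + e) ->
  (forall a b, f b - f a <= B) ->
  exists P, forall a b, a <= b -> P `]a, b]%classic = (f b - f a)%:E.
Proof.
move=> ndf rcf fB; pose F := cumulative_of ndf (right_continuousP ndf rcf).
pose S := lebesgue_stieltjes_measure F.
have ST : (S setT < +oo)%E.
  apply: (@le_lt_trans _ _ B%:E); last exact: ltry.
  pose I n : set R := `]- (n%:R), n%:R]%classic.
  have SI : (S \o I) n @[n --> \oo] --> S setT.
    rewrite -(bigcup_itvT false false).
    apply: nondecreasing_cvg_mu; rewrite /I//; first exact: bigcup_measurable.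
    by move=> *; apply/subsetPset/subset_itv; rewrite leBSide/= ?lerN2 ler_nat.
  rewrite -(cvg_lim _ SI)//; apply: lime_le; first exact: cvgP SI.
  apply: nearW => n; rewrite /= /S lebesgue_stieltjes_itv ?ge0_cp//.
  by rewrite lee_fin; exact: fB.
have SF : fin_num_fun S.
  move=> A mA; rewrite ge0_fin_numE// (le_lt_trans _ ST)//.
  by rewrite le_measure ?inE.
pose P : {finite_measure set T -> \bar R} := HB.pack S (Measure_isFinite.Build _ _ _ S SF).
by exists P => a b ab; exact: lebesgue_stieltjes_itv.
Qed.

(** A Stieltjes measure comes from an outer measure. This gives both uniqueness from the values on
    half-open intervals and nearly optimal covers by such intervals. *)
Lemma finite_measure_LS P : exists F : cumulative R R,
  forall A, measurable A -> lebesgue_stieltjes_measure F A = P A.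
Proof.
exists (cumulative_of (@mass_nd P) (right_continuousP (@mass_nd P) (@mass_rc P))).
move=> A mA; apply: lebesgue_stieltjes_measure_unique => // _ [[a b] _ <-]/=.
have [ab|ba] := leP a b; last by rewrite set_itv_ge ?measure0// bnd_simp -leNgt ltW.
by rewrite lebesgue_stieltjes_itv// mass_itv.
Qed.

Lemma finite_measure_unique P Q :
  (forall a b, a <= b -> P `]a, b]%classic = Q `]a, b]%classic) ->
  forall A, measurable A -> P A = Q A.
Proof.
move=> PQ A mA; have [F FP] := finite_measure_LS P; rewrite -FP//.
apply: lebesgue_stieltjes_measure_unique => // _ [[a b] _ <-]/=.
have [ab|ba] := leP a b; last by rewrite set_itv_ge ?measure0// bnd_simp -leNgt ltW.
by rewrite FP// PQ.
Qed.

Lemma finite_measure_cover P A (e : R) : measurable A -> 0 < e ->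
  exists s t : nat -> R, A `<=` \bigcup_k `]s k, t k]%classic /\
    (\sum_(0 <= k <oo) P `]s k, t k]%classic <= P A + e%:E)%E.
Proof.
move=> mA e0; have [F FP] := finite_measure_LS P.
have PA : P A \is a fin_num by exact: fin_num_measure.
have : (mu_ext (wlength F) A < P A + e%:E)%E.
  by rewrite -FP// [ltLHS](_ : _ = P A) ?FP ?lteDl// -FP.
move=> /ereal_inf_lt[_ [E [mE AE] <-] hE].
have Eitv k : exists st : R * R, `]st.1, st.2]%classic = E k.
  by have [st _ stE] := mE k; exists st.
have [st stE] := choice Eitv.
exists (fun k => (st k).1), (fun k => (st k).2); split.
  by under eq_bigcupr do rewrite stE.
rewrite (le_trans _ (ltW hE))//; apply: lee_nneseries => // k _.
rewrite stE -FP; last by rewrite -stE; exact: measurable_itv.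
by rewrite /lebesgue_stieltjes_measure /measure_extension/= measurable_mu_extE.
Qed.

Lemma measure_add_finite P Q : fin_num_fun (measure_add P Q).
Proof. by move=> A mA; rewrite measure_addE fin_numD !fin_num_measure. Qed.

Definition finite_measure_add P Q : {finite_measure set T -> \bar R} :=
  HB.pack (msum (fun n => if n is 0 then P : {measure set T -> \bar R} else Q) 2)
    (Measure_isFinite.Build _ _ _ (measure_add P Q) (measure_add_finite P Q)).

Lemma finite_measure_addE P Q A : finite_measure_add P Q A = (P A + Q A)%E.
Proof. exact: measure_addE. Qed.

(** The difference of the two distribution functions is nondecreasing; its Stieltjes measure [S]
    satisfies Q = S + P. *)
Lemma le_measure_itv P Q :
  (forall a b, a <= b -> (P `]a, b]%classic <= Q `]a, b]%classic)%E) ->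
  forall A, measurable A -> (P A <= Q A)%E.
Proof.
move=> PQ A mA; pose f x := mass Q x - mass P x.
have fab a b : a <= b -> 0 <= f b - f a /\ f b - f a <= mass Q b - mass Q a.
  move=> ab; have := PQ a b ab; rewrite !mass_itv// lee_fin /f.
  by have := mass_nd P ab; lra.
have [|x e e0|a b|S SE] := @finite_lebesgue_stieltjes f (fine (Q setT)).
- by move=> x y /fab[]; rewrite subr_ge0.
- have [h h0 hQ] := mass_rc Q x e0; exists h => // y xy yh.
  by have := hQ y xy yh; have [] := fab _ _ xy; lra.
- have [ab|/ltW/fab[ba _]] := leP a b.
    have [_] := fab _ _ ab; have := mass_le Q b; have := mass_ge0 Q a; lra.
  have := mass_le Q b; have := mass_ge0 Q b; lra.
have SP : forall A, measurable A -> Q A = finite_measure_add S P A.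
  apply: (finite_measure_unique (Q := finite_measure_add S P)).
  move=> a b ab; rewrite finite_measure_addE SE// !mass_itv// -EFinD; congr EFin.
  by rewrite /f; ring.
by rewrite SP// finite_measure_addE leeDr.
Qed.

Lemma charge_of_increments P (g : R -> R) (K : R) : 0 <= K ->
  (forall a b, a <= b -> `|g b - g a| <= K * (mass P b - mass P a)) ->
  exists nu : {charge set T -> \bar R},
    (forall a b, a <= b -> nu `]a, b]%classic = (g b - g a)%:E) /\
    forall A, measurable A -> (`|nu A| <= (3 * K)%:E * P A)%E.
Proof.
(* g + K P(]-oo, x]) is nondecreasing. *)
move=> K0 gP; pose G x := g x + K * mass P x.
have Gab a b : a <= b -> 0 <= G b - G a /\ G b - G a <= 2 * K * (mass P b - mass P a).
  by move=> ab; have := gP a b ab; rewrite ler_norml /G => /andP[]; lra.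
have [|x e e0|a b|S SE] := @finite_lebesgue_stieltjes G (2 * K * fine (P setT)).
- by move=> x y /Gab[]; rewrite subr_ge0.
- have K1 : 0 < 2 * K + 1 by lra.
  have [h h0 hP] := mass_rc P x (divr_gt0 e0 K1); exists h => // y xy yh.
  have := hP y xy yh; rewrite -ltrBlDl ltr_pdivlMr//.
  by have [] := Gab _ _ xy; have := mass_nd P xy; lra.
- have := mass_le P b; have := mass_ge0 P a; have := mass_ge0 P b.
  have [ab|/ltW/Gab[ba _]] := leP a b.
    by have [_] := Gab _ _ ab; nra.
  by nra.
have SP A : measurable A -> (S A <= (2 * K)%:E * P A)%E.
  have K20 : 0 <= 2 * K by rewrite mulr_ge0.
  apply: (le_measure_itv (Q := [the {finite_measure set T -> \bar R} of
    mscale (NngNum K20) P])).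
  move=> a b ab; rewrite SE//= /mscale/= mass_itv// -EFinM lee_fin.
  by have [] := Gab _ _ ab.
(* Subtracting [K] times [P] undoes the shift in [G]; with [S] at most [2 * K] times [P] this gives
   the factor [3 * K]. *)
pose nu : {charge set T -> \bar R} := [the {charge set T -> \bar R} of
  cadd (charge_of_finite_measure S) (cscale (- K) (charge_of_finite_measure P))].
have nuE A : nu A = (S A + (- K)%:E * P A)%E by [].
exists nu; split=> [a b ab|A mA].
  rewrite nuE SE// mass_itv// -EFinM -EFinD; congr EFin.
  by rewrite /G; ring.
rewrite nuE (le_trans (lee_abs_add _ _))// abseM (gee0_abs (measure_ge0 _ _)).
rewrite (gee0_abs (measure_ge0 _ _)) abse_EFin normrN ger0_norm//.
have -> : (3 * K)%:E = ((2 * K)%:E + K%:E)%E :> \bar R by rewrite -EFinD; congr EFin; ring.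
by rewrite ge0_muleDl ?lee_fin ?mulr_ge0// leeD2r// SP.
Qed.

End finite_measures.

(** * Good representatives *)

Section representative.
Context {R : realType}.
Local Notation leb := (@lebesgue_measure R).
Local Notation T := (measurableTypeR R).

Lemma ae_itv (I : set R) (Q : R -> Prop) a b : {ae leb, forall x, I x -> Q x} ->
  a < b -> `]a, b[%classic `<=` I -> exists2 y, a < y < b & Q y.
Proof.
move=> [N [mN N0 QN]] ab abI; apply: contrapT => nQ.
have abN : `]a, b[%classic `<=` N.
  move=> y yab; apply: QN => /= /(_ (abI _ yab)) Qy; apply: nQ.
  by exists y => //; move: yab; rewrite /= in_itv.
have : (leb `]a, b[%classic <= leb N)%E by apply: le_measure => //; rewrite inE.
by rewrite N0 lebesgue_measure_itv/= lte_fin ab -EFinB lee_fin subr_le0 leNgt ab.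
Qed.

Lemma finite_measure_sum (J : eqType) (s : seq J) (P : J -> {finite_measure set T -> \bar R}) :
  exists Q : {finite_measure set T -> \bar R}, forall A, measurable A ->
    Q A = (\sum_(j <- s) P j A)%E.
Proof.
elim: s => [|j s [Q QE]].
  have [|x e e0|a b|Q QE] := @finite_lebesgue_stieltjes R (fun=> 0) 0 => //.
  - by exists 1 => // y _ _; rewrite add0r.
  (* [Q] is known only on intervals; scaling by 0 gives the zero measure on every set. *)
  exists (mscale (NngNum (lexx 0)) Q) => A mA.
  by rewrite big_nil /= /mscale/= mul0e.
by exists (finite_measure_add (P j) Q) => A mA; rewrite finite_measure_addE big_cons QE.
Qed.

(** [P] is the sum of the variations of the components. Their Jordan parts are restrictions of the
    components up to sign, so they vanish off [I] as well. *)
Lemma vcharge_dominated m (Du : vcharge (R := R) m) :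
  exists P : {finite_measure set T -> \bar R},
    (forall A, measurable A -> ((enorm (vcharge_val Du A))%:E <= P A)%E) /\
    forall I, measurable I -> (forall i A, measurable A -> A `&` I = set0 -> Du i A = 0%E) ->
      forall A, measurable A -> A `&` I = set0 -> P A = 0%E.
Proof.
pose V i := finite_measure_add (jordan_pos (hahn_posneg (Du i)))
                               (jordan_neg (hahn_posneg (Du i))).
have [P PE] := finite_measure_sum (index_enum 'I_m) V.
exists P; split=> [A mA|I mI DI A mA AI].
  rewrite PE// (@le_trans _ _ (\sum_i `|vcharge_val Du A 0 i|)%:E)//.
    by rewrite lee_fin enorm_le_sum.
  rewrite -sumEFin; apply: lee_sum => i _; rewrite finite_measure_addE mxE.
  rewrite -abse_EFin fineK ?fin_num_measure//.
  exact: (abse_charge_variation (hahn_posneg (Du i)) mA).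
rewrite PE// big1// => i _; rewrite finite_measure_addE.
have [[mp _] [mn _] _ _] := hahn_posneg (Du i).
have sub B : A `&` B `&` I = set0 by rewrite setIAC AI set0I.
have p0 : jordan_pos (hahn_posneg (Du i)) A = 0%E.
  rewrite jordan_posE cjordan_posE /crestr0 mem_set// /crestr DI//.
  exact: measurableI.
have n0 : jordan_neg (hahn_posneg (Du i)) A = 0%E.
  rewrite jordan_negE cjordan_negE /crestr0 mem_set// /crestr DI ?oppe0//.
  exact: measurableI.
transitivity (0 + 0 : \bar R)%E; last by rewrite adde0.
by congr (_ + _)%E.
Qed.

Section BV.
Context {m : nat} (I : set R) (u : R -> 'rV[R]_m) (Du : vcharge (R := R) m).
Hypothesis oI : open I.
Hypothesis iI : is_interval I.
Hypothesis lu : forall i, locally_integrable I (fun x => u x 0 i).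
Hypothesis dDu : distributional_derivative I u Du.

Lemma charge_cdf_measurable (nu : {charge set T -> \bar R}) (D : set R) :
  measurable D -> measurable_fun D (fun x => fine (nu `]-oo, x]%classic)).
Proof.
move=> mD; pose Pp := jordan_pos (hahn_posneg nu); pose Pn := jordan_neg (hahn_posneg nu).
rewrite (_ : (fun x => _) = mass Pp \- mass Pn).
  by apply: measurable_funB; apply: nondecreasing_measurable => //; exact: mass_nd.
apply/funext => x; rewrite (jordan_decomp (hahn_posneg nu) (measurable_itv _)).
have Ppf : Pp `]-oo, x]%classic \is a fin_num by rewrite fin_num_measure.
have Pnf : Pn `]-oo, x]%classic \is a fin_num by rewrite fin_num_measure.
rewrite /cadd/= /cscale/= -/Pp -/Pn.
transitivity (fine (Pp `]-oo, x]%classic) - fine (Pn `]-oo, x]%classic)) => //.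
move: (Pp `]-oo, x]%classic) Ppf (Pn `]-oo, x]%classic) Pnf.
by move=> [p| |] // _ [q| |] // _ /=; rewrite mulN1r.
Qed.

Lemma charge_cdf_bounded (nu : {charge set T -> \bar R}) :
  exists B, forall x, `|fine (nu `]-oo, x]%classic)| <= B.
Proof.
have [P [Pnu _]] := vcharge_dominated (fun _ : 'I_1 => nu).
exists (fine (P setT)) => x.
have := normr_coord_le (vcharge_val (fun _ : 'I_1 => nu) `]-oo, x]%classic) 0.
rewrite mxE => /le_trans; apply; have /= := Pnu _ (measurable_itv `]-oo, x]).
rewrite -[P _]fineK ?fin_num_measure// lee_fin => /le_trans; apply.
exact: mass_le.
Qed.

(** By integration by parts x |-> Du(]-oo, x]) has the same distributional derivative as [u], so
    each component of the difference is constant almost everywhere. *)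
Lemma BV_ae_primitive : exists c : 'rV[R]_m, {ae leb, forall x, I x ->
  u x = c + vcharge_val Du `]-oo, x]%classic}.
Proof.
have mI : measurable I by exact: open_measurable.
have compwise i : exists c : R, {ae leb, forall x, I x ->
    u x 0 i - fine (Du i `]-oo, x]%classic) = c}.
  have mF := charge_cdf_measurable (Du i).
  have [B FB] := charge_cdf_bounded (Du i).
  have iF K : compact K ->
      leb.-integrable K (EFin \o (fun x => fine (Du i `]-oo, x]%classic))).
    move=> cK; apply: measurable_bounded_integrable.
    - exact: compact_measurable.
    - exact: compact_finite_measure.
    - by apply: mF; exact: compact_measurable.
    - exists B; split; first exact: num_real.
      by move=> M BM x _ /=; rewrite (le_trans (FB x))// ltW.
  have iu K : compact K -> K `<=` I -> leb.-integrable K (EFin \o (fun x => u x 0 i)).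
    move=> cK KI; have [mu _ hu] := lu i; apply/integrableP; split.
      by apply/measurable_EFinP; exact: measurable_funS mu.
    exact: (hu K).
  apply: du_Bois_Reymond => //.
    have [mu _ hu] := lu i; split=> //.
      by apply: measurable_funB => //; exact: mF.
    move=> K KI cK.
    have : leb.-integrable K
        (fun x => (u x 0 i)%:E - (fine (Du i `]-oo, x]%classic))%:E)%E.
      by apply: integrableB; [exact: compact_measurable|exact: iu|exact: iF].
    by case/integrableP.
  move=> phi tphi; have [K [cK KI _ phi'0]] := test_function_derive_support tphi.
  have mK := compact_measurable cK.
  have cphi' := test_function_continuous_derive tphi.
  have iM h : leb.-integrable K (EFin \o h) ->
      leb.-integrable K (EFin \o (fun x => h x * phi^`()%classic x)).
    move=> ih; rewrite (_ : _ \o _ = ((EFin \o h) \* (EFin \o phi^`()%classic))%E).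
      apply: integrableMl => //.
        by apply: measurable_funTS; exact: continuous_measurable_fun.
      have cc : compact (phi^`()%classic @` K).
        apply: continuous_compact => //; exact: continuous_subspaceT.
      have [M [Mr hM]] := compact_bounded cc; exists M; split=> // M' MM' x Kx.
      by apply: (hM M' MM'); exists x.
    by apply/funext => x /=; rewrite EFinM.
  have IK h : (\int[leb]_(x in I) (h x * phi^`()%classic x)%:E =
      \int[leb]_(x in K) (h x * phi^`()%classic x)%:E)%E.
    by apply: integral_support => // x _ /phi'0 ->; rewrite mulr0.
  rewrite IK; under eq_integral do rewrite mulrBl EFinB.
  rewrite integralB_EFin//; [|exact: iM (iu K cK KI)|exact: iM (iF K cK)].
  rewrite -!IK (dDu.2 i phi tphi) -(charge_integral_by_parts (Du i) mI tphi).
  by rewrite IK subee//; apply: integrable_fin_num => //; exact: iM (iF K cK).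
have [c hc] := choice compwise.
exists (\row_i c i).
have hc' : {ae leb, forall x, forall i, I x -> u x 0 i - fine (Du i `]-oo, x]%classic) = c i}.
  exact: filter_forall.
by apply: (@filterS _ _ (ae_filter_ringOfSetsType leb)) hc' => x hx Ix; apply/rowP => i; rewrite !mxE -(hx i Ix) subrK.
Qed.

(** The primitive of [Du] lies in [N] almost everywhere on [I], hence everywhere there by right
    continuity. Off [I] it is constant on each side and equal to the limit at that end of [I], so
    [v] can be lifted on the whole line. *)
Lemma BV_representative (N : set 'rV[R]_m) : closed N -> N !=set0 ->
  {ae leb, forall x, I x -> N (u x)} ->
  exists (P : {finite_measure set T -> \bar R}) (v : R -> 'rV[R]_m),
  [/\ forall x, N (v x), {ae leb, forall x, I x -> u x = v x},
      forall a b, a <= b -> v b - v a = vcharge_val Du `]a, b]%classic,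
      forall A, measurable A -> ((enorm (vcharge_val Du A))%:E <= P A)%E &
      forall A, measurable A -> A `&` I = set0 -> P A = 0%E].
Proof.
move=> cN [k0 Nk0] Nu; have mI : measurable I by exact: open_measurable.
have [P [PDu P0]] := vcharge_dominated Du.
have {}P0 := P0 I mI dDu.1.
have [[z Iz]|noI] := pselect (I !=set0); last first.
  have I0 : I = set0 by apply/seteqP; split=> // x Ix; apply: noI; exists x.
  exists P, (fun=> k0); split=> //; first by apply: aeW => x; rewrite I0.
  move=> a b _; rewrite subrr; apply/rowP => i.
  by rewrite !mxE dDu.1// I0 setI0.
have [c hc] := BV_ae_primitive.
pose v x := c + vcharge_val Du `]-oo, x]%classic.
have vB a b : a <= b -> v b - v a = vcharge_val Du `]a, b]%classic.
  move=> ab; rewrite /v opprD addrACA subrr add0r.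
  have -> : `]-oo, b]%classic = `]-oo, a]%classic `|` `]a, b]%classic :> set R.
    by rewrite (@itv_bndbnd_setU _ _ -oo%O (BRight a) (BRight b)) ?bnd_simp.
  rewrite vcharge_valU//; first by rewrite addrAC subrr add0r.
  by apply/seteqP; split=> // x /= []; rewrite !in_itv/= => xa /andP[]; rewrite ltNge xa.
have vP a b : a <= b -> enorm (v b - v a) <= mass P b - mass P a.
  by move=> ab; rewrite vB// -lee_fin -mass_itv// PDu.
have clN x : (forall e : R, 0 < e -> exists2 y, enorm (v y - v x) < e & N (v y)) -> N (v x).
  move=> h; apply: cN => B /nbhs_enormP[e e0 eB].
  by have [y yx Ny] := h e e0; exists (v y); split=> //; exact: eB.
have NI x : I x -> N (v x).
  move=> Ix; apply: clN => e e0.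
  have [h h0 hP] := mass_rc P x e0.
  have /nbhs_ballP[r /= r0 rI] : nbhs x I by exact: open_nbhs_nbhs.
  have hae : {ae leb, forall x, I x -> N (v x)}.
    by apply: (@filterS2 _ _ (ae_filter_ringOfSetsType leb)) hc Nu => y vy Ny Iy; rewrite /v -vy//; exact: Ny.
  pose s := Num.min h r.
  have s0 : 0 < s by rewrite lt_min h0 r0.
  have [||y /andP[xy yx] Ny] := ae_itv (a := x) (b := x + s) hae.
  - by rewrite ltrDl.
  - move=> y /=; rewrite in_itv/= => /andP[xy]; rewrite /s -ltrBlDl lt_min => /andP[_ yr].
    by apply: rI; rewrite ball_itv/= in_itv/=; lra.
  exists y => //; rewrite (le_lt_trans (vP _ _ (ltW xy)))// ltrBlDl hP ?(ltW xy)//.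
  by rewrite (lt_le_trans yx)// lerD2l ge_min lexx.
exists P, v; split=> // x.
have [Ix|nIx] := pselect (I x); first exact: NI.
apply: clN => e e0.
(* For [x] on the left of [I], compare with a point [y] of [I] just after [inf I]: [P] has no mass
   on []x, inf I]] and little on []inf I, y]]. *)
have [xz|zx|xz] := ltgtP x z; last by rewrite xz in nIx.
  have inf0 : has_inf I.
    split; first by exists z.
    exists x => y Iy; rewrite leNgt; apply/negP => yx.
    by apply: nIx; apply: (iI Iy Iz); rewrite !ltW.
  have xt : x <= inf I.
    apply: lb_le_inf => [|y Iy]; first by exists z.
    rewrite leNgt; apply/negP => yx.
    by apply: nIx; apply: (iI Iy Iz); rewrite !ltW.
  have [h h0 hP] := itv_right_small P (inf I) e0.
  have [y Iy yt] := inf_adherent h0 inf0.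
  have ty : inf I <= y by apply: inf_lbound => //; exact: inf0.2.
  exists y; last exact: NI.
  rewrite vB ?(le_trans xt)// -lte_fin (le_lt_trans (PDu _ _))// (le_lt_trans _ hP)//.
  have -> : `]x, y]%classic = `]x, inf I]%classic `|` `]inf I, y]%classic.
    by rewrite (@itv_bndbnd_setU _ _ (BRight x) (BRight (inf I)) (BRight y)) ?bnd_simp.
  rewrite measureU//; last first.
    apply/seteqP; split=> // w /= []; rewrite !in_itv/= => /andP[_ wt] /andP[].
    by rewrite ltNge wt.
  rewrite [X in (X + _)%E]P0 ?add0e//.
    by apply: le_measure; rewrite ?inE//; apply: subset_itvl; rewrite bnd_simp ltW.
  apply/seteqP; split=> // w /= [+ Iw]; rewrite in_itv/= => /andP[xw wt].
  have /nbhs_ballP[r /= r0 rI] : nbhs w I by exact: open_nbhs_nbhs.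
  have : inf I <= w - r / 2.
    apply: inf_lbound; first exact: inf0.2.
    by apply: rI; rewrite ball_itv/= in_itv/=; lra.
  lra.
have sup0 : has_sup I.
  split; first by exists z.
  exists x => y Iy; rewrite leNgt; apply/negP => xy.
  by apply: nIx; apply: (iI Iz Iy); rewrite !ltW.
have tx : sup I <= x.
  apply: ge_sup => [|y Iy]; first by exists z.
  rewrite leNgt; apply/negP => xy.
  by apply: nIx; apply: (iI Iz Iy); rewrite !ltW.
have [h h0 hP] := itv_left_small P (sup I) e0.
have [y Iy yt] := sup_adherent h0 sup0.
(* On the right the increment runs over []y, x]], which contains [sup I]; that point must carry no
   mass. *)
have nIt : ~ I (sup I).
  move=> It; have /nbhs_ballP[r /= r0 rI] : nbhs (sup I) I by exact: open_nbhs_nbhs.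
  have : sup I + r / 2 <= sup I.
    apply: sup_ubound; first exact: sup0.2.
    by apply: rI; rewrite ball_itv/= in_itv/=; lra.
  lra.
have ty : y < sup I.
  rewrite lt_neqAle sup_ubound ?andbT//; last exact: sup0.2.
  by apply/eqP => yE; apply: nIt; rewrite -yE.
exists y; last exact: NI.
rewrite enormBC vB ?(le_trans (ltW ty))// -lte_fin (le_lt_trans (PDu _ _))//.
rewrite (le_lt_trans _ hP)//.
have -> : `]y, x]%classic = `]y, sup I[%classic `|` `[sup I, x]%classic.
  by rewrite (@itv_bndbnd_setU _ _ (BRight y) (BLeft (sup I)) (BRight x)) ?bnd_simp// ltW.
rewrite measureU//; last first.
  apply/seteqP; split=> // w /= []; rewrite !in_itv/= => /andP[_ wt] /andP[].
  by rewrite leNgt wt.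
rewrite [X in (_ + X)%E]P0 ?adde0//.
  by apply: le_measure; rewrite ?inE//; apply: subset_itvr; rewrite bnd_simp ltW.
apply/seteqP; split=> // w /= [+ Iw]; rewrite in_itv/= => /andP[tw _].
have wt : w <= sup I by apply: sup_ubound => //; exact: sup0.2.
by apply: nIt; rewrite (@le_anti _ _ (sup I) w)// tw wt.
Qed.

End BV.
End representative.

(** * The lifting *)

Section lifting.
Context {R : realType} {d D : nat} (iota : set 'rV[R]_d -> 'rV[R]_D).
Hypothesis emb : isometric_embedding iota.
Local Notation f := (emb_line iota).
Variables (C : R) (M : R -> R) (B : R) (v : R -> 'rV[R]_D).
Hypothesis C0 : 0 < C.
Hypothesis fC : forall p q, sphere p -> sphere q -> 0 <= dot p q ->
  enorm (p - q) <= C * enorm (f p - f q).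
Hypothesis ndM : {homo M : x y / x <= y}.
Hypothesis rcM : forall x e, 0 < e ->
  exists2 h, 0 < h & forall y, x <= y -> y < x + h -> M y < M x + e.
Hypothesis M0 : forall x, 0 <= M x.
Hypothesis MB : forall x, M x <= B.
Hypothesis vf : forall x, (f @` sphere (d := d)) (v x).
Hypothesis vM : forall x y, x <= y -> enorm (v y - v x) <= M y - M x.
Implicit Types (p q : 'rV[R]_d) (n : R -> 'rV[R]_d).

(** If [dot p q < 0], the Lipschitz bound holds for [p] and [- q], and |p - q|^2 = |p + q|^2 - 4 p .
    q exceeds |p + q|^2 by at most (2 e)^2. *)
Lemma enorm_sub_approx p q e : sphere p -> sphere q -> 0 <= e ->
  - e ^+ 2 <= dot p q -> enorm (p - q) <= C * enorm (f p - f q) + 2 * e.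
Proof.
move=> p1 q1 e0 pq; have [pq0|pq0] := leP 0 (dot p q).
  by rewrite (le_trans (fC p1 q1 pq0))// lerDl mulr_ge0.
have := fC p1 (sphereN q1); rewrite dotNr emb_lineN opprK => /(_ _)h.
have {}h : enorm (p + q) <= C * enorm (f p - f q) by apply: h; lra.
have A2 := sqr_sphere_dist p1 q1.
have := sqr_sphere_dist p1 (sphereN q1); rewrite opprK dotNr => B2.
have W0 : 0 <= C * enorm (f p - f q) by rewrite mulr_ge0 ?enorm_ge0 ?ltW.
have pq2 : enorm (p + q) ^+ 2 <= (C * enorm (f p - f q)) ^+ 2.
  by rewrite ler_pXn2r// nnegrE ?enorm_ge0.
rewrite -(@ler_pXn2r _ 2)// ?nnegrE ?enorm_ge0//; last first.
  by rewrite addr_ge0// mulr_ge0.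
rewrite sqrrD; nra.
Qed.

Lemma enorm_vB x y : enorm (v y - v x) <= `|M y - M x|.
Proof.
have [xy|yx] := leP x y; first by rewrite (le_trans (vM xy))// ler_norm.
by rewrite enormBC distrC (le_trans (vM (ltW yx)))// ler_norm.
Qed.

Lemma dot_ge0_near p q : sphere p -> sphere q -> enorm (p - q) <= 1 -> 0 <= dot p q.
Proof.
move=> p1 q1 pq; have := sqr_sphere_dist p1 q1; have := enorm_ge0 (p - q); nra.
Qed.

(** All signs are chosen relative to [q]. On [L] this puts each lift within C / (2 C) = 1/2 of [q],
    so any two are within 1. *)
Lemma lift_level (L : set R) (x0 : R) q : L x0 -> sphere q -> f q = v x0 ->
  (forall x y, L x -> L y -> M y - M x < (2 * C)^-1) ->
  exists n, [/\ n x0 = q, forall x, sphere (n x), forall x, f (n x) = v x &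
    forall x y, L x -> L y -> 0 <= dot (n x) (n y)].
Proof.
move=> Lx0 q1 fq LM.
have ex x : exists p, sphere p /\ f p = v x by have [p] := vf x; exists p.
have [pick hpick] := choice ex.
pose n x := if 0 <= dot (pick x) q then pick x else - pick x.
have n1 x : sphere (n x).
  by have [? _] := hpick x; rewrite /n; case: ifP => // _; exact: sphereN.
have fn x : f (n x) = v x.
  by have [_ ?] := hpick x; rewrite /n; case: ifP; rewrite ?emb_lineN.
have nq x : 0 <= dot (n x) q.
  rewrite /n; case: ifPn => //; rewrite -ltNge => /ltW.
  by rewrite dotNl oppr_ge0.
have near x : L x -> enorm (n x - q) <= 2^-1.
  move=> Lx; rewrite (le_trans (fC (n1 x) q1 (nq x)))// fn fq.
  have h : enorm (v x - v x0) <= (2 * C)^-1.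
    rewrite (le_trans (enorm_vB _ _))// ler_norml.
    by have := LM _ _ Lx Lx0; have := LM _ _ Lx0 Lx; lra.
  have : C * enorm (v x - v x0) <= C * (2 * C)^-1 by rewrite ler_wpM2l// ltW.
  by move/le_trans; apply; rewrite invfM mulrCA mulfV ?gt_eqF// mulr1.
exists n; split=> //.
  by apply: (emb_line_inj_dot emb) => //; rewrite fn fq.
move=> x y Lx Ly; apply: dot_ge0_near => //.
rewrite (le_trans (enorm_distD q _ _))// (enormBC q).
by have := near _ Lx; have := near _ Ly; lra.
Qed.

(** The last clause expresses that the left limit of [n] at [y] makes a non-obtuse angle with [n y],
    without mentioning that limit. *)
Definition lifts_on (E : set R) n := [/\ forall x, E x -> sphere (n x),
  forall x, E x -> f (n x) = v x,
  forall x y, E x -> E y -> x <= y -> enorm (n y - n x) <= C * (M y - M x) &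
  forall y e, E y -> 0 < e -> exists2 h, 0 < h &
    forall x, E x -> y - h < x -> x < y -> - e <= dot (n x) (n y)].

Lemma nondecreasing_left_osc t e : 0 < e ->
  exists2 h, 0 < h & forall x y, t - h < x -> x <= y -> y < t -> M y - M x < e.
Proof.
move=> e0; pose S := M @` [set x | x < t].
have supS : has_sup S.
  split; first by exists (M (t - 1)); exists (t - 1) => //=; rewrite ltrBlDr ltrDl.
  by exists B => _ [x _ <-].
have [_ [s /= st <-] sS] := sup_adherent e0 supS.
exists (t - s); first by rewrite subr_gt0.
move=> x y sx xy yt.
have My : M y <= sup S by apply: sup_ubound => //; [exact: supS.2|exists y].
have Mx : M s <= M x by apply: ndM; lra.
lra.
Qed.

(* The sign of the lift after t is chosen so that it makes a non-obtuse angle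
   with the lift before t. *)
Lemma choose_sign t n q : sphere q ->
  (forall x, x < t -> sphere (n x)) ->
  (forall x y, x <= y -> y < t -> enorm (n y - n x) <= C * (M y - M x)) ->
  exists2 q', q' = q \/ q' = - q & forall e, 0 < e -> exists2 h, 0 < h &
    forall x, t - h < x -> x < t -> - e <= dot (n x) q'.
Proof.
move=> q1 n1 nM.
have [hq|] := pselect (forall e, 0 < e -> exists2 h, 0 < h &
    forall x, t - h < x -> x < t -> - e <= dot (n x) q).
  by exists q => //; left.
move=> /existsNP[e /not_implyP[e0 he]].
exists (- q); first by right.
(* Close to [t] the lift moves by at most [e]. So one point [x] with [dot (n x) q < - e] forces
   [dot (n y) q <= 0] for all later [y < t]. *)
have eC : 0 < e / C by rewrite divr_gt0.
have [h h0 osc] := nondecreasing_left_osc t eC.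
have [x [hx xt xe]] : exists x, [/\ t - h < x, x < t & dot (n x) q < - e].
  apply: contrapT => nx; apply: he; exists h => // x hx xt.
  by rewrite leNgt; apply/negP => xe; apply: nx; exists x.
move=> e' e'0; exists (t - x); first by rewrite subr_gt0.
move=> y xy yt; have {}xy : x <= y by lra.
have d1 : enorm (n y - n x) <= e.
  rewrite (le_trans (nM _ _ xy yt))// mulrC -ler_pdivlMr// ltW// osc//.
have := dot_le_enorm (n y - n x) q; rewrite dotBl q1 mulr1 dotNr; lra.
Qed.

(** The next level set [L] of [M] starts at [t = inf L]. Before [t] the old lift is kept; from [t]
    on a lift of [L] is used whose sign at [t] comes from [choose_sign]. *)
Lemma lifts_on_extend (k : nat) n : let dl := (2 * C)^-1 in
  lifts_on [set x | M x < k%:R * dl] n ->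
  exists n', lifts_on [set x | M x < k.+1%:R * dl] n'.
Proof.
move=> dl [n1 fn nM nJ].
have dl0 : 0 < dl by rewrite invr_gt0 mulr_gt0.
pose E := [set x | M x < k%:R * dl].
pose L := [set x | k%:R * dl <= M x /\ M x < k.+1%:R * dl].
have EL x : M x < k.+1%:R * dl -> E x \/ L x.
  by move=> xk; have [?|?] := ltP (M x) (k%:R * dl); [left|right].
have LM x y : L x -> L y -> M y - M x < dl.
  by move=> [kx xk] [ky yk]; move: xk yk; rewrite -natr1 mulrDl mul1r; lra.
have down x y : x <= y -> M y < k.+1%:R * dl -> M x < k.+1%:R * dl.
  by move=> xy; apply: le_lt_trans; exact: ndM.
have Edown x y : x <= y -> E y -> E x.
  by move=> xy; apply: le_lt_trans; exact: ndM.
have nearL m : (forall x, sphere (m x)) -> (forall x, f (m x) = v x) ->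
    (forall x y, L x -> L y -> 0 <= dot (m x) (m y)) ->
    forall x y, L x -> L y -> x <= y -> enorm (m y - m x) <= C * (M y - M x).
  move=> m1 fm mL x y Lx Ly xy; rewrite (le_trans (fC (m1 y) (m1 x) (mL _ _ Ly Lx)))//.
  by rewrite !fm ler_wpM2l ?(ltW C0)// vM.
have [[x0 Lx0]|noL] := pselect (exists x, L x); last first.
  exists n; suff -> : [set x | M x < k.+1%:R * dl] = E by split.
  apply/seteqP; split=> x /=; first by move=> /EL[//|Lx]; case: noL; exists x.
  by move/lt_trans; apply; rewrite ltr_pM2r// ltr_nat.
have [[z Ez]|noE] := pselect (exists x, E x); last first.
  have [q q1 fq] := vf x0.
  have [m [_ m1 fm mL]] := lift_level Lx0 q1 fq LM.
  have Lall x : M x < k.+1%:R * dl -> L x.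
    by move=> /EL[Ex|//]; case: noE; exists x.
  exists m; split=> [x _|x _|x y /Lall Lx /Lall Ly|y e /Lall Ly e0] //.
    exact: nearL.
  exists 1 => // x /Lall Lx _ _; rewrite (le_trans _ (mL _ _ Lx Ly))// oppr_le0.
  exact: ltW.
pose t := inf L.
have infL : has_inf L.
  split; first by exists x0.
  exists z => y [ky _]; rewrite leNgt; apply/negP => yz.
  by have := Edown _ _ (ltW yz) Ez; rewrite /E/=; lra.
have tL y : L y -> t <= y by move=> Ly; apply: inf_lbound => //; exact: infL.2.
(* Right continuity of [M] makes the infimum belong to [L], so [v t] itself can be lifted as the
   reference value. *)
have Lt : L t.
  split; last by apply: down (tL _ Lx0) _; case: Lx0.
  rewrite leNgt; apply/negP => Mt.
  have e0 : 0 < k%:R * dl - M t by rewrite subr_gt0.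
  have [h h0 hM] := rcM t e0.
  have [y Ly yt] := inf_adherent h0 infL.
  have := hM y (tL _ Ly) yt; have := Ly.1; lra.
have ltE x : x < t -> E x.
  move=> xt; have [//|Lx] := EL x (down _ _ (ltW xt) Lt.2).
  by have := tL _ Lx; lra.
have geL y : t <= y -> M y < k.+1%:R * dl -> L y.
  by move=> ty yk; split=> //; apply: le_trans Lt.1 _; exact: ndM.
have [q0 q01 fq0] := vf t.
have [q qq0 qJ] := choose_sign q01 (fun x xt => n1 x (ltE x xt))
  (fun x y xy yt => nM x y (ltE x (le_lt_trans xy yt)) (ltE y yt) xy).
have q1 : sphere q by case: qq0 => ->//; exact: sphereN.
have fq : f q = v t by case: qq0 => ->; rewrite ?emb_lineN.
have [m [mt m1 fm mL]] := lift_level Lt q1 fq LM.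
(* Pass through [z'] just before [t]: up to [z'] the old bound applies, and from [z'] to [t] the
   angle is only nearly non-obtuse. The tolerance [(e / 2) ^+ 2] on the product costs [e] in
   distance. *)
have nm x : x < t -> enorm (m t - n x) <= C * (M t - M x).
  move=> xt; apply/ler_addgt0Pr => e e0.
  have e20 : 0 < e / 2 by rewrite divr_gt0.
  have [h h0 hJ] := qJ _ (exprn_gt0 2 e20).
  pose z' := Num.max x (t - h / 2).
  have [xz' z't hz'] : [/\ x <= z', z' < t & t - h < z'].
    rewrite /z' le_max lexx gt_max xt lt_max; split=> //; first lra.
    by apply/orP; right; lra.
  have Ez' := ltE _ z't.
  rewrite (le_trans (enorm_distD (n z') _ _))//.
  have h1 := nM _ _ (ltE _ xt) Ez' xz'.
  have := enorm_sub_approx q1 (n1 _ Ez') (ltW e20) _; rewrite dotC => /(_ (hJ _ hz' z't)).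
  rewrite fq (fn _ Ez') -mt => h2.
  have h3 : C * enorm (v t - v z') <= C * (M t - M z').
    by rewrite ler_wpM2l ?(ltW C0)// vM// ltW.
  lra.
exists (fun x => if x < t then n x else m x); split.
- by move=> x xk /=; case: ifP => // /ltE; exact: n1.
- by move=> x xk /=; case: ifP => // /ltE; exact: fn.
- move=> x y xk yk xy /=; case: (ltP x t) => xt; case: (ltP y t) => yt.
  + by apply: nM => //; exact: ltE.
  + rewrite (le_trans (enorm_distD (m t) _ _))//.
    have := nearL m m1 fm mL _ _ Lt (geL _ yt yk) yt; have := nm _ xt; lra.
  + by have := lt_le_trans yt (le_trans xt xy); rewrite ltxx.
  + by apply: nearL => //; exact: geL.
- move=> y e yk e0 /=; have [yt|ty|yt] := ltgtP y t.
  + have [h h0 hJ] := nJ y e (ltE _ yt) e0; exists h => // x _ hx xy.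
    by rewrite (lt_trans xy yt); apply: hJ => //; exact: ltE (lt_trans xy yt).
  + exists (y - t); first by rewrite subr_gt0.
    move=> x xk; rewrite opprB addrC subrK => tx xy.
    rewrite ltNge (ltW tx)/= (le_trans _ (mL _ _ _ _)) ?oppr_le0 ?(ltW e0)//.
      by apply: geL => //; exact: ltW.
    by apply: geL => //; exact: ltW.
  + have [h h0 hJ] := qJ e e0; exists h => // x _; rewrite yt => hx xt.
    by rewrite xt mt; exact: hJ.
Qed.

(** The induction starts from the empty level, as [M >= 0], and reaches the whole line after
    finitely many levels, as [M <= B]. *)
Theorem lifting : exists n : R -> 'rV[R]_d,
  [/\ forall x, sphere (n x), forall x, f (n x) = v x,
      forall x y, x <= y -> enorm (n y - n x) <= C * (M y - M x) &
      forall y e, 0 < e -> exists2 h, 0 < h &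
        forall x, y - h < x -> x < y -> - e <= dot (n x) (n y)].
Proof.
pose dl := (2 * C)^-1; have dl0 : 0 < dl by rewrite invr_gt0 mulr_gt0.
have ex k : exists n, lifts_on [set x | M x < k%:R * dl] n.
  elim: k => [|k [n /lifts_on_extend//]].
  exists (fun=> 0); split=> [x|x|x y|y e] /=; rewrite mul0r ltNge M0//.
have [n] := ex (Num.bound (B / dl)); set E := [set x | _].
have -> : E = setT.
  apply/seteqP; split=> // x _; rewrite /E/= (le_lt_trans (MB x))//.
  by rewrite -ltr_pdivrMr// archi_boundP// divr_ge0 ?(ltW dl0)// (le_trans (M0 0)).
case=> n1 fn nM nJ; exists n; split=> [x|x|x y|y e e0]; [exact: n1|exact: fn| |].
  exact: nM.
by have [h h0 hJ] := nJ y e Logic.I e0; exists h => // x; exact: hJ.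
Qed.

End lifting.

(** * One-sided traces *)

Section averages.
Context {R : realType}.
Local Notation leb := (@lebesgue_measure R).

Lemma average_cvg (J : R -> set R) (g : R -> R) (c : R) : 0 <= c ->
  (forall r, 0 < r -> measurable (J r) /\ leb (J r) = r%:E) ->
  (forall x, 0 <= g x) ->
  (forall e : R, 0 < e -> exists2 h : R, 0 < h & forall r, 0 < r -> r < h ->
    measurable_fun (J r) g /\ {ae leb, forall y, J r y -> `|g y - c| <= e}) ->
  ((r^-1)%:E * \int[leb]_(y in J r) (g y)%:E)%E @[r --> 0^'+] --> c%:E.
Proof.
move=> c0 JE g0 gc.
pose X r : \bar R := ((r^-1)%:E * \int[leb]_(y in J r) (g y)%:E)%E.
have X0 r : 0 < r -> (0 <= X r)%E.
  move=> r0; apply: mule_ge0; first by rewrite lee_fin invr_ge0 ltW.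
  by apply: integral_ge0 => y _; rewrite lee_fin.
have bd (e : R) : 0 < e -> \forall r \near 0^'+, ((c - e)%:E <= X r <= (c + e)%:E)%E.
  move=> e0; have [h h0 hJ] := gc e e0; near=> r.
  have r0 : 0 < r by near: r; exact: nbhs_right_gt.
  have rh : r < h by near: r; exact: nbhs_right_lt.
  have [mg ge] := hJ r r0 rh.
  have [mJ lJ] := JE r r0.
  have meg : measurable_fun (J r) (EFin \o g) by exact/measurable_EFinP.
  have scale k : ((r^-1)%:E * (k%:E * r%:E) = k%:E)%E.
    by rewrite -!EFinM mulrCA mulVf ?mulr1 ?gt_eqF.
  apply/andP; split.
    have [ce|ce] := leP (c - e) 0; first by rewrite (le_trans _ (X0 _ r0))// lee_fin.
    rewrite -[leLHS]scale -lJ -integral_cst// lee_pmul2l ?lte_fin ?invr_gt0//.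
    have {}ge : {ae leb, forall y, J r y -> ((c - e)%:E <= (g y)%:E)%E}.
      apply: (@filterS _ _ (ae_filter_ringOfSetsType leb)) ge => y + Jy.
      by move=> /(_ Jy); rewrite lee_fin ler_norml; lra.
    by apply: ae_ge0_le_integral => // [y _|y _]; rewrite ?lee_fin ?g0 ?ltW.
  rewrite -[leRHS]scale -lJ -integral_cst// lee_pmul2l ?lte_fin ?invr_gt0//.
  have {}ge : {ae leb, forall y, J r y -> ((g y)%:E <= (c + e)%:E)%E}.
    apply: (@filterS _ _ (ae_filter_ringOfSetsType leb)) ge => y + Jy.
    by move=> /(_ Jy); rewrite lee_fin ler_norml; lra.
  by apply: ae_ge0_le_integral => // y _ /=; rewrite lee_fin ?g0// addr_ge0// ltW.
apply/fine_cvgP; split.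
  near=> r; have /andP[X1 X2] : ((c - 1)%:E <= X r <= (c + 1)%:E)%E.
    by near: r; exact: bd.
  by rewrite fin_numElt (lt_le_trans _ X1) ?ltNyr// (le_lt_trans X2)// ltry.
apply/cvgrPdist_le => e e0; near=> r.
have : ((c - e)%:E <= X r <= (c + e)%:E)%E by near: r; exact: bd.
rewrite /= -/(X r); case: (X r) => [x| |] /=.
- by rewrite !lee_fin ler_norml; lra.
- by rewrite leye_eq andbF.
- by [].
Unshelve. all: by end_near. Qed.

Context {m : nat} (I : set R) (u v : R -> 'rV[R]_m).
Hypothesis oI : open I.
Hypothesis mu : forall i, measurable_fun I (fun x => u x 0 i).
Hypothesis uv : {ae leb, forall x, I x -> u x = v x}.

Lemma measurable_enorm_sub a : measurable_fun I (fun y => enorm (u y - a)).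
Proof.
rewrite (_ : (fun y => _) = Num.sqrt \o (fun y => \sum_i (u y 0 i - a 0 i) ^+ 2)).
  apply: measurableT_comp.
    by apply: continuous_measurable_fun; exact: sqrt_continuous.
  apply: measurable_sum => i; apply: measurable_funX.
  by apply: measurable_funB => //; exact: measurable_cst.
apply/funext => y; rewrite /enorm /dot/=; congr Num.sqrt.
by apply: eq_bigr => i _; rewrite !mxE expr2.
Qed.

Lemma near_open_itv x : I x -> exists2 h : R, 0 < h & forall y, x - h < y -> y < x + h -> I y.
Proof.
move=> Ix; have /nbhs_ballP[r /= r0 rI] : nbhs x I by exact: open_nbhs_nbhs.
by exists r => // y xy yx; apply: rI; rewrite ball_itv/= in_itv/= xy.
Qed.

(** The averages of [enorm (u y - a)] tend to [enorm (l - a)], which vanishes only for [a = l]. *)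
Lemma trace_limitE (J : R -> set R) x l a : I x ->
  (forall r, 0 < r -> measurable (J r) /\ leb (J r) = r%:E) ->
  (forall r y, J r y -> x - r < y < x + r) ->
  (forall e : R, 0 < e -> exists2 h : R, 0 < h & forall r y, r < h -> J r y ->
     enorm (v y - l) < e) ->
  ((r^-1)%:E * \int[leb]_(y in J r) (enorm (u y - a))%:E)%E @[r --> 0^'+] --> 0%E
  <-> a = l.
Proof.
move=> Ix JE Jx vl.
have h : ((r^-1)%:E * \int[leb]_(y in J r) (enorm (u y - a))%:E)%E @[r --> 0^'+] -->
    (enorm (l - a))%:E.
  apply: average_cvg => // [|y|e e0]; rewrite ?enorm_ge0//.
  have [h h0 hv] := vl e e0; have [k k0 kI] := near_open_itv Ix.
  exists (Num.min h k); first by rewrite lt_min h0.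
  move=> r r0; rewrite lt_min => /andP[rh rk].
  have JI : J r `<=` I by move=> y /Jx yr; apply: kI; lra.
  split; first by apply: measurable_funS (measurable_enorm_sub a) => //; exact: open_measurable.
  apply: (@filterS _ _ (ae_filter_ringOfSetsType leb)) uv => y uvy Jy.
  rewrite uvy//; last exact: JI.
  rewrite (le_trans (ler_enorm_dist _ _))// opprB addrA subrK ltW//.
  exact: hv Jy.
split=> [h0|aE]; last by move: h; rewrite aE subrr enorm0.
have := cvg_lim (@ereal_hausdorff R) h; rewrite (cvg_lim (@ereal_hausdorff R) h0).
by move=> /(_ (at_right_proper_filter 0))[] /esym/enorm_eq0/subr0_eq.
Qed.

Context (P : {finite_measure set (measurableTypeR R) -> \bar R})
  (Dv : vcharge (R := R) m) (K : R).
Hypothesis vD : forall a b, a <= b -> v b - v a = vcharge_val Dv `]a, b]%classic.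
Hypothesis K0 : 0 < K.
Hypothesis DP : forall A, measurable A -> ((enorm (vcharge_val Dv A))%:E <= K%:E * P A)%E.

Lemma primitive_right x (e : R) : 0 < e ->
  exists2 h : R, 0 < h & forall y, x < y -> y < x + h -> enorm (v y - v x) < e.
Proof.
move=> e0; have [h h0 hP] := itv_right_small P x (divr_gt0 e0 K0).
exists h => // y xy yh; rewrite vD ?(ltW xy)// -lte_fin (le_lt_trans (DP _))//.
rewrite (@le_lt_trans _ _ (K%:E * P `]x, (x + h)%R]%classic)%E)//.
  rewrite lee_pmul2l ?lte_fin//; apply: le_measure; rewrite ?inE//.
  by apply: subset_itvl; rewrite bnd_simp ltW.
by rewrite muleC -lte_pdivlMr// -EFinM.
Qed.

Lemma primitive_left x (e : R) : 0 < e -> exists2 h : R, 0 < h &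
  forall y, x - h < y -> y < x -> enorm (v y - (v x - vcharge_val Dv [set x])) < e.
Proof.
move=> e0; have [h h0 hP] := itv_left_small P x (divr_gt0 e0 K0).
exists h => // y hy yx.
have -> : v y - (v x - vcharge_val Dv [set x]) = - vcharge_val Dv `]y, x[%classic.
  rewrite -opprB; congr (- _); rewrite addrAC vD ?ltW//.
  have -> : `]y, x]%classic = `]y, x[%classic `|` [set x] :> set R.
    by rewrite setUitv1.
  rewrite vcharge_valU//.
    by rewrite addrK.
  by apply/seteqP; split=> // z /= []; rewrite in_itv/= => /andP[_ +] zx; rewrite zx ltxx.
rewrite enormN -lte_fin (le_lt_trans (DP _))//.
rewrite (@le_lt_trans _ _ (K%:E * P `](x - h)%R, x[%classic)%E)//.
  rewrite lee_pmul2l ?lte_fin//; apply: le_measure; rewrite ?inE//.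
  by apply: subset_itvr; rewrite bnd_simp ltW.
by rewrite muleC -lte_pdivlMr// -EFinM.
Qed.

Lemma right_traceE x a : I x -> right_trace u x a <-> a = v x.
Proof.
move=> Ix; apply: (@trace_limitE (fun r => `]x, (x + r)%R[%classic) x (v x) a Ix) => // [r r0|r y /=|e e0].
- by split=> //; rewrite lebesgue_measure_itv/= lte_fin ltrDl r0 -EFinB addrAC subrr add0r.
- by rewrite in_itv/=; lra.
- have [h h0 hv] := primitive_right x e0; exists h => // r y rh /=.
  by rewrite in_itv/= => /andP[xy yr]; apply: hv => //; lra.
Qed.

Lemma left_traceE x a : I x -> left_trace u x a <-> a = v x - vcharge_val Dv [set x].
Proof.
move=> Ix; apply: (@trace_limitE (fun r => `](x - r)%R, x[%classic) x _ a Ix) => // [r r0|r y /=|e e0].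
- split=> //; rewrite lebesgue_measure_itv/= lte_fin ltrBlDr ltrDl r0 -EFinB.
  by rewrite opprB addrC subrK.
- by rewrite in_itv/=; lra.
- have [h h0 hv] := primitive_left x e0; exists h => // r y rh /=.
  by rewrite in_itv/= => /andP[xy yr]; apply: hv => //; lra.
Qed.

Lemma jump_tracesE x up um : I x -> jump_traces I u x up um <->
  [/\ vcharge_val Dv [set x] <> 0, up = v x & um = v x - vcharge_val Dv [set x]].
Proof.
move=> Ix; split=> [[_ upm /(right_traceE _ Ix) upE /(left_traceE _ Ix) umE]|[D0 -> ->]].
  by split=> // D0; apply: upm; rewrite upE umE D0 subr0.
split=> //; [|exact/right_traceE|exact/left_traceE].
by move=> /eqP; rewrite -subr_eq0 opprB addrC subrK => /eqP.
Qed.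

Lemma jump_setE : jump_set I u = [set x | I x /\ vcharge_val Dv [set x] <> 0].
Proof.
apply/seteqP; split=> [x [up [um j]]|x [Ix D0]] /=.
  by have [Ix _ _ _] := j; move: j => /(jump_tracesE _ _ Ix)[].
by exists (v x), (v x - vcharge_val Dv [set x]); apply/jump_tracesE.
Qed.

Lemma countable_atoms : countable [set x | (0 < P [set x])%E].
Proof.
rewrite [X in countable X](_ : _ =
    \bigcup_n [set x | (n.+1%:R^-1%:E < P [set x])%E]); last first.
  apply/seteqP; split=> [x/= Px|x/= [k _]]; last first.
    by apply: le_lt_trans; rewrite lee_fin.
  have Pf : P [set x] \is a fin_num by rewrite fin_num_measure.
  move: Px; rewrite -(fineK Pf) lte_fin => /ltr_add_invr[k].
  by rewrite add0r => kx; exists k => //=; rewrite -(fineK Pf) lte_fin.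
apply: bigcup_countable => // n _; apply: finite_set_countable.
apply: contrapT => /infiniteP/pcard_leP/injfunPex[/= q q_fun q_inj].
have tq : trivIset setT (fun k => [set q k]).
  apply/trivIsetP => i j _ _ ij; apply/seteqP; split=> // x [/= -> qij].
  by move: ij; rewrite (q_inj i j) ?eqxx// inE.
(* [N] atoms of mass more than 1 / (n + 1) would exceed the total mass of [P]. *)
pose N := (Num.truncn (n.+1%:R * fine (P setT))).+1.
have : (\sum_(0 <= k < N) P [set q k] <= P setT)%E.
  have -> : (\sum_(0 <= k < N) P [set q k] = P (\big[setU/set0]_(k < N) [set q k]))%E.
    by rewrite big_mkord; apply/esym/(@measure_bigsetU _ _ _ P (fun k => [set q k])).
  by apply: le_measure; rewrite ?inE//; exact: bigsetU_measurable.
apply/negP; rewrite -ltNge.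
have PT : P setT \is a fin_num by rewrite fin_num_measure.
rewrite (@lt_le_trans _ _ (\sum_(0 <= k < N) (n.+1%:R^-1)%:E)%E)//; last first.
  by apply: lee_sum => k _; apply: ltW; exact: q_fun.
rewrite sumEFin sumr_const_nat subn0 -(fineK PT) lte_fin -[ltRHS]mulr_natl.
by rewrite ltr_pdivlMr// mulrC truncnS_gt.
Qed.

Lemma measurable_jump_set : measurable (jump_set I u).
Proof.
apply: countable_measurable => //.
apply: sub_countable countable_atoms; apply: subset_card_le.
rewrite jump_setE => x /= [_ D0]; rewrite lt0e measure_ge0 andbT.
apply/eqP => P0; apply: D0; apply: enorm_eq0; apply/eqP.
by rewrite eq_le enorm_ge0 andbT -lee_fin (le_trans (DP _))// P0 mule0.
Qed.

End averages.

(** * Decomposition of the derivatives *)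

Section singular_part.
Context {R : realType}.
Local Notation leb := (@lebesgue_measure R).
Local Notation T := (measurableTypeR R).

(** [Z] is a Lebesgue-null set of maximal [P]-mass, the union of a maximizing sequence. A null set
    with mass outside [Z] could be added to it and would exceed the supremum. *)
Lemma lebesgue_null_exhaustion (P : {finite_measure set T -> \bar R}) :
  exists Z : set T, [/\ measurable Z, leb Z = 0%E &
    forall A, measurable A -> leb A = 0%E -> P (A `\` Z) = 0%E].
Proof.
have Pf A : measurable A -> P A \is a fin_num by move=> mA; rewrite fin_num_measure.
pose S := [set fine (P A) | A in [set A | measurable A /\ leb A = 0%E]].
have supS : has_sup S.
  split; first by exists (fine (P set0)); exists set0 => //; split => //; rewrite measure0.
  by exists (fine (P setT)) => _ [A [mA _] <-]; rewrite fine_le ?Pf// le_measure ?inE.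
have ex k : exists A, [/\ measurable A, leb A = 0%E & sup S - k.+1%:R^-1 < fine (P A)].
  have k0 : 0 < k.+1%:R^-1 :> R by rewrite invr_gt0.
  by have [_ [A [mA A0] <-] hA] := sup_adherent k0 supS; exists A.
have [Z hZ] := choice ex.
have mZ : measurable (\bigcup_k Z k) by apply: bigcup_measurable => k _; case: (hZ k).
set U := \bigcup_k Z k in mZ.
have U0 : leb U = 0%E.
  apply: (measure_negligible mZ); apply: negligible_bigcup => k.
  by have [mk k0 _] := hZ k; exists (Z k); split.
exists U; split=> // A mA A0.
have leU : sup S <= fine (P U).
  apply/ler_addgt0Pr => e e0.
  have [k ke] : exists k, k.+1%:R^-1 < e :> R.
    by have [k] := ltr_add_invr e0; rewrite add0r; exists k.
  have [mk _ hk] := hZ k.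
  have h : fine (P (Z k)) <= fine (P U).
    by rewrite fine_le ?Pf// le_measure ?inE//; exact: bigcup_sup.
  rewrite -lerBlDr (le_trans _ h)// (le_trans _ (ltW hk))//.
  by rewrite lerD2l lerN2 ltW.
have mAU : measurable (A `\` U) by exact: measurableD.
have : fine (P (A `\` U)) + fine (P U) <= sup S.
  rewrite -fineD ?Pf// -measureU//; last by rewrite setDKI.
  apply: sup_ubound; first exact: supS.2.
  exists ((A `\` U) `|` U) => //; split; first exact: measurableU.
  have AU0 : leb (A `\` U) = 0%E by apply: (subset_measure0 mAU mA) => //; exact: subDsetl.
  transitivity (leb (A `\` U) + leb U)%E; last by rewrite AU0 U0 adde0.
  by apply: measureU => //; rewrite setDKI.
move=> h; have {}h : fine (P (A `\` U)) <= 0 by lra.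
by apply/eqP; rewrite eq_le measure_ge0 andbT -(fineK (Pf _ mAU)) lee_fin.
Qed.

Context {m : nat}.
Implicit Types (nu : vcharge (R := R) m).

Definition vrestr nu (B : set T) (mB : measurable B) : vcharge (R := R) m :=
  fun i => crestr (nu i) mB.

Lemma vcharge_val_restr nu B (mB : measurable B) A :
  vcharge_val (vrestr nu mB) A = vcharge_val nu (A `&` B).
Proof. by []. Qed.

Lemma tot_var_restr nu B (mB : measurable B) A : measurable A ->
  tot_var (vrestr nu mB) A = tot_var nu (A `&` B).
Proof.
move=> mA; have mAB : measurable (A `&` B) by exact: measurableI.
apply/eqP; rewrite eq_le; apply/andP; split; apply: tot_var_le => F mF tF FA n.
  apply: (@tot_var_ge_sum _ _ nu (fun k => F k `&` B)) => // k.
  - exact: measurableI.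
  - exact: trivIset_setIr.
  - by rewrite -FA; apply: setSI; exact: bigcup_sup.
have FB k : F k `&` B = F k.
  by apply/setIidPl => x Fx; have [] : (A `&` B) x by rewrite -FA; exists k.
under eq_bigr do rewrite -FB -vcharge_val_restr.
apply: tot_var_ge_sum => // k; apply: subset_trans (@subIsetl _ A B).
by rewrite -FA; exact: bigcup_sup.
Qed.

Lemma BV_parts_restr (I : set R) (w : R -> 'rV[R]_m) Dw
    (P : {finite_measure set T -> \bar R}) (K : R) (Z : set T)
    (mZ : measurable Z) (mJ : measurable (jump_set I w)) :
  distributional_derivative I w Dw ->
  (forall A, measurable A -> ((enorm (vcharge_val Dw A))%:E <= K%:E * P A)%E) ->
  leb Z = 0%E ->
  (forall A, measurable A -> leb A = 0%E -> P (A `\` Z) = 0%E) ->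
  BV_parts I w (vrestr Dw (measurableC mZ))
    (vrestr (vrestr Dw mZ) (measurableC mJ)) (vrestr (vrestr Dw mZ) mJ).
Proof.
move=> dw DP Z0 PZ; exists Dw, (vrestr Dw mZ); split=> //.
split=> [i A mA|i|].
- transitivity (Dw i ((A `&` ~` Z) `|` (A `&` Z))).
    by rewrite -setIUr setUCl setIT.
  rewrite chargeU//; [|exact: measurableI|].
    by apply: measurableI => //; exact: measurableC.
  by rewrite setIACA setICl !setI0.
- apply/null_content_dominatesP => A mA A0.
  have mAZ : measurable (A `&` ~` Z) by apply: measurableI => //; exact: measurableC.
  have : (`|vcharge_val Dw (A `&` ~` Z) 0 i|%:E <= 0)%E.
    rewrite (@le_trans _ _ (enorm (vcharge_val Dw (A `&` ~` Z)))%:E)//.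
      by rewrite lee_fin normr_coord_le.
    by rewrite (le_trans (DP _ mAZ))// -setDE PZ// mule0.
  rewrite lee_fin normr_le0 mxE => /eqP h.
  by rewrite /vrestr /= /crestr -[LHS]fineK ?fin_num_measure// h.
- exists Z; split=> // i A mA.
  by rewrite /vrestr /= /crestr setDE -setIA setICl setI0 charge0.
Qed.

End singular_part.

(** * Primitives of vector measures have bounded variation *)

Section primitive.
Context {R : realType} {m : nat} (I : set R) (n : R -> 'rV[R]_m) (Dn : vcharge (R := R) m).
Local Notation leb := (@lebesgue_measure R).
Local Notation T := (measurableTypeR R).
Hypothesis oI : open I.
Hypothesis nD : forall a b, a <= b -> n b - n a = vcharge_val Dn `]a, b]%classic.
Hypothesis D0 : forall i A, measurable A -> A `&` I = set0 -> Dn i A = 0%E.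

Lemma primitive_cdf : exists c, forall x, n x = c + vcharge_val Dn `]-oo, x]%classic.
Proof.
pose c x := n x - vcharge_val Dn `]-oo, x]%classic.
have cE a b : a <= b -> c a = c b.
  move=> ab; rewrite /c.
  have -> : `]-oo, b]%classic = `]-oo, a]%classic `|` `]a, b]%classic :> set R.
    by rewrite (@itv_bndbnd_setU _ _ -oo%O (BRight a) (BRight b)) ?bnd_simp.
  rewrite vcharge_valU//.
    by rewrite -nD//; apply/rowP => i; rewrite !mxE; ring.
  by apply/seteqP; split=> // x /= []; rewrite !in_itv/= => xa /andP[]; rewrite ltNge xa.
exists (c 0) => x; rewrite (_ : c 0 = c x) ?subrK//.
by have [x0|x0] := leP 0 x; [exact: cE|apply/esym/cE/ltW].
Qed.

Lemma primitive_measurable i (E : set R) : measurable E -> measurable_fun E (fun x => n x 0 i).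
Proof.
move=> mE; have [c nE] := primitive_cdf.
rewrite (_ : (fun x => _) = (fun x => c 0 i + fine (Dn i `]-oo, x]%classic))).
  by apply: measurable_funD => //; exact: charge_cdf_measurable.
by apply/funext => x; rewrite nE !mxE.
Qed.

Lemma test_function_integral0 phi : test_function I phi ->
  (\int[leb]_(x in I) (phi^`()%classic x)%:E = 0)%E.
Proof.
move=> tphi; have [a [b [ab phi0 phi'0]]] := test_function_support tphi.
transitivity (\int[leb]_x (phi^`()%classic x)%:E)%E.
  by apply/esym; apply: integral_support => // x _ Ix; rewrite phi'0//; right.
(* Evaluated to the left of the support, the formula says that the integral of the derivative over
   the whole line is 0. *)
have := test_function_integral tphi (a - 1); rewrite phi0; last first.
  by left; rewrite /= in_itv/= => /andP[]; lra.
rewrite (_ : integral _ _ _ = - \int[leb]_x (phi^`()%classic x)%:E)%E.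
  by move/eqP; rewrite eq_sym oppe_eq0 => /eqP.
rewrite -integralN; last exact: integrable_add_def (integrable_test_derive tphi).
apply: eq_integral => x _; case: ifPn => // /negP ax.
by rewrite phi'0 ?oppe0//; left => /=; rewrite in_itv/= => /andP[]; lra.
Qed.

Lemma primitive_distributional_derivative : distributional_derivative I n Dn.
Proof.
split=> // i phi tphi; have mI := open_measurable oI.
have [c nE] := primitive_cdf.
have iphi : leb.-integrable I (EFin \o phi^`()%classic).
  exact: integrableS (integrable_test_derive tphi).
have [B FB] := charge_cdf_bounded (Dn i).
have iF : leb.-integrable I
    (fun x => (fine (Dn i `]-oo, x]%classic) * phi^`()%classic x)%:E).
  rewrite (_ : (fun x => _) = ((EFin \o phi^`()%classic) \*
      (EFin \o (fun x => fine (Dn i `]-oo, x]%classic))))%E).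
    apply: integrableMl => //; first exact: charge_cdf_measurable.
    exists B; split; first exact: num_real.
    by move=> M BM x _ /=; rewrite (le_trans (FB x))// ltW.
  by apply/funext => x /=; rewrite mulrC.
rewrite -charge_integral_by_parts//.
transitivity (\int[leb]_(x in I) ((c 0 i)%:E * (phi^`()%classic x)%:E +
    (fine (Dn i `]-oo, x]%classic) * phi^`()%classic x)%:E))%E.
  by apply: eq_integral => x _; rewrite nE !mxE mulrDl.
rewrite integralD//; last exact: integrableZl.
by rewrite integralZl// test_function_integral0// mule0 add0e.
Qed.

Lemma bounded_primitive_BV (N : set 'rV[R]_m) (B : R) : (forall x, N (n x)) ->
  (forall x, enorm (n x) <= B) -> BV I N n.
Proof.
move=> Nn nB; split=> [i||].
- have mI := open_measurable oI.
  split=> //; first exact: primitive_measurable.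
  move=> K KI cK; have mK := compact_measurable cK.
  have : leb.-integrable K (EFin \o (fun x => n x 0 i)).
    apply: measurable_bounded_integrable => //.
    - exact: compact_finite_measure.
    - exact: primitive_measurable.
    - exists B; split; first exact: num_real.
      by move=> M BM x _ /=; rewrite (le_trans (normr_coord_le _ _))// (le_trans (nB x))// ltW.
  by case/integrableP.
- by apply: aeW => x _.
- by exists Dn; exact: primitive_distributional_derivative.
Qed.

End primitive.

(** * Comparison of a map with its lift *)

Lemma lee_mul_gt1 (R : realType) (x y : \bar R) : (0 <= y)%E ->
  (forall c : R, 1 < c -> (x <= c%:E * y)%E) -> (x <= y)%E.
Proof.
case: y => [y| |] // y0 xy; last by rewrite leey.
rewrite lee_fin in y0; apply/lee_addgt0Pr => e e0.
have y1 : 0 < y + 1 by rewrite ltr_wpDl.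
have d0 : 0 < e / (y + 1) by rewrite divr_gt0.
have := xy (1 + e / (y + 1)); rewrite ltrDl => /(_ d0) h; apply: le_trans h _.
rewrite -EFinM -EFinD lee_fin mulrDl mul1r lerD2l mulrAC.
by rewrite ler_pdivrMr// ler_wpM2l ?ltW// ltrDl.
Qed.

Section lift.
Context {R : realType} {d D : nat} (iota : set 'rV[R]_d -> 'rV[R]_D).
Hypothesis emb : isometric_embedding iota.
Local Notation f := (emb_line iota).
Local Notation T := (measurableTypeR R).
Context (P : {finite_measure set T -> \bar R}) (K : R).
Context (v : R -> 'rV[R]_D) (n : R -> 'rV[R]_d).
Context (Dv : vcharge (R := R) D) (Dn : vcharge (R := R) d).
Hypothesis n1 : forall x, sphere (n x).
Hypothesis fn : forall x, f (n x) = v x.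
Hypothesis nl : forall y (e : R), 0 < e -> exists2 h : R, 0 < h &
  forall x, y - h < x -> x < y -> - e <= dot (n x) (n y).
Hypothesis vD : forall a b, a <= b -> v b - v a = vcharge_val Dv `]a, b]%classic.
Hypothesis nD : forall a b, a <= b -> n b - n a = vcharge_val Dn `]a, b]%classic.
Hypothesis K0 : 0 < K.
Hypothesis DvP : forall A, measurable A -> ((enorm (vcharge_val Dv A))%:E <= K%:E * P A)%E.
Hypothesis DnP : forall A, measurable A -> ((enorm (vcharge_val Dn A))%:E <= K%:E * P A)%E.

Local Notation vleft x := (v x - vcharge_val Dv [set x]).
Local Notation nleft x := (n x - vcharge_val Dn [set x]).

(** One point [y] serves all three estimates, so closed conditions on [n y] and [v y] pass to the
    left limits. *)
Lemma left_approx x (e : R) : 0 < e -> exists y,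
  [/\ enorm (n y - nleft x) < e, enorm (v y - vleft x) < e & - e <= dot (n y) (n x)].
Proof.
move=> e0; have [h1 h10 H1] := primitive_left nD K0 DnP x e0.
have [h2 h20 H2] := primitive_left vD K0 DvP x e0.
have [h3 h30 H3] := nl x e0.
pose h := Num.min h1 (Num.min h2 h3).
have h0 : 0 < h by rewrite !lt_min h10 h20.
have /and3P[hh1 hh2 hh3] : [&& h <= h1, h <= h2 & h <= h3].
  by have := lexx h; rewrite {2}/h !le_min.
by exists (x - h / 2); split; [apply: H1|apply: H2|apply: H3]; lra.
Qed.

Lemma sphere_nleft x : sphere (nleft x).
Proof.
apply: closed_sphere => B /nbhs_enormP[e e0 eB].
have [y [ny _ _]] := left_approx x e0; exists (n y); split; first exact: n1.
exact: eB.
Qed.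

Lemma dot_nleft_ge0 x : 0 <= dot (n x) (nleft x).
Proof.
rewrite -(@opprK _ (dot _ _)) oppr_ge0; apply/ler_addgt0Pr => e e0; rewrite add0r.
have [y [ny _ nxy]] := left_approx x (divr_gt0 e0 (ltr0n _ 2 : 0 < 2)).
have := normr_dot_le (n y - nleft x) (n x).
rewrite [X in _ * X](n1 x) mulr1 dotBl ler_norml => /andP[_].
by rewrite (dotC (n x)); lra.
Qed.

Lemma emb_line_nleft x : f (nleft x) = vleft x.
Proof.
have [r r0 fr] := near_isometry emb (sphere_nleft x) (@ltr01 R).
apply/eqP; rewrite -subr_eq0; apply/eqP/enorm_eq0/eqP.
rewrite eq_le enorm_ge0 andbT; apply/ler_addgt0Pr => e e0; rewrite add0r.
(* Near [nleft x] the map [f] is 2-Lipschitz, which costs [2 * e / 3]; the approximation of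
   [vleft x] costs the rest. *)
have e30 : 0 < Num.min r (e / 3) by rewrite lt_min r0 divr_gt0.
have [y [ny vy _]] := left_approx x e30.
have /andP[yr ye] : (enorm (n y - nleft x) < r) && (enorm (n y - nleft x) < e / 3).
  by rewrite -lt_min.
have {vy}/andP[_ vy] : (enorm (v y - vleft x) < r) && (enorm (v y - vleft x) < e / 3).
  by rewrite -lt_min.
have := fr _ _ (n1 y) (sphere_nleft x) yr.
rewrite subrr enorm0 fn ler_norml => /(_ r0)/andP[_].
have := enorm_distD (v y) (f (nleft x)) (vleft x).
by rewrite (enormBC _ (v y)); lra.
Qed.

(** If [v] does not jump, [n x] and [nleft x] have the same image under [f], and the non-obtuse
    angle between them rules out antipodal points. *)
Lemma lift_atom x : vcharge_val Dn [set x] = 0 <-> vcharge_val Dv [set x] = 0.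
Proof.
have sub0 (p : nat) (a b : 'rV[R]_p) : a = a - b -> b = 0.
  by move=> /(congr1 (fun z => a - z)); rewrite subrr subKr.
split=> [n0|v0]; first by apply: (sub0 _ (v x)); rewrite -emb_line_nleft n0 subr0 fn.
apply: (sub0 _ (n x)); apply: (emb_line_inj_dot emb (n1 x) (sphere_nleft x)).
  exact: dot_nleft_ge0.
by rewrite emb_line_nleft v0 subr0 fn.
Qed.

Lemma lift_near_isometry x (e : R) : vcharge_val Dn [set x] = 0 -> 0 < e ->
  exists2 h : R, 0 < h & forall s t, x - h < s -> s <= t -> t < x + h ->
    `|enorm (v t - v s) - enorm (n t - n s)| <= e * enorm (n t - n s).
Proof.
move=> Dx e0; have [r r0 fr] := near_isometry emb (n1 x) e0.
have [h1 h10 H1] := primitive_left nD K0 DnP x r0.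
have [h2 h20 H2] := primitive_right nD K0 DnP x r0.
rewrite Dx subr0 in H1.
have nr y : x - Num.min h1 h2 < y -> y < x + Num.min h1 h2 -> enorm (n y - n x) < r.
  rewrite ltrBlDl -ltrBlDr lt_min => /andP[y1 _].
  rewrite -ltrBlDl lt_min => /andP[_ y2].
  have [yx|xy|->] := ltgtP y x; last by rewrite subrr enorm0.
    by apply: H1 => //; lra.
  by apply: H2 => //; lra.
exists (Num.min h1 h2); first by rewrite lt_min h10.
move=> s t xs st tx; rewrite -!fn; apply: fr => //; apply: nr => //.
  exact: lt_le_trans xs st.
exact: le_lt_trans st tx.
Qed.

Lemma tot_var_lift A : measurable A -> (forall x, A x -> vcharge_val Dn [set x] = 0) ->
  tot_var Dn A = tot_var Dv A.
Proof.
move=> mA A0; have cov := @finite_measure_cover R P.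
have K0' := ltW K0.
apply/eqP; rewrite eq_le; apply/andP; split; apply: lee_mul_gt1; rewrite ?tot_var_ge0// => c c1.
- have c0 : 0 < c by rewrite (lt_trans _ c1).
  apply: (tot_var_le_local K0' (ltW c0) DnP DvP cov mA) => x Ax.
  (* The relative error 1 - 1 / c gives |v t - v s| >= |n t - n s| / c; in the other direction, c -
     1 gives |v t - v s| <= c |n t - n s|. *)
  have e0 : 0 < 1 - c^-1 by rewrite subr_gt0 invf_lt1.
  have [h h0 H] := lift_near_isometry (A0 x Ax) e0; exists h => // s t xs st tx.
  have := H s t xs st tx; rewrite vD// nD// ler_norml => /andP[+ _].
  rewrite mulrBl mul1r opprB lerBrDr subrK => {}H.
  by rewrite -ler_pdivrMl.
- have c0 : 0 < c by rewrite (lt_trans _ c1).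
  apply: (tot_var_le_local K0' (ltW c0) DvP DnP cov mA) => x Ax.
  have e0 : 0 < c - 1 by rewrite subr_gt0.
  have [h h0 H] := lift_near_isometry (A0 x Ax) e0; exists h => // s t xs st tx.
  have := H s t xs st tx; rewrite vD// nD// ler_norml => /andP[_].
  by rewrite mulrBl mul1r lerBlDr subrK.
Qed.

End lift.

Lemma vcharge_of_increments (R : realType) (m : nat) (n : R -> 'rV[R]_m) (C : R)
    (P : {finite_measure set (measurableTypeR R) -> \bar R}) : 0 <= C ->
  (forall a b, a <= b -> enorm (n b - n a) <= C * (mass P b - mass P a)) ->
  exists Dn : vcharge (R := R) m,
    (forall a b, a <= b -> n b - n a = vcharge_val Dn `]a, b]%classic) /\
    exists2 K : R, 0 < K & forall A, measurable A ->
      (forall i, `|Dn i A| <= K%:E * P A)%E /\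
      ((enorm (vcharge_val Dn A))%:E <= K%:E * P A)%E.
Proof.
move=> C0 nC.
have ex i : exists nu : {charge set (measurableTypeR R) -> \bar R},
    (forall a b, a <= b -> nu `]a, b]%classic = (n b 0 i - n a 0 i)%:E) /\
    forall A, measurable A -> (`|nu A| <= (3 * C)%:E * P A)%E.
  apply: charge_of_increments => // a b ab.
  by have := nC a b ab; apply: le_trans; have := normr_coord_le (n b - n a) i; rewrite !mxE.
have [Dn hDn] := choice ex; exists Dn; split.
  by move=> a b ab; apply/rowP => i; rewrite !mxE (hDn i).1.
have K1 : 3 * C <= m%:R * (3 * C) + 3 * C + 1.
  have : 0 <= m%:R * (3 * C) by rewrite !mulr_ge0.
  lra.
exists (m%:R * (3 * C) + 3 * C + 1); first by rewrite ltr_pwDr// addr_ge0// !mulr_ge0.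
move=> A mA; split=> [i|].
  by rewrite (le_trans ((hDn i).2 A mA))// lee_wpmul2r.
rewrite (@le_trans _ _ (\sum_i `|vcharge_val Dn A 0 i|)%:E)//.
  by rewrite lee_fin enorm_le_sum.
rewrite -sumEFin (@le_trans _ _ (\sum_(i < m) (3 * C)%:E * P A)%E)//.
  apply: lee_sum => i _; rewrite mxE -abse_EFin fineK ?fin_num_measure//.
  exact: (hDn i).2.
have Pf : P A \is a fin_num by rewrite fin_num_measure.
rewrite -(fineK Pf) -EFinM sumEFin sumr_const card_ord -EFinM lee_fin -[leLHS]mulr_natl mulrA.
rewrite ler_wpM2r ?fine_ge0//.
lra.
Qed.

Theorem proposition5p1 (R : realType) (d D : nat)
    (iota : set 'rV[R]_d -> 'rV[R]_D) (I : set R) (u : R -> 'rV[R]_D) :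
  (2 <= d)%N ->
  isometric_embedding iota ->
  open I -> is_interval I ->
  BV I (iota @` RP (d := d)) u ->
  exists n : R -> 'rV[R]_d,
    [/\ BV I (sphere (d := d)) n,
        {ae @lebesgue_measure R, forall x, I x -> u x = iota (proj_class (n x))},
        exists (Dau Dcu Dju : vcharge D) (Dan Dcn Djn : vcharge d),
          [/\ BV_parts I u Dau Dcu Dju,
              BV_parts I n Dan Dcn Djn,
              tot_var Dan I = tot_var Dau I &
              tot_var Dcn I = tot_var Dcu I],
        jump_set I n = jump_set I u &
        forall x, jump_set I u x ->
          exists Q : 'M[R]_d, SO Q /\
            forall np nm, jump_traces I n x np nm ->
              (rotate (invmx Q) @` closure (cap (d := d))) np /\
              (rotate (invmx Q) @` closure (cap (d := d))) nm].
Proof.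
move=> d2 emb oI iI [lu uN [Du dDu]]; rewrite emb_RPE in uN.
have mI : measurable I by exact: open_measurable.
have d0 : (0 < d)%N by exact: ltnW.
have S0 : emb_line iota @` sphere (d := d) !=set0.
  by exists (emb_line iota (last_vec d)), (last_vec d) => //; exact: sphere_last_vec.
have [P [v [vN uv vD DuP P0]]] :=
  BV_representative oI iI lu dDu (closed_emb_line emb) S0 uN.
have [C C0 fC] := emb_line_inv_lipschitz emb.
have vM a b : a <= b -> enorm (v b - v a) <= mass P b - mass P a.
  by move=> ab; rewrite vD// -lee_fin -mass_itv// DuP.
have [n [n1 fn nC nl]] := lifting emb C0 fC (@mass_nd R P) (@mass_rc R P)
  (mass_ge0 P) (mass_le P) vN vM.
have [Dn [nD [K K0 DnK]]] := vcharge_of_increments (ltW C0) nC.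
(* A common constant for [Du], dominated with constant 1, and [Dn], dominated with constant [K]. *)
pose K1 := K + 1.
have K10 : 0 < K1 by rewrite addr_gt0.
have DvP A : measurable A -> ((enorm (vcharge_val Du A))%:E <= K1%:E * P A)%E.
  move=> mA; rewrite (le_trans (DuP A mA))// -[leLHS]mul1e lee_wpmul2r// lee_fin.
  by rewrite lerDr ltW.
have DnP A : measurable A -> ((enorm (vcharge_val Dn A))%:E <= K1%:E * P A)%E.
  move=> mA; rewrite (le_trans (DnK A mA).2)// lee_wpmul2r// lee_fin.
  by rewrite lerDl.
have Dn0 i A : measurable A -> A `&` I = set0 -> Dn i A = 0%E.
  move=> mA AI; apply/eqP; rewrite -abse_eq0 eq_le abse_ge0 andbT.
  by rewrite (le_trans ((DnK A mA).1 i))// P0// mule0.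
have BVn : BV I (sphere (d := d)) n.
  by apply: (bounded_primitive_BV oI nD Dn0 (B := 1) n1) => x; rewrite n1.
have [ln _ _] := BVn.
have mu i : measurable_fun I (fun x => u x 0 i) by case: (lu i).
have mn i : measurable_fun I (fun x => n x 0 i) by case: (ln i).
have nn : {ae @lebesgue_measure R, forall x, I x -> n x = n x} by exact: aeW.
have Jn := jump_setE oI mn nn nD K10 DnP.
have Ju := jump_setE oI mu uv vD K10 DvP.
have atom := lift_atom emb n1 fn nl vD nD K10 DvP DnP.
have JE : jump_set I n = jump_set I u.
  rewrite Jn Ju; apply/seteqP; split=> x /= [Ix Dx]; split=> // Dx'.
    by apply: Dx; exact/atom.
  by apply: Dx; exact/atom.
have mJu := measurable_jump_set oI mu uv vD K10 DvP.
have mJn := measurable_jump_set oI mn nn nD K10 DnP.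
have [Z [mZ Z0 PZ]] := lebesgue_null_exhaustion P.
(* Points are Lebesgue-null, so all atoms lie in [Z]; hence the absolutely continuous parts live on
   a set without jump points, as [tot_var_lift] requires. *)
have JZ x : ~ Z x -> vcharge_val Dn [set x] = 0.
  move=> nZx; apply/enorm_eq0/eqP; rewrite eq_le enorm_ge0 andbT -lee_fin.
  rewrite (le_trans (DnP _ _))//.
  have <- : [set x] `\` Z = [set x] by apply/seteqP; split=> [y []//|y /= ->].
  by rewrite PZ ?mule0// lebesgue_measure_set1.
have dn := primitive_distributional_derivative oI nD Dn0.
exists n; split=> //.
- by apply: (@filterS _ _ (ae_filter_ringOfSetsType _)) uv => x uvx Ix; rewrite uvx// -fn.
- exists (vrestr Du (measurableC mZ)), (vrestr (vrestr Du mZ) (measurableC mJu)),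
    (vrestr (vrestr Du mZ) mJu), (vrestr Dn (measurableC mZ)),
    (vrestr (vrestr Dn mZ) (measurableC mJn)), (vrestr (vrestr Dn mZ) mJn).
  have mnZ := measurableC mZ.
  split.
  + exact: (BV_parts_restr mZ mJu dDu DvP Z0 PZ).
  + exact: (BV_parts_restr mZ mJn dn DnP Z0 PZ).
  + rewrite !tot_var_restr//; apply: (tot_var_lift emb n1 fn vD nD K10 DvP DnP).
      exact: measurableI.
    by move=> x [_ /JZ].
  + have mIJ : measurable (I `&` ~` jump_set I u).
      by apply: measurableI => //; exact: measurableC.
    rewrite (tot_var_restr _ (measurableC mJn) mI) (tot_var_restr _ (measurableC mJu) mI) JE.
    rewrite !tot_var_restr//; apply: (tot_var_lift emb n1 fn vD nD K10 DvP DnP).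
      exact: measurableI.
    move=> x [[Ix +] _]; rewrite -JE Jn /= => nJ.
    by apply: contrapT => Dx; apply: nJ.
(* The traces of [n] at [x] can only be [n x] and its left limit, so the rotation is built from
   these two vectors. *)
- move=> x /[dup] Jx; rewrite Ju /= => -[Ix _].
  have [Q SOQ [capn capl]] := rotate_closure_cap d2 (n1 x)
    (sphere_nleft n1 nl vD nD K10 DvP DnP x) (dot_nleft_ge0 n1 nl vD nD K10 DvP DnP x).
  exists Q; split=> // np nm /(jump_tracesE oI mn nn nD K10 DnP _ _ Ix)[_ -> ->].
  by split.
Qed.
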